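(* Let $f\in\mathcal{A}$, let $$\mathcal{G}(z):=1-\frac{zf'(z)}{f(z)}+\frac{zf''(z)}{f'(z)},\qquad z\in\mathbb{D},$$ let $$\varphi_{RL}(z):=\sqrt{2}-(\sqrt{2}-1)\sqrt{\frac{1-z}{1+2(\sqrt{2}-1)z}},\qquad z\in\mathbb{D},$$ $$g_0(z):=\sqrt{2(\sqrt{2}-1)}\;\tan^{-1}\left(\frac{\sqrt{2(\sqrt{2}-1)}\left(\sqrt{2(\sqrt{2}-1)z+1}-\sqrt{1-z}\right)}{2(\sqrt{2}-1)\sqrt{1-z}+\sqrt{2(\sqrt{2}-1)z+1}}\right),$$ and let $\beta\in\mathbb{R}$. Then each of the following conditions implies $f\in\mathcal{S}^*_{Ne}$: (a) $1+\beta\,\mathcal{G}(z)\left(\dfrac{zf'(z)}{f(z)}\right)\prec\varphi_{RL}(z)$, for $\beta\geq-\dfrac32\left(2(\sqrt{2}-1)\log\left(\dfrac12\left(\sqrt{1-2(\sqrt{2}-1)}+\sqrt{2}\right)\right)+g_0(-1)\right)$; (b) $1+\beta\,\mathcal{G}(z)\prec\varphi_{RL}(z)$, for $\beta\geq\dfrac{2(\sqrt{2}-1)\log\left(\frac12\sqrt{2(\sqrt{2}-1)+1}\right)+g_0(1)}{\log(5/3)}$; (c) $1+\beta\,\mathcal{G}(z)\left(\dfrac{zf'(z)}{f(z)}\right)^{-1}\prec\varphi_{RL}(z)$, for $\beta\geq\dfrac52\left(2(\sqrt{2}-1)\log\left(\frac12\sqrt{2(\sqrt{2}-1)+1}\right)+g_0(1)\right)$.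 The bounds on $\beta$ are sharp.
   Context: $\mathbb{D}=\{z\in\mathbb{C}:|z|<1\}$, $\mathcal{H}$ is the set of all analytic functions on $\mathbb{D}$, and $\mathcal{A}$ is the set of $f\in\mathcal{H}$ with $f(0)=0$ and $f'(0)=1$. For $f,g\in\mathcal{H}$, $f\prec g$ ($f$ is subordinate to $g$) means that there is $w\in\mathcal{H}$ with $w(0)=0$ and $|w(z)|<1$ for $z\in\mathbb{D}$ such that $f(z)=g(w(z))$ on $\mathbb{D}$; in particular, writing a subordination presupposes that both sides are analytic in $\mathbb{D}$ (the removable singularity of $zf'(z)/f(z)$ at $0$ being filled with value $1$). With $\varphi_{Ne}(z):=1+z-z^3/3$, $\mathcal{S}^*_{Ne}:=\{f\in\mathcal{A}:zf'(z)/f(z)\prec\varphi_{Ne}(z)\}$. Square roots are principal branches (so $\varphi_{RL}(0)=1$), $\tan^{-1}$ is the principal arctangent, and $\log$ of a positive number is the natural logarithm. That a bound $\beta\ge\beta_0$ is sharp means that $\beta_0$ cannot be replaced by any smaller real number so that the implication remains valid for all $f\in\mathcal{A}$ and all $\beta$ at least that number. *)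

(* Defs.v *)
From Stdlib Require Import Reals.
From Coquelicot Require Import Coquelicot.

Open Scope R_scope.

Definition in_disk (z : C) : Prop := Cmod z < 1.

(* Complex differentiability at every point of the open disk; values outside
   the disk are irrelevant. *)
Definition analytic (f : C -> C) : Prop :=
  forall z : C, in_disk z -> @ex_derive C_AbsRing C_NormedModule f z.

Definition class_A (f : C -> C) : Prop :=
  analytic f /\ f (RtoC 0) = RtoC 0 /\ C_derive f (RtoC 0) = RtoC 1.

Definition subordinate (f g : C -> C) : Prop :=
  analytic f /\ analytic g /\
  exists w : C -> C,
    analytic w /\ w (RtoC 0) = RtoC 0 /\
    (forall z, in_disk z -> Cmod (w z) < 1) /\
    (forall z, in_disk z -> f z = g (w z)).

(* z f'(z) / f(z), with its removable singularity at 0 filled. At a zero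
   z <> 0 of f the quotient has a pole, so no function taking these values at
   the neighbouring points is analytic, whatever the value at the zero. *)
Definition log_quot (f : C -> C) (z : C) : C :=
  match Ceq_dec z (RtoC 0) with
  | left _ => RtoC 1
  | right _ => (z * C_derive f z / f z)%C
  end.

Definition calG (f : C -> C) (z : C) : C :=
  (1 - log_quot f z + z * C_derive (C_derive f) z / C_derive f z)%C.

Definition phi_Ne (z : C) : C := (1 + z - z * z * z / 3)%C.

Definition S_Ne (f : C -> C) : Prop :=
  class_A f /\ subordinate (log_quot f) phi_Ne.

(* Principal branch: nonnegative real part, cut along the negative reals. *)
Definition Csqrt (z : C) : C :=
  (sqrt ((Cmod z + Re z) / 2),
   (if Rle_dec 0 (Im z) then 1 else -1) * sqrt ((Cmod z - Re z) / 2)).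

Definition phi_RL (z : C) : C :=
  (RtoC (sqrt 2) - RtoC (sqrt 2 - 1) *
     Csqrt ((1 - z) / (1 + RtoC (2 * (sqrt 2 - 1)) * z)))%C.

(* Needed only at x = -1 and x = 1; on [-1, 1] the arguments of the square
   roots and of the arctangent are real (and those of the roots nonnegative),
   so the principal complex branches reduce to the real functions. *)
Definition g0 (x : R) : R :=
  sqrt (2 * (sqrt 2 - 1)) *
  atan (sqrt (2 * (sqrt 2 - 1)) *
          (sqrt (2 * (sqrt 2 - 1) * x + 1) - sqrt (1 - x)) /
        (2 * (sqrt 2 - 1) * sqrt (1 - x) + sqrt (2 * (sqrt 2 - 1) * x + 1))).

Definition bound_a : R :=
  - (3 / 2) *
  (2 * (sqrt 2 - 1) * ln (1 / 2 * (sqrt (1 - 2 * (sqrt 2 - 1)) + sqrt 2))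
   + g0 (-1)).

Definition bound_b : R :=
  (2 * (sqrt 2 - 1) * ln (1 / 2 * sqrt (2 * (sqrt 2 - 1) + 1)) + g0 1)
  / ln (5 / 3).

Definition bound_c : R :=
  5 / 2 *
  (2 * (sqrt 2 - 1) * ln (1 / 2 * sqrt (2 * (sqrt 2 - 1) + 1)) + g0 1).

(* The points where no denominator of [log_quot f], [calG f] and
   [/ log_quot f] vanishes (at 0 for f in A, the quotient being filled). *)
Definition regular_point (f : C -> C) (z : C) : Prop :=
  (z <> RtoC 0 -> f z <> RtoC 0) /\ C_derive f z <> RtoC 0.

(* A subordination whose left-hand side is an expression E in f with such
   denominators: E is read as an analytic function on the disk, removable
   singularities being filled. *)
Definition expr_subordinate (f E g : C -> C) : Prop :=
  exists F : C -> C,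
    (forall z, in_disk z -> regular_point f z -> F z = E z) /\
    subordinate F g.

Definition cond_a (beta : R) (f : C -> C) : Prop :=
  expr_subordinate f
    (fun z => 1 + RtoC beta * calG f z * log_quot f z)%C phi_RL.

Definition cond_b (beta : R) (f : C -> C) : Prop :=
  expr_subordinate f (fun z => 1 + RtoC beta * calG f z)%C phi_RL.

Definition cond_c (beta : R) (f : C -> C) : Prop :=
  expr_subordinate f
    (fun z => 1 + RtoC beta * calG f z * / log_quot f z)%C phi_RL.

Definition valid_bound (cond : R -> (C -> C) -> Prop) (b : R) : Prop :=
  forall (f : C -> C) (beta : R),
    class_A f -> b <= beta -> cond beta f -> S_Ne f.

Definition sharp_bound (cond : R -> (C -> C) -> Prop) (b0 : R) : Prop :=
  forall b : R, b < b0 -> ~ valid_bound cond b.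

(* Main.v *)
Require Import Defs.
From Stdlib Require Import Reals Lra ClassicalEpsilon.
From Coquelicot Require Import Coquelicot.

Open Scope R_scope.

(** Write p = z f' / f. The left-hand sides of (a), (b), (c) are 1 + beta z p', 1 + beta z p' / p
    and 1 + beta z p' / p^2, so if L is the primitive of (phi_RL (w (z)) - 1) / (beta z) vanishing
    at 0, then p is 1 + L, exp L and 1 / (1 - L) respectively. A Moebius map followed by a square
    root sends |z| <= t into the disk with real diameter [phi_RL (-t), phi_RL t]; by Schwarz's lemma
    this disk contains phi_RL (w (z)) for |z| = t, and integrating along rays puts beta L into the
    disk with diameter [-A, B], where -A and B are the values at -1 and 1 of the real primitive of
    (phi_RL (x) - 1) / x. Under the stated bounds on beta each of the three maps sends that disk into
    |p - 1| < 2/3, which the nephroid domain contains. In (b) this uses (A + B) log (5/3) <= 4 B / 3.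
    For w (z) = z the function p reaches real values arbitrarily close to the images of -A / beta
    or B / beta, while the nephroid domain meets the real line in (1/3, 5/3); this gives sharpness. *)

(** * Complex differentiability *)

(** [analytic] asks for nothing but a complex derivative at each point of the disk, and conditions
    (a), (b), (c) constrain [f] only at its regular points. So neither the differentiability of f'
    nor the absence of zeros of f(z) / z and f' is given. The former comes out of Cauchy's formula.
    The latter is the main obstacle: the differential equation for p can be integrated from 0 only
    along a ray without singular points, and it is the resulting estimate |p - 1| < 2/3 that keeps p
    away from 0 and infinity and lets the ray be continued. The radius 2/3 is the minimum of |w -
    w^3 / 3| on |w| = 1. The disk |p - 1| < 2/3 meets the real line in the same interval as the
    nephroid domain, and the extremal functions leave that domain on the real line, so working with
    the disk costs nothing in the bounds. *)

Lemma is_derive_C_iff (f : C -> C) (z l : C) :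
  @is_derive C_AbsRing C_NormedModule f z l <->
  forall eps, 0 < eps -> exists d, 0 < d /\ forall y, Cmod (y - z) < d ->
    Cmod (f y - f z - l * (y - z)) <= eps * Cmod (y - z).
Proof.
split.
- intros [_ H] eps Heps.
  destruct (H z (fun P HP => HP) (mkposreal eps Heps)) as [d Hd].
  exists d; split; [apply cond_pos|]; intros y Hy.
  specialize (Hd y Hy). simpl in Hd.
  replace (f y - f z - l * (y - z))%C with (minus (minus (f y) (f z)) (scal (minus y z) l)).
  2:{ unfold minus, scal, plus, opp; simpl. unfold mult; simpl. ring. }
  exact Hd.
- intros H. split; [apply is_linear_scal_l|].
  intros x Hx.
  (* [is_derive] speaks of every limit point of the filter of neighbourhoods of [z]; uniqueness of
     limits leaves [z] alone. *)
  assert (x = z). { symmetry. apply (@is_filter_lim_locally_unique _ (AbsRing_NormedModule C_AbsRing) z x Hx). }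
  subst x. intros [eps Heps]. destruct (H eps Heps) as [d [Hd Hd']].
  exists (mkposreal d Hd). intros y Hy. specialize (Hd' y Hy). simpl.
  replace (f y - f z - l * (y - z))%C with (minus (minus (f y) (f z)) (scal (minus y z) l)) in Hd'.
  2:{ unfold minus, scal, plus, opp; simpl. unfold mult; simpl. ring. }
  exact Hd'.
Qed.

Lemma is_derive_RC_iff (f : R -> C) (t : R) (l : C) :
  @is_derive R_AbsRing C_R_NormedModule f t l <->
  forall eps, 0 < eps -> exists d, 0 < d /\ forall s, Rabs (s - t) < d ->
    Cmod (f s - f t - RtoC (s - t) * l) <= eps * Rabs (s - t).
Proof.
assert (E : forall s, norm (minus (minus (f s) (f t)) (scal (minus s t) l) : C_R_NormedModule) = Cmod (f s - f t - RtoC (s - t) * l)).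
{ intros s. rewrite Cmod_norm. f_equal. unfold minus, scal, plus, opp; simpl. unfold prod_plus, prod_opp, prod_scal. simpl.
  unfold scal, plus, opp; simpl. unfold mult; simpl. apply injective_projections; simpl; ring. }
split.
- intros [_ H] eps Heps.
  destruct (H t (fun P HP => HP) (mkposreal eps Heps)) as [d Hd].
  exists d; split; [apply cond_pos|]; intros y Hy.
  specialize (Hd y Hy). rewrite <- E. exact Hd.
- intros H. split; [apply is_linear_scal_l|].
  intros x Hx.
  assert (x = t). { symmetry. apply (@is_filter_lim_locally_unique _ (AbsRing_NormedModule R_AbsRing) t x Hx). }
  subst x. intros [eps Heps]. destruct (H eps Heps) as [d [Hd Hd']].
  exists (mkposreal d Hd). intros y Hy. specialize (Hd' y Hy). rewrite <- E in Hd'. exact Hd'.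
Qed.

(** The balls of the product structure on [C] are squares; comparing them with the disks of [Cmod]
    costs the factor [sqrt 2], here and in [locally_C_iff]. *)
Lemma continuous_C_iff {U : UniformSpace} (f : U -> C) (x : U) :
  continuous f x <-> forall eps, 0 < eps -> locally x (fun y => Cmod (f y - f x) < eps).
Proof.
split.
- intros H eps Heps.
  assert (H2 : 0 < eps / sqrt 2) by (apply Rdiv_lt_0_compat; [lra|apply sqrt_lt_R0; lra]).
  specialize (H (fun y => @ball C_UniformSpace (f x) (eps / sqrt 2) y)).
  assert (L : locally (f x) (fun y : C_UniformSpace => ball (f x) (eps / sqrt 2) y)) by (exists (mkposreal _ H2); intros; assumption).
  specialize (H L). unfold filtermap in H. apply filter_imp with (2 := H).
  intros y Hy. apply (C_NormedModule_mixin_compat2 _ _ (mkposreal _ H2)) in Hy. simpl in Hy.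
  replace (sqrt 2 * (eps / sqrt 2)) with eps in Hy by (field; apply Rgt_not_eq, sqrt_lt_R0; lra).
  exact Hy.
- intros H P [d Hd]. unfold filtermap. generalize (H d (cond_pos d)). apply filter_imp.
  intros y Hy. apply Hd. apply C_NormedModule_mixin_compat1. exact Hy.
Qed.

Lemma locally_C_iff (z : C) (P : C -> Prop) :
  @locally C_UniformSpace z P <-> exists d, 0 < d /\ forall y, Cmod (y - z) < d -> P y.
Proof.
split.
- intros [d Hd]. exists d; split; [apply cond_pos|]. intros y Hy. apply Hd. now apply C_NormedModule_mixin_compat1.
- intros [d [Hd H]].
  assert (H2 : 0 < d / sqrt 2) by (apply Rdiv_lt_0_compat; [lra|apply sqrt_lt_R0; lra]).
  exists (mkposreal _ H2). intros y Hy. apply H.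
  apply (C_NormedModule_mixin_compat2 _ _ (mkposreal _ H2)) in Hy. simpl in Hy.
  replace (sqrt 2 * (d / sqrt 2)) with d in Hy by (field; apply Rgt_not_eq, sqrt_lt_R0; lra).
  exact Hy.
Qed.

(* Coquelicot states many equalities at carriers that are only convertible to [C], where [ring]
   and [field] fail. *)
Ltac cring := intros; cbv beta; match goal with |- @eq _ ?a ?b => change (@eq C a b) end; ring.
Ltac cfield := cbv beta; match goal with |- @eq _ ?a ?b => change (@eq C a b) end; field.

Notation Cd := (@is_derive C_AbsRing C_NormedModule).
Notation Rd := (@is_derive R_AbsRing C_R_NormedModule).

(** * Continuity of complex-valued functions *)

Lemma continuous_Re {U : UniformSpace} (f : U -> C) x : continuous f x -> continuous (fun y => Re (f y)) x.
Proof.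
intros H. apply (continuous_comp f Re). exact H. unfold Re. destruct (f x) as [a b]. apply (@continuous_fst R_UniformSpace R_UniformSpace).
Qed.

Lemma continuous_Im {U : UniformSpace} (f : U -> C) x : continuous f x -> continuous (fun y => Im (f y)) x.
Proof.
intros H. apply (continuous_comp f Im). exact H. unfold Im. destruct (f x) as [a b]. apply (@continuous_snd R_UniformSpace R_UniformSpace).
Qed.

Lemma continuous_ReIm {U : UniformSpace} (f : U -> C) x :
  continuous (fun y => Re (f y)) x -> continuous (fun y => Im (f y)) x -> continuous f x.
Proof.
intros H1 H2. apply (continuous_ext (fun y => (Re (f y), Im (f y)))).
  intros y. now destruct (f y).
apply (continuous_comp_2 (fun y => Re (f y)) (fun y => Im (f y)) (fun a b => (a, b))); auto.
apply (continuous_ext (fun y => y)). now intros []. apply continuous_id.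
Qed.

Lemma continuous_RtoC {U : UniformSpace} (f : U -> R) x : continuous f x -> continuous (fun y => RtoC (f y)) x.
Proof. intros H. apply continuous_ReIm; simpl. exact H. apply continuous_const. Qed.

Lemma continuous_Cplus {U : UniformSpace} (f g : U -> C) x :
  continuous f x -> continuous g x -> continuous (fun y => (f y + g y)%C) x.
Proof.
intros Hf Hg. apply continuous_ReIm; simpl.
- apply (continuous_plus (V := R_NormedModule) (fun y => Re (f y)) (fun y => Re (g y))); now apply continuous_Re.
- apply (continuous_plus (V := R_NormedModule) (fun y => Im (f y)) (fun y => Im (g y))); now apply continuous_Im.
Qed.

Lemma continuous_Copp {U : UniformSpace} (f : U -> C) x :
  continuous f x -> continuous (fun y => (- f y)%C) x.
Proof.
intros Hf. apply continuous_ReIm; simpl.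
- apply (continuous_opp (V := R_NormedModule) (fun y => Re (f y))); now apply continuous_Re.
- apply (continuous_opp (V := R_NormedModule) (fun y => Im (f y))); now apply continuous_Im.
Qed.

Lemma continuous_Cminus {U : UniformSpace} (f g : U -> C) x :
  continuous f x -> continuous g x -> continuous (fun y => (f y - g y)%C) x.
Proof. intros Hf Hg. apply continuous_Cplus; auto. now apply continuous_Copp. Qed.

Lemma continuous_Cmult {U : UniformSpace} (f g : U -> C) x :
  continuous f x -> continuous g x -> continuous (fun y => (f y * g y)%C) x.
Proof.
intros Hf Hg.
pose proof (continuous_Re f x Hf) as F1. pose proof (continuous_Im f x Hf) as F2.
pose proof (continuous_Re g x Hg) as G1. pose proof (continuous_Im g x Hg) as G2.
apply continuous_ReIm; simpl.
- apply (continuous_minus (V := R_NormedModule) (fun y => Re (f y) * Re (g y)) (fun y => Im (f y) * Im (g y)));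
  apply (continuous_mult (K := R_AbsRing)); assumption.
- apply (continuous_plus (V := R_NormedModule) (fun y => Re (f y) * Im (g y)) (fun y => Im (f y) * Re (g y)));
  apply (continuous_mult (K := R_AbsRing)); assumption.
Qed.

Lemma continuous_Cmod {U : UniformSpace} (f : U -> C) x :
  continuous f x -> continuous (fun y => Cmod (f y)) x.
Proof.
intros Hf. apply (continuous_comp f Cmod _ Hf).
intros P [d Hd]. apply locally_C_iff. exists d; split; [apply cond_pos|]. intros y Hy. apply Hd.
change (Rabs (Cmod y - Cmod (f x)) < d). apply Rle_lt_trans with (2 := Hy).
apply Rabs_le.
generalize (Cmod_triangle (y - f x) (f x)) (Cmod_triangle (f x - y) y).
replace (y - f x + f x)%C with y by ring. replace (f x - y + y)%C with (f x) by ring.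
rewrite <- (Cmod_opp (f x - y)). replace (- (f x - y))%C with (y - f x)%C by ring. lra.
Qed.

Lemma Cnorm2_gt_0 (z : C) : z <> 0 -> 0 < Re z ^ 2 + Im z ^ 2.
Proof. intros H. rewrite <- Cmod2_alt. apply pow_lt. now apply Cmod_gt_0. Qed.

Lemma continuous_Cinv {U : UniformSpace} (f : U -> C) x :
  f x <> 0 -> continuous f x -> continuous (fun y => (/ f y)%C) x.
Proof.
intros H0 Hf.
pose proof (continuous_Re f x Hf) as F1. pose proof (continuous_Im f x Hf) as F2.
assert (N : continuous (fun y => Re (f y) ^ 2 + Im (f y) ^ 2) x).
{ apply (continuous_plus (V := R_NormedModule) (fun y => Re (f y) ^ 2) (fun y => Im (f y) ^ 2)).
  - apply (continuous_ext (fun y => Re (f y) * Re (f y))). intros; simpl; ring. now apply (continuous_mult (K := R_AbsRing)).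
  - apply (continuous_ext (fun y => Im (f y) * Im (f y))). intros; simpl; ring. now apply (continuous_mult (K := R_AbsRing)). }
assert (NI : continuous (fun y => / (Re (f y) ^ 2 + Im (f y) ^ 2)) x).
{ apply (continuous_comp _ Rinv _ N). apply continuous_Rinv. apply Rgt_not_eq, Cnorm2_gt_0, H0. }
apply continuous_ReIm; simpl.
- apply (continuous_mult (K := R_AbsRing) (fun y => Re (f y))). assumption. exact NI.
- apply (continuous_mult (K := R_AbsRing) (fun y => - Im (f y))). now apply (continuous_opp (V := R_NormedModule) (fun y => Im (f y))). exact NI.
Qed.

(** Caratheodory's form of differentiability: the slope, extended by [l] at [z], is continuous
    there. It turns the sum, product, quotient and chain rules into identities between slopes,
    without further estimates. *)
Lemma Cd_carath (f : C -> C) z l : Cd f z l ->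
  exists q : C -> C, continuous q z /\ q z = l /\ forall y, (f y - f z = q y * (y - z))%C.
Proof.
intros H. rewrite is_derive_C_iff in H.
exists (fun y => if Ceq_dec y z then l else ((f y - f z) / (y - z))%C). split; [|split].
- apply continuous_C_iff. intros eps He. apply locally_C_iff.
  destruct (H (eps / 2)) as [d [Hd Hd']]; [lra|].
  exists d; split; auto. intros y Hy. destruct (Ceq_dec z z) as [_|]; [|easy].
  destruct (Ceq_dec y z) as [->|Hne].
    replace (l - l)%C with (RtoC 0) by ring. rewrite Cmod_0. lra.
  specialize (Hd' y Hy).
  assert (y - z <> 0)%C. { intros E. apply Hne. replace y with (y - z + z)%C by ring. rewrite E. ring. }
  replace ((f y - f z) / (y - z) - l)%C with ((f y - f z - l * (y - z)) / (y - z))%C by (field; auto).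
  rewrite Cmod_div by auto. pose proof (proj1 (Cmod_gt_0 _) H0).
  apply Rle_lt_trans with (eps / 2); [|lra]. apply Rle_div_l; auto.
- now destruct (Ceq_dec z z).
- intros y. destruct (Ceq_dec y z) as [->|Hne]; [ring|]. field. intros E. apply Hne. replace y with (y - z + z)%C by ring. rewrite E. ring.
Qed.

(** The slope identity is local, so that [Cd_inv] can use it where [f] does not vanish. *)
Lemma carath_Cd (f q : C -> C) z : continuous q z ->
  @locally C_UniformSpace z (fun y => (f y - f z = q y * (y - z))%C) -> Cd f z (q z).
Proof.
intros Hq He. apply is_derive_C_iff. intros eps Heps.
apply locally_C_iff in He. destruct He as [d1 [Hd1 He]].
rewrite continuous_C_iff in Hq. specialize (Hq eps Heps). apply locally_C_iff in Hq.
destruct Hq as [d2 [Hd2 Hq]].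
exists (Rmin d1 d2). split. now apply Rmin_glb_lt.
intros y Hy. rewrite He. 2: apply Rlt_le_trans with (1 := Hy), Rmin_l.
replace (q y * (y - z) - q z * (y - z))%C with ((q y - q z) * (y - z))%C by ring.
rewrite Cmod_mult. apply Rmult_le_compat_r. apply Cmod_ge_0. left. apply Hq.
apply Rlt_le_trans with (1 := Hy), Rmin_r.
Qed.

Lemma Rd_carath (f : R -> C) t l : Rd f t l ->
  exists q : R -> C, continuous q t /\ q t = l /\ forall s, (f s - f t = q s * RtoC (s - t))%C.
Proof.
intros H. rewrite is_derive_RC_iff in H.
exists (fun s => if Req_dec_T s t then l else ((f s - f t) / RtoC (s - t))%C). split; [|split].
- apply continuous_C_iff. intros eps He.
  destruct (H (eps / 2)) as [d [Hd Hd']]; [lra|].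
  exists (mkposreal d Hd). intros s Hs. specialize (Hd' s Hs).
  destruct (Req_dec_T t t) as [_|]; [|easy].
  destruct (Req_dec_T s t) as [->|Hne].
    replace (l - l)%C with (RtoC 0) by ring. rewrite Cmod_0. lra.
  assert (RtoC (s - t) <> 0)%C. { intros E. apply RtoC_inj in E. lra. }
  replace ((f s - f t) / RtoC (s - t) - l)%C with ((f s - f t - RtoC (s - t) * l) / RtoC (s - t))%C by (field; auto).
  rewrite Cmod_div by auto. pose proof (proj1 (Cmod_gt_0 _) H0).
  apply Rle_lt_trans with (eps / 2); [|lra]. apply Rle_div_l; auto. now rewrite Cmod_R.
- now destruct (Req_dec_T t t).
- intros s. destruct (Req_dec_T s t) as [->|Hne].
    replace (t - t) with 0 by ring. ring.
  field. intros E. apply RtoC_inj in E. lra.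
Qed.

Lemma carath_Rd (f q : R -> C) t : continuous q t ->
  locally t (fun s => (f s - f t = q s * RtoC (s - t))%C) -> Rd f t (q t).
Proof.
intros Hq He. apply is_derive_RC_iff. intros eps Heps.
rewrite continuous_C_iff in Hq. specialize (Hq eps Heps).
destruct (filter_and _ _ He Hq) as [d Hd].
exists d. split. apply cond_pos.
intros y Hy. destruct (Hd y Hy) as [E B]. rewrite E.
replace (q y * RtoC (y - t) - RtoC (y - t) * q t)%C with ((q y - q t) * RtoC (y - t))%C by ring.
rewrite Cmod_mult, Cmod_R. apply Rmult_le_compat_r. apply Rabs_pos. now left.
Qed.

Lemma Cd_continuous (f : C -> C) z l : Cd f z l -> continuous f z.
Proof.
intros H. destruct (Cd_carath _ _ _ H) as [q [Hq [_ E]]].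
apply (continuous_ext (fun y => f z + q y * (y - z))%C). intros y. rewrite <- E. cring.
apply continuous_Cplus. apply continuous_const. apply continuous_Cmult; auto.
apply continuous_Cminus. apply continuous_id. apply continuous_const.
Qed.

Lemma Rd_continuous (f : R -> C) z l : Rd f z l -> continuous f z.
Proof.
intros H. destruct (Rd_carath _ _ _ H) as [q [Hq [_ E]]].
apply (continuous_ext (fun y => f z + q y * RtoC (y - z))%C). intros y. rewrite <- E. cring.
apply continuous_Cplus. apply continuous_const. apply continuous_Cmult; auto.
apply continuous_RtoC. apply (continuous_minus (V := R_NormedModule)). apply continuous_id. apply continuous_const.
Qed.

Lemma Cd_const (c z : C) : Cd (fun _ => c) z (RtoC 0).
Proof. apply (carath_Cd _ (fun _ => RtoC 0)). apply continuous_const. apply filter_forall. intros y. cring. Qed.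

Lemma Cd_id (z : C) : Cd (fun y => y) z (RtoC 1).
Proof. apply (carath_Cd _ (fun _ => RtoC 1)). apply continuous_const. apply filter_forall. intros y. cring. Qed.

Lemma Cd_ext_loc (f g : C -> C) z l : @locally C_UniformSpace z (fun y => f y = g y) -> Cd f z l -> Cd g z l.
Proof.
intros E H. destruct (Cd_carath _ _ _ H) as [q [Hq [<- Eq]]]. apply carath_Cd; auto.
pose proof (locally_singleton _ _ E) as E0.
generalize E. apply filter_imp. intros y Ey. rewrite <- Ey, <- E0. apply Eq.
Qed.

Lemma Cd_eq (f : C -> C) z l l' : Cd f z l -> l = l' -> Cd f z l'.
Proof. now intros H <-. Qed.

Lemma Rd_eq (f : R -> C) z l l' : Rd f z l -> l = l' -> Rd f z l'.
Proof. now intros H <-. Qed.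

Lemma Cd_plus (f g : C -> C) z l m : Cd f z l -> Cd g z m -> Cd (fun y => f y + g y)%C z (l + m)%C.
Proof.
intros Hf Hg.
destruct (Cd_carath _ _ _ Hf) as [p [Hp [<- Ep]]]. destruct (Cd_carath _ _ _ Hg) as [q [Hq [<- Eq]]].
apply (carath_Cd _ (fun y => p y + q y)%C). now apply continuous_Cplus.
apply filter_forall. intros y. cbv beta.
replace (f y + g y - (f z + g z))%C with ((f y - f z) + (g y - g z))%C by ring. rewrite Ep, Eq. cring.
Qed.

Lemma Cd_mult (f g : C -> C) z l m : Cd f z l -> Cd g z m ->
  Cd (fun y => f y * g y)%C z (l * g z + f z * m)%C.
Proof.
intros Hf Hg.
destruct (Cd_carath _ _ _ Hf) as [p [Hp [<- Ep]]]. destruct (Cd_carath _ _ _ Hg) as [q [Hq [<- Eq]]].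
apply (carath_Cd _ (fun y => p y * g y + f z * q y)%C).
{ apply continuous_Cplus; apply continuous_Cmult; auto. apply (Cd_continuous _ _ _ Hg). apply continuous_const. }
apply filter_forall. intros y. cbv beta.
replace (f y * g y - f z * g z)%C with ((f y - f z) * g y + f z * (g y - g z))%C by ring. rewrite Ep, Eq. cring.
Qed.

Lemma Cd_opp (f : C -> C) z l : Cd f z l -> Cd (fun y => - f y)%C z (- l)%C.
Proof.
intros H. apply (Cd_ext_loc (fun y => (- RtoC 1) * f y)%C).
  apply filter_forall. cring.
apply (Cd_eq _ _ _ _ (Cd_mult _ _ _ _ _ (Cd_const (- RtoC 1)%C z) H)). cring.
Qed.

Lemma Cd_minus (f g : C -> C) z l m : Cd f z l -> Cd g z m -> Cd (fun y => f y - g y)%C z (l - m)%C.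
Proof. intros Hf Hg. apply Cd_plus; auto. now apply Cd_opp. Qed.

Lemma continuous_nonzero {U : UniformSpace} (f : U -> C) x : continuous f x -> f x <> 0 -> locally x (fun y => f y <> 0).
Proof.
intros H H0. rewrite continuous_C_iff in H. apply Cmod_gt_0 in H0. generalize (H _ H0).
apply filter_imp. intros y Hy E. rewrite E in Hy. replace (0 - f x)%C with (- f x)%C in Hy by ring. rewrite Cmod_opp in Hy. lra.
Qed.

Lemma Cd_inv (f : C -> C) z l : Cd f z l -> f z <> 0 -> Cd (fun y => / f y)%C z (- l / (f z * f z))%C.
Proof.
intros Hf H0. pose proof (Cd_continuous _ _ _ Hf) as Cf.
destruct (Cd_carath _ _ _ Hf) as [p [Hp [<- Ep]]].
apply (carath_Cd _ (fun y => - p y / (f y * f z))%C).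
{ apply continuous_Cmult. now apply continuous_Copp. apply continuous_Cinv. now apply Cmult_neq_0.
  apply continuous_Cmult; auto. apply continuous_const. }
generalize (continuous_nonzero f z Cf H0). apply filter_imp. intros y Hy.
replace (/ f y - / f z)%C with (- (f y - f z) / (f y * f z))%C by (cfield; auto). rewrite Ep. cfield; auto.
Qed.

Lemma Cd_div (f g : C -> C) z l m : Cd f z l -> Cd g z m -> g z <> 0 ->
  Cd (fun y => f y / g y)%C z ((l * g z - f z * m) / (g z * g z))%C.
Proof.
intros Hf Hg H0. apply (Cd_eq _ _ _ _ (Cd_mult _ _ _ _ _ Hf (Cd_inv _ _ _ Hg H0))). cfield; auto.
Qed.

Lemma Cd_comp (f g : C -> C) z l m : Cd g z m -> Cd f (g z) l -> Cd (fun y => f (g y)) z (l * m)%C.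
Proof.
intros Hg Hf. pose proof (Cd_continuous _ _ _ Hg) as Cg.
destruct (Cd_carath _ _ _ Hf) as [p [Hp [<- Ep]]]. destruct (Cd_carath _ _ _ Hg) as [q [Hq [<- Eq]]].
apply (carath_Cd _ (fun y => p (g y) * q y)%C).
{ apply continuous_Cmult; auto. now apply (continuous_comp g p). }
apply filter_forall. intros y. rewrite Ep, Eq. cring.
Qed.

Lemma Rd_comp (f : C -> C) (g : R -> C) t l m : Rd g t m -> Cd f (g t) l -> Rd (fun y => f (g y)) t (l * m)%C.
Proof.
intros Hg Hf. pose proof (Rd_continuous _ _ _ Hg) as Cg.
destruct (Cd_carath _ _ _ Hf) as [p [Hp [<- Ep]]]. destruct (Rd_carath _ _ _ Hg) as [q [Hq [<- Eq]]].
apply (carath_Rd _ (fun y => p (g y) * q y)%C).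
{ apply continuous_Cmult; auto. now apply (continuous_comp g p). }
apply filter_forall. intros y. rewrite Ep, Eq. cring.
Qed.

Lemma Rd_mult (f g : R -> C) z l m : Rd f z l -> Rd g z m ->
  Rd (fun y => f y * g y)%C z (l * g z + f z * m)%C.
Proof.
intros Hf Hg.
destruct (Rd_carath _ _ _ Hf) as [p [Hp [<- Ep]]]. destruct (Rd_carath _ _ _ Hg) as [q [Hq [<- Eq]]].
apply (carath_Rd _ (fun y => p y * g y + f z * q y)%C).
{ apply continuous_Cplus; apply continuous_Cmult; auto. apply (Rd_continuous _ _ _ Hg). apply continuous_const. }
apply filter_forall. intros y. cbv beta.
replace (f y * g y - f z * g z)%C with ((f y - f z) * g y + f z * (g y - g z))%C by ring. rewrite Ep, Eq. cring.
Qed.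

Lemma Rd_const (c : C) t : Rd (fun _ => c) t (RtoC 0).
Proof. apply (carath_Rd _ (fun _ => RtoC 0)). apply continuous_const. apply filter_forall. intros y. cring. Qed.

Lemma Rd_plus (f g : R -> C) z l m : Rd f z l -> Rd g z m -> Rd (fun y => f y + g y)%C z (l + m)%C.
Proof.
intros Hf Hg.
destruct (Rd_carath _ _ _ Hf) as [p [Hp [<- Ep]]]. destruct (Rd_carath _ _ _ Hg) as [q [Hq [<- Eq]]].
apply (carath_Rd _ (fun y => p y + q y)%C). now apply continuous_Cplus.
apply filter_forall. intros y. cbv beta.
replace (f y + g y - (f z + g z))%C with ((f y - f z) + (g y - g z))%C by ring. rewrite Ep, Eq. cring.
Qed.

Lemma Rd_RtoC t : Rd RtoC t (RtoC 1).
Proof. apply (carath_Rd _ (fun _ => RtoC 1)). apply continuous_const. apply filter_forall. intros y. cbv beta. rewrite RtoC_minus. cring. Qed.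

Lemma Rd_Re (f : R -> C) t l : Rd f t l -> is_derive (fun s => Re (f s)) t (Re l).
Proof.
intros H. rewrite is_derive_RC_iff in H. split; [apply is_linear_scal_l|].
intros x Hx. assert (x = t) by (symmetry; apply (@is_filter_lim_locally_unique _ R_NormedModule t x Hx)). subst x.
intros [eps Heps]. destruct (H eps Heps) as [d [Hd Hd']]. exists (mkposreal d Hd). intros y Hy. specialize (Hd' y Hy).
apply Rle_trans with (2 := Hd'). apply Rle_trans with (2 := re_le_Cmod _). right.
change (Rabs (Re (f y) - Re (f t) - (y - t) * Re l) = Rabs (Re (f y - f t - RtoC (y - t) * l))). f_equal. simpl. unfold Re. ring.
Qed.

Lemma Rd_Im (f : R -> C) t l : Rd f t l -> is_derive (fun s => Im (f s)) t (Im l).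
Proof.
intros H.
(* Multiplication by [- Ci] turns imaginary parts into real parts. *)
assert (H' : Rd (fun s => - Ci * f s)%C t (- Ci * l)%C).
{ apply (Rd_eq _ _ _ _ (Rd_mult _ _ _ _ _ (Rd_const (- Ci)%C t) H)). cring. }
apply Rd_Re in H'.
apply (is_derive_ext (fun s => Re (- Ci * f s)%C)). intros s. unfold Re, Im. simpl. ring.
replace (Im l) with (Re (- Ci * l)%C). exact H'. unfold Re, Im. simpl. ring.
Qed.

Lemma Rd_pair (f g : R -> R) t l m : is_derive f t l -> is_derive g t m -> Rd (fun s => (f s, g s)) t (l, m).
Proof.
intros [_ Hf] [_ Hg]. apply is_derive_RC_iff. intros eps He.
assert (He2 : 0 < eps / 2) by lra.
pose proof (Hf t (fun P HP => HP) (mkposreal _ He2)) as F. pose proof (Hg t (fun P HP => HP) (mkposreal _ He2)) as G.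
destruct (filter_and _ _ F G) as [d Hd]. exists d; split; [apply cond_pos|]. intros s Hs. destruct (Hd s Hs) as [A B].
change (Rabs (f s - f t - (s - t) * l) <= eps / 2 * Rabs (s - t)) in A.
change (Rabs (g s - g t - (s - t) * m) <= eps / 2 * Rabs (s - t)) in B.
replace (((f s, g s) : C) - (f t, g t) - RtoC (s - t) * (l, m))%C with (RtoC (f s - f t - (s - t) * l) + Ci * RtoC (g s - g t - (s - t) * m))%C.
2:{ apply injective_projections; simpl; ring. }
eapply Rle_trans. apply Cmod_triangle. rewrite Cmod_mult, Cmod_Ci, !Cmod_R. lra.
Qed.

(** * Integrals along segments and Goursat's theorem *)

Notation CInt := (@RInt C_R_CompleteNormedModule).
Notation is_CInt := (@is_RInt C_R_NormedModule).
Notation ex_CInt := (@ex_RInt C_R_NormedModule).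

Lemma scal_RC (r : R) (z : C) : @scal R_AbsRing C_R_NormedModule r z = (RtoC r * z)%C.
Proof. apply injective_projections; simpl; unfold scal; simpl; unfold mult; simpl; ring. Qed.

Lemma is_CInt_Cscal (c : C) (f : R -> C) a b l :
  is_CInt f a b l -> is_CInt (fun t => (c * f t)%C) a b (c * l)%C.
Proof.
intros H.
pose proof (is_RInt_fct_extend_fst (U := R_NormedModule) (V := R_NormedModule) f a b l H) as H1.
pose proof (is_RInt_fct_extend_snd (U := R_NormedModule) (V := R_NormedModule) f a b l H) as H2.
apply (is_RInt_fct_extend_pair (U := R_NormedModule) (V := R_NormedModule) (fun t => (c * f t)%C)); simpl.
- apply (is_RInt_minus (V := R_NormedModule)); now apply (is_RInt_scal (V := R_NormedModule)).
- apply (is_RInt_plus (V := R_NormedModule)); now apply (is_RInt_scal (V := R_NormedModule)).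
Qed.

Lemma ex_CInt_cont (f : R -> C) a b : a <= b ->
  (forall t, a <= t <= b -> continuous f t) -> ex_CInt f a b.
Proof.
intros Hab H. apply (ex_RInt_continuous (V := C_R_CompleteNormedModule)).
intros z. rewrite Rmin_left, Rmax_right by assumption. apply H.
Qed.

Lemma CInt_Cscal (c : C) (f : R -> C) a b : ex_CInt f a b ->
  CInt (fun t => (c * f t)%C) a b = (c * CInt f a b)%C.
Proof.
intros H. apply (is_RInt_unique (V := C_R_CompleteNormedModule)). apply is_CInt_Cscal.
now apply (RInt_correct (V := C_R_CompleteNormedModule)).
Qed.

Lemma CInt_plus (f g : R -> C) a b : ex_CInt f a b -> ex_CInt g a b ->
  CInt (fun t => (f t + g t)%C) a b = (CInt f a b + CInt g a b)%C.
Proof. intros. now apply (RInt_plus (V := C_R_CompleteNormedModule)). Qed.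

Lemma CInt_minus (f g : R -> C) a b : ex_CInt f a b -> ex_CInt g a b ->
  CInt (fun t => (f t - g t)%C) a b = (CInt f a b - CInt g a b)%C.
Proof. intros. now apply (RInt_minus (V := C_R_CompleteNormedModule)). Qed.

Lemma CInt_bound (f : R -> C) a b M : a <= b -> ex_CInt f a b ->
  (forall t, a <= t <= b -> Cmod (f t) <= M) -> Cmod (CInt f a b) <= M * (b - a).
Proof.
intros Hab Hf HM. rewrite Cmod_norm.
apply (norm_RInt_le (V := C_R_NormedModule) f (fun _ => M) a b); auto.
- intros x Hx. rewrite <- Cmod_norm. now apply HM.
- now apply (RInt_correct (V := C_R_CompleteNormedModule)).
- replace (M * (b - a)) with (scal (b - a) M) by (unfold scal; simpl; unfold mult; simpl; ring).
  apply (is_RInt_const (V := R_NormedModule)).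
Qed.

Lemma CInt_FTC (F f : R -> C) a b : a <= b ->
  (forall t, a <= t <= b -> Rd F t (f t)) -> (forall t, a <= t <= b -> continuous f t) ->
  CInt f a b = (F b - F a)%C.
Proof.
intros Hab H1 H2. apply (is_RInt_unique (V := C_R_CompleteNormedModule)).
apply (is_RInt_derive (V := C_R_CompleteNormedModule) F f);
intros t; rewrite Rmin_left, Rmax_right by assumption; auto.
Qed.

Lemma CInt_const (c : C) a b : CInt (fun _ => c) a b = (RtoC (b - a) * c)%C.
Proof. rewrite <- scal_RC. apply (RInt_const (V := C_R_CompleteNormedModule)). Qed.

Lemma CInt_ext (f g : R -> C) a b : a <= b -> (forall t, a < t < b -> f t = g t) -> CInt f a b = CInt g a b.
Proof. intros Hab H. apply (RInt_ext (V := C_R_CompleteNormedModule)). intros x. rewrite Rmin_left, Rmax_right by assumption. apply H. Qed.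

Definition segm (u v : C) (t : R) : C := (u + RtoC t * (v - u))%C.

Definition segint (K : C -> C) (u v : C) : C := CInt (fun t => (K (segm u v t) * (v - u))%C) 0 1.

Lemma in_disk_segm u v t : in_disk u -> in_disk v -> 0 <= t <= 1 -> in_disk (segm u v t).
Proof.
unfold in_disk, segm. intros Hu Hv Ht.
replace (u + RtoC t * (v - u))%C with (RtoC (1 - t) * u + RtoC t * v)%C by (rewrite RtoC_minus; ring).
eapply Rle_lt_trans. apply Cmod_triangle. rewrite !Cmod_mult, !Cmod_R, !Rabs_pos_eq by lra.
destruct (Rlt_dec t 1). nra. assert (t = 1) by lra. subst. lra.
Qed.

Lemma Rd_segm u v t : Rd (segm u v) t (v - u)%C.
Proof.
unfold segm.
apply (Rd_eq _ _ _ _ (Rd_plus _ _ _ _ _ (Rd_const u t) (Rd_mult _ _ _ _ _ (Rd_RtoC t) (Rd_const (v - u)%C t)))). cring.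
Qed.

Lemma continuous_segm u v t : continuous (segm u v) t.
Proof. apply (Rd_continuous _ _ _ (Rd_segm u v t)). Qed.

Lemma continuous_integrand (K : C -> C) u v t : continuous K (segm u v t) ->
  continuous (fun t => (K (segm u v t) * (v - u))%C) t.
Proof.
intros H. apply continuous_Cmult. apply (continuous_comp (segm u v) K); auto. apply continuous_segm. apply continuous_const.
Qed.

Lemma segint_chasles K u v s : (forall t, 0 <= t <= 1 -> continuous K (segm u v t)) -> 0 <= s <= 1 ->
  segint K u v = (segint K u (segm u v s) + segint K (segm u v s) v)%C.
Proof.
intros HK Hs. unfold segint at 1.
set (g := fun t => (K (segm u v t) * (v - u))%C).
assert (Cg : forall t, 0 <= t <= 1 -> continuous g t) by (intros; apply continuous_integrand; auto).
assert (E1 : ex_CInt g 0 s) by (apply ex_CInt_cont; intros; try apply Cg; lra).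
assert (E2 : ex_CInt g s 1) by (apply ex_CInt_cont; intros; try apply Cg; lra).
rewrite <- (RInt_Chasles (V := C_R_CompleteNormedModule) g 0 s 1 E1 E2).
apply (f_equal2 Cplus).
- transitivity (CInt g (s * 0 + 0) (s * 1 + 0)). f_equal; ring.
  rewrite <- (RInt_comp_lin (V := C_R_CompleteNormedModule) g s 0 0 1).
  2:{ replace (s * 0 + 0) with 0 by ring. replace (s * 1 + 0) with s by ring. exact E1. }
  apply CInt_ext. lra. intros t _. rewrite scal_RC. unfold g, segm.
  replace (u + RtoC (s * t + 0) * (v - u))%C with (u + RtoC t * (u + RtoC s * (v - u) - u))%C.
  ring. rewrite RtoC_plus, RtoC_mult. ring.
- transitivity (CInt g ((1 - s) * 0 + s) ((1 - s) * 1 + s)). f_equal; ring.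
  rewrite <- (RInt_comp_lin (V := C_R_CompleteNormedModule) g (1 - s) s 0 1).
  2:{ replace ((1 - s) * 0 + s) with s by ring. replace ((1 - s) * 1 + s) with 1 by ring. exact E2. }
  apply CInt_ext. lra. intros t _. rewrite scal_RC. unfold g, segm.
  replace (u + RtoC ((1 - s) * t + s) * (v - u))%C with (u + RtoC s * (v - u) + RtoC t * (v - (u + RtoC s * (v - u))))%C.
  rewrite RtoC_minus. ring. rewrite RtoC_plus, RtoC_mult, RtoC_minus. ring.
Qed.

Lemma segint_swap K u v : (forall t, 0 <= t <= 1 -> continuous K (segm u v t)) ->
  segint K v u = (- segint K u v)%C.
Proof.
intros HK. unfold segint.
assert (Em : RtoC (-1) = (- (1))%C) by (apply injective_projections; simpl; ring).
set (g := fun t => (K (segm u v t) * (v - u))%C).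
assert (Cg : forall t, 0 <= t <= 1 -> continuous g t) by (intros; apply continuous_integrand; auto).
assert (E1 : ex_CInt g 0 1) by (apply ex_CInt_cont; intros; try apply Cg; lra).
transitivity (CInt g 1 0). 2: symmetry; apply (opp_RInt_swap (V := C_R_CompleteNormedModule)); exact E1.
transitivity (CInt g ((-1) * 0 + 1) ((-1) * 1 + 1)). 2: f_equal; ring.
rewrite <- (RInt_comp_lin (V := C_R_CompleteNormedModule) g (-1) 1 0 1).
2:{ replace ((-1) * 0 + 1) with 1 by ring. replace ((-1) * 1 + 1) with 0 by ring. now apply ex_RInt_swap. }
apply CInt_ext. lra. intros t _. rewrite scal_RC. unfold g, segm.
replace (u + RtoC (-1 * t + 1) * (v - u))%C with (v + RtoC t * (u - v))%C.
{ rewrite Em. ring. } { rewrite RtoC_plus, RtoC_mult, Em. ring. }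
Qed.

Lemma segint_FTC K P u v : (forall t, 0 <= t <= 1 -> Cd P (segm u v t) (K (segm u v t))) ->
  (forall t, 0 <= t <= 1 -> continuous K (segm u v t)) -> segint K u v = (P v - P u)%C.
Proof.
intros HP HK. unfold segint.
rewrite (CInt_FTC (fun t => P (segm u v t)) (fun t => (K (segm u v t) * (v - u))%C)).
- f_equal; f_equal; [|f_equal]; unfold segm; ring.
- lra.
- intros t Ht. apply Rd_comp. apply Rd_segm. auto.
- intros t Ht. apply continuous_integrand; auto.
Qed.

Lemma segint_bound K u v M : (forall t, 0 <= t <= 1 -> continuous K (segm u v t)) ->
  (forall t, 0 <= t <= 1 -> Cmod (K (segm u v t)) <= M) -> Cmod (segint K u v) <= M * Cmod (v - u).
Proof.
intros HK HM. unfold segint. replace (M * Cmod (v - u)) with (M * Cmod (v - u) * (1 - 0)) by ring.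
apply CInt_bound. lra. apply ex_CInt_cont. lra. intros; apply continuous_integrand; auto.
intros t Ht. rewrite Cmod_mult. apply Rmult_le_compat_r. apply Cmod_ge_0. auto.
Qed.

Lemma segint_plus K1 K2 u v : (forall t, 0 <= t <= 1 -> continuous K1 (segm u v t)) ->
  (forall t, 0 <= t <= 1 -> continuous K2 (segm u v t)) ->
  segint (fun z => K1 z + K2 z)%C u v = (segint K1 u v + segint K2 u v)%C.
Proof.
intros H1 H2. unfold segint. rewrite <- CInt_plus; try (apply ex_CInt_cont; [lra|]; intros; apply continuous_integrand; auto).
apply CInt_ext. lra. intros; ring.
Qed.

(** The supremum of the lower ends is a common point, because every lower end lies below every upper
    end. *)
Lemma nested_intervals (lo hi : nat -> R) :
  (forall n, lo n <= lo (S n)) -> (forall n, hi (S n) <= hi n) -> (forall n, lo n <= hi n) ->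
  exists X, forall n, lo n <= X <= hi n.
Proof.
intros Hl Hh Hlh.
assert (ML : forall n m, (n <= m)%nat -> lo n <= lo m) by (intros n m H; induction H; [lra|specialize (Hl m); lra]).
assert (MH : forall n m, (n <= m)%nat -> hi m <= hi n) by (intros n m H; induction H; [lra|specialize (Hh m); lra]).
assert (A : forall n m, lo n <= hi m).
{ intros n m. destruct (Nat.le_gt_cases n m).
  - generalize (ML n m H) (Hlh m). lra.
  - generalize (MH m n ltac:(apply Nat.lt_le_incl; assumption)) (Hlh n). lra. }
destruct (completeness (fun x => exists n, x = lo n)) as [X [U L]].
- exists (hi 0%nat). intros x [n ->]. apply A.
- exists (lo 0%nat). now exists 0%nat.
- exists X. intros n. split. apply U. now exists n. apply L. intros x [m ->]. apply A.
Qed.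

(** * Goursat's theorem for a triangle *)

Definition triint (K : C -> C) (a b c : C) : C := (segint K a b + segint K b c + segint K c a)%C.

Section Goursat.
Variables (K : C -> C) (u v w : C).
Hypothesis (Du : in_disk u) (Dv : in_disk v) (Dw : in_disk w).
Hypothesis KC : forall z, in_disk z -> continuous K z.

(** Affine coordinates on the triangle: the subdivision takes place among real pairs, and a
    degenerate triangle is no exception. *)
Let P x y : C := (u + RtoC x * (v - u) + RtoC y * (w - u))%C.

Lemma simplex_disk x y : 0 <= x -> 0 <= y -> x + y <= 1 -> in_disk (P x y).
Proof.
intros Hx Hy Hxy. destruct (Req_dec x 1) as [->|Hx1].
- assert (y = 0) by lra. subst. replace (P 1 0) with v by (unfold P; ring). exact Dv.
- replace (P x y) with (segm (segm u w (y / (1 - x))) v x).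
  + apply in_disk_segm; try lra; auto. apply in_disk_segm; auto. split. apply Rdiv_le_0_compat; lra.
    apply Rle_div_l; lra.
  + unfold segm, P. rewrite RtoC_div, RtoC_minus by lra. field.
    change (RtoC 1 - RtoC x <> 0)%C. rewrite <- RtoC_minus. intros E. apply RtoC_inj in E. lra.
Qed.

(* A triple [(x, y, h)] stands for the triangle with vertices [P x y], [P (x + h) y] and
   [P x (y + h)]; the middle one of the four halved triangles has [h] of the opposite sign. *)
Let T (s : R * R * R) : C :=
  let '(x, y, h) := s in triint K (P x y) (P (x + h) y) (P x (y + h)).

(** All three vertices have their coordinates in the standard simplex, whatever the sign of [h]. *)
Let valid (s : R * R * R) : Prop :=
  let '(x, y, h) := s in
  0 <= x /\ 0 <= y /\ x + y <= 1 /\ 0 <= x + h /\ 0 <= y + h /\ x + y + h <= 1.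

Let child (i : nat) (s : R * R * R) : R * R * R :=
  let '(x, y, h) := s in
  match i with
  | 0%nat => (x, y, h / 2)
  | 1%nat => (x + h / 2, y, h / 2)
  | 2%nat => (x, y + h / 2, h / 2)
  | _ => (x + h / 2, y + h / 2, - (h / 2))
  end.

Lemma seg_half a b : in_disk a -> in_disk b ->
  segint K a b = (segint K a (segm a b (1 / 2)) + segint K (segm a b (1 / 2)) b)%C.
Proof. intros. apply segint_chasles; [|lra]. intros. apply KC, in_disk_segm; auto. Qed.

Lemma seg_swap a b : in_disk a -> in_disk b -> segint K b a = (- segint K a b)%C.
Proof. intros. apply segint_swap. intros. apply KC, in_disk_segm; auto. Qed.

(** Each edge of the middle triangle is an edge of one of the other three with the opposite
    orientation, so the inner integrals cancel. *)
Lemma T_split s : valid s -> T s = (T (child 0 s) + T (child 1 s) + T (child 2 s) + T (child 3 s))%C.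
Proof.
destruct s as [[x y] h]. unfold valid, T, child, triint. intros (H1 & H2 & H3 & H4 & H5 & H6).
set (a := P x y). set (b := P (x + h) y). set (c := P x (y + h)).
assert (Da : in_disk a) by (apply simplex_disk; lra).
assert (Db : in_disk b) by (apply simplex_disk; lra).
assert (Dc : in_disk c) by (apply simplex_disk; lra).
assert (E2 : RtoC (1 / 2) = (/ 2)%C) by (rewrite RtoC_div by lra; field; intros E; apply RtoC_inj in E; lra).
assert (T2 : RtoC 2 <> 0) by (intros E; apply RtoC_inj in E; lra).
set (m1 := P (x + h / 2) y). set (m3 := P x (y + h / 2)). set (m2 := P (x + h / 2) (y + h / 2)).
replace (P (x + h / 2 + h / 2) y) with b by (unfold b; f_equal; field).
replace (P x (y + h / 2 + h / 2)) with c by (unfold c; f_equal; field).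
replace (P (x + h / 2 + - (h / 2)) (y + h / 2)) with m3 by (unfold m3; f_equal; field).
replace (P (x + h / 2) (y + h / 2 + - (h / 2))) with m1 by (unfold m1; f_equal; field).
assert (Dm1 : in_disk m1) by (apply simplex_disk; lra).
assert (Dm2 : in_disk m2) by (apply simplex_disk; lra).
assert (Dm3 : in_disk m3) by (apply simplex_disk; lra).
rewrite (seg_half a b), (seg_half b c), (seg_half c a) by assumption.
replace (segm a b (1 / 2)) with m1.
2:{ unfold segm, a, b, m1, P. rewrite E2, !RtoC_plus, RtoC_div by lra. field; auto. }
replace (segm b c (1 / 2)) with m2.
2:{ unfold segm, c, b, m2, P. rewrite E2, !RtoC_plus, RtoC_div by lra. field; auto. }
replace (segm c a (1 / 2)) with m3.
2:{ unfold segm, a, c, m3, P. rewrite E2, !RtoC_plus, RtoC_div by lra. field; auto. }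
rewrite (seg_swap m2 m1), (seg_swap m3 m2), (seg_swap m1 m3) by assumption. ring.
Qed.

Lemma valid_child i s : valid s -> valid (child i s).
Proof.
destruct s as [[x y] h]. unfold valid, child. intros (H1 & H2 & H3 & H4 & H5 & H6).
destruct i as [|[|[|i]]]; repeat split; lra.
Qed.

(** The fourth child is the default: when the first three fall short of a quarter of the integral,
    the triangle inequality leaves at least a quarter to it. *)
Let step (s : R * R * R) : R * R * R :=
  if Rle_dec (Cmod (T s) / 4) (Cmod (T (child 0 s))) then child 0 s else
  if Rle_dec (Cmod (T s) / 4) (Cmod (T (child 1 s))) then child 1 s else
  if Rle_dec (Cmod (T s) / 4) (Cmod (T (child 2 s))) then child 2 s else child 3 s.

Lemma step_child s : exists i, step s = child i s.
Proof. unfold step. destruct Rle_dec; [now exists 0%nat|]. destruct Rle_dec; [now exists 1%nat|].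
destruct Rle_dec; [now exists 2%nat|now exists 3%nat]. Qed.

Lemma step_T s : valid s -> Cmod (T s) / 4 <= Cmod (T (step s)).
Proof.
intros V. pose proof (T_split s V) as E. unfold step.
repeat (destruct Rle_dec; [assumption|]).
generalize (Cmod_triangle (T (child 0 s) + T (child 1 s) + T (child 2 s)) (T (child 3 s)))
 (Cmod_triangle (T (child 0 s) + T (child 1 s)) (T (child 2 s))) (Cmod_triangle (T (child 0 s)) (T (child 1 s))).
rewrite <- E. lra.
Qed.

Let st (n : nat) := Nat.iter n step (0, 0, 1).

Lemma st_valid n : valid (st n).
Proof.
induction n. unfold st, valid; simpl; lra.
change (valid (step (st n))). destruct (step_child (st n)) as [i ->]. now apply valid_child.
Qed.

Lemma st_size n : Rabs (snd (st n)) = (1 / 2) ^ n.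
Proof.
induction n. unfold st; simpl. apply Rabs_pos_eq; lra.
change (st (S n)) with (step (st n)). destruct (step_child (st n)) as [i ->]. simpl. rewrite <- IHn.
destruct (st n) as [[x y] h]. replace (1 / 2) with (Rabs (1 / 2)) by (apply Rabs_pos_eq; lra). rewrite <- Rabs_mult.
destruct i as [|[|[|i]]]; simpl; try (f_equal; lra). rewrite Rabs_Ropp. f_equal; lra.
Qed.

(** Each halving loses at most the factor 4, the square of the factor lost by the side. In
    [goursat_triangle] the remainder has the same order, with an arbitrarily small coefficient. *)
Lemma st_T n : Cmod (triint K u v w) * ((1 / 2) ^ n) ^ 2 <= Cmod (T (st n)).
Proof.
induction n.
- unfold st, T; simpl. replace (P 0 0) with u by (unfold P; ring).
  replace (P (0 + 1) 0) with v by (unfold P; rewrite RtoC_plus; ring).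
  replace (P 0 (0 + 1)) with w by (unfold P; rewrite RtoC_plus; ring). lra.
- change (st (S n)) with (step (st n)). pose proof (step_T _ (st_valid n)). simpl in *. lra.
Qed.

Hypothesis KD : forall x y, 0 <= x -> 0 <= y -> x + y <= 1 -> exists l, Cd K (P x y) l.

Lemma st_limit : exists X Y, 0 <= X /\ 0 <= Y /\ X + Y <= 1 /\
  forall n, Rabs (fst (fst (st n)) - X) <= (1 / 2) ^ n /\ Rabs (snd (fst (st n)) - Y) <= (1 / 2) ^ n.
Proof.
(* The size can be negative, so the interval between [x] and [x + h] is written with [Rmin] and
   [Rmax]. *)
assert (BX : exists X, forall n, Rmin (fst (fst (st n))) (fst (fst (st n)) + snd (st n)) <= X <= Rmax (fst (fst (st n))) (fst (fst (st n)) + snd (st n))).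
{ apply nested_intervals; intros n.
  1,2: change (st (S n)) with (step (st n)); destruct (step_child (st n)) as [i ->]; destruct (st n) as [[x y] h];
    destruct i as [|[|[|i]]]; simpl; unfold Rmin, Rmax; repeat destruct Rle_dec; lra.
  unfold Rmin, Rmax; repeat destruct Rle_dec; lra. }
assert (BY : exists X, forall n, Rmin (snd (fst (st n))) (snd (fst (st n)) + snd (st n)) <= X <= Rmax (snd (fst (st n))) (snd (fst (st n)) + snd (st n))).
{ apply nested_intervals; intros n.
  1,2: change (st (S n)) with (step (st n)); destruct (step_child (st n)) as [i ->]; destruct (st n) as [[x y] h];
    destruct i as [|[|[|i]]]; simpl; unfold Rmin, Rmax; repeat destruct Rle_dec; lra.
  unfold Rmin, Rmax; repeat destruct Rle_dec; lra. }
destruct BX as [X HX]. destruct BY as [Y HY].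
assert (B : forall n, Rabs (fst (fst (st n)) - X) <= (1 / 2) ^ n /\ Rabs (snd (fst (st n)) - Y) <= (1 / 2) ^ n).
{ intros n. rewrite <- st_size. specialize (HX n). specialize (HY n).
  generalize (Rle_abs (snd (st n))) (Rle_abs (- snd (st n))). rewrite Rabs_Ropp.
  unfold Rmin, Rmax in *. split; apply Rabs_le; repeat destruct Rle_dec; lra. }
(* The limit point violates an inequality of the simplex by at most [2 * (1 / 2) ^ n] for every [n],
   hence not at all. *)
assert (Z : forall c, (forall n, c <= 2 * (1 / 2) ^ n) -> c <= 0).
{ intros c Hc. destruct (Rle_dec c 0); auto. exfalso.
  destruct (pow_lt_1_zero (1 / 2) ltac:(rewrite Rabs_pos_eq; lra) (c / 2) ltac:(lra)) as [N HN].
  specialize (HN N (le_n _)). specialize (Hc N). rewrite Rabs_pos_eq in HN by (apply pow_le; lra). lra. }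
exists X, Y. split; [|split; [|split]]; auto.
- cut (- X <= 0). lra. apply Z. intros n. destruct (B n) as [B1 _]. apply Rabs_le_between in B1.
  pose proof (st_valid n) as V. destruct (st n) as [[x y] h]. unfold valid in V. simpl in *. pose proof (pow_le (1/2) n). lra.
- cut (- Y <= 0). lra. apply Z. intros n. destruct (B n) as [_ B1]. apply Rabs_le_between in B1.
  pose proof (st_valid n) as V. destruct (st n) as [[x y] h]. unfold valid in V. simpl in *. pose proof (pow_le (1/2) n). lra.
- cut (X + Y - 1 <= 0). lra. apply Z. intros n. destruct (B n) as [B1 B2]. apply Rabs_le_between in B1. apply Rabs_le_between in B2.
  pose proof (st_valid n) as V. destruct (st n) as [[x y] h]. unfold valid in V. simpl in *. lra.
Qed.

(** The linear approximation of [K] at [q] has a quadratic polynomial as primitive, so its integral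
    is a difference of end values. These differences cancel around a triangle, and only the error
    term remains. *)
Lemma seg_affine_part (q l : C) (eps : R) a b r : in_disk a -> in_disk b ->
  (forall t, 0 <= t <= 1 -> Cmod (segm a b t - q) <= r) ->
  (forall z, Cmod (z - q) <= r -> Cmod (K z - K q - l * (z - q)) <= eps * r) ->
  Cmod (segint K a b - ((K q - l * q) * (b - a) + l * / 2 * (b * b - a * a))) <= eps * r * Cmod (b - a).
Proof.
intros Da Db Hr He.
set (A := fun z => (K q + l * (z - q))%C).
set (E := fun z => (K z - A z)%C).
assert (CA : forall z, continuous A z).
{ intros z. apply continuous_Cplus. apply continuous_const. apply continuous_Cmult. apply continuous_const.
  apply continuous_Cminus. apply continuous_id. apply continuous_const. }
assert (CE : forall z, in_disk z -> continuous E z) by (intros; apply continuous_Cminus; auto).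
assert (S1 : segint K a b = (segint A a b + segint E a b)%C).
{ rewrite <- segint_plus by (intros; auto using in_disk_segm). unfold segint. apply CInt_ext. lra. intros. f_equal. unfold E. ring. }
assert (T2 : RtoC 2 <> 0) by (intros X; apply RtoC_inj in X; lra).
rewrite S1, (segint_FTC A (fun z => (K q - l * q) * z + l * / 2 * (z * z))%C).
- match goal with |- Cmod ?x <= _ => replace x with (segint E a b) by (field; auto) end.
  apply segint_bound. intros; auto using in_disk_segm. intros t Ht. unfold E, A.
  replace (K (segm a b t) - (K q + l * (segm a b t - q)))%C with (K (segm a b t) - K q - l * (segm a b t - q))%C by ring.
  apply He; auto.
- intros t Ht. eapply Cd_eq. apply Cd_plus; apply Cd_mult. apply Cd_const. apply Cd_id. apply Cd_const. apply Cd_mult; apply Cd_id.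
  unfold A. cfield; auto.
- auto.
Qed.

Lemma goursat_triangle : triint K u v w = 0.
Proof.
destruct st_limit as (X & Y & HX & HY & HXY & HL).
destruct (KD X Y HX HY HXY) as [l Hl].
set (q := P X Y) in *.
set (M := Cmod (v - u) + Cmod (w - u)).
assert (HM : 0 <= M) by (unfold M; generalize (Cmod_ge_0 (v - u)) (Cmod_ge_0 (w - u)); lra).
apply Cmod_eq_0. apply Rle_antisym; [|apply Cmod_ge_0].
apply le_epsilon. intros eps Heps. rewrite Rplus_0_l.
(* 36 = 3 * 3 * 4: there are three edges, the radius [r] is [3 * M * h0], and an edge has length at
   most [4 * M * h0]. Using [M + 1] keeps the denominator positive when the triangle is a point. *)
set (e := eps / (36 * (M + 1) * (M + 1))).
assert (He : 0 < e) by (apply Rdiv_lt_0_compat; nra).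
rewrite is_derive_C_iff in Hl. destruct (Hl e He) as [d [Hd Hd']].
destruct (pow_lt_1_zero (1 / 2) ltac:(rewrite Rabs_pos_eq; lra) (d / (3 * (M + 1)))) as [n Hn].
{ apply Rdiv_lt_0_compat; nra. }
specialize (Hn n (le_n _)). rewrite Rabs_pos_eq in Hn by (apply pow_le; lra).
pose proof (st_T n) as HT. pose proof (st_valid n) as V. pose proof (st_size n) as SZ. destruct (HL n) as [LX LY].
set (h0 := (1 / 2) ^ n) in *. assert (Hh0 : 0 < h0) by (apply pow_lt; lra).
set (r := 3 * M * h0).
assert (Hr : r < d). { apply Rlt_div_r in Hn; [|lra]. unfold r. nra. }
assert (Hr0 : 0 <= r) by (unfold r; nra).
destruct (st n) as [[x y] h]. unfold valid in V. simpl in SZ, LX, LY. destruct V as (H1 & H2 & H3 & H4 & H5 & H6).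
assert (PQ : forall x' y', Rabs (x' - x) <= h0 -> Rabs (y' - y) <= h0 -> Cmod (P x' y' - q) <= 2 * M * h0).
{ intros x' y' Hx Hy. unfold q, P.
  replace (u + RtoC x' * (v - u) + RtoC y' * (w - u) - (u + RtoC X * (v - u) + RtoC Y * (w - u)))%C
    with (RtoC (x' - X) * (v - u) + RtoC (y' - Y) * (w - u))%C by (rewrite !RtoC_minus; ring).
  eapply Rle_trans. apply Cmod_triangle. rewrite !Cmod_mult, !Cmod_R.
  assert (Rabs (x' - X) <= 2 * h0) by (replace (x' - X) with ((x' - x) + (x - X)) by ring; eapply Rle_trans; [apply Rabs_triang|lra]).
  assert (Rabs (y' - Y) <= 2 * h0) by (replace (y' - Y) with ((y' - y) + (y - Y)) by ring; eapply Rle_trans; [apply Rabs_triang|lra]).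
  unfold M. generalize (Cmod_ge_0 (v - u)) (Cmod_ge_0 (w - u)). nra. }
assert (Q0 : Rabs 0 <= h0) by (rewrite Rabs_R0; lra).
assert (SEG : forall a b t, Cmod (a - q) <= 2 * M * h0 -> Cmod (b - q) <= 2 * M * h0 -> 0 <= t <= 1 -> Cmod (segm a b t - q) <= r).
{ intros a b t Ha Hb Ht. unfold segm. replace (a + RtoC t * (b - a) - q)%C with (RtoC (1 - t) * (a - q) + RtoC t * (b - q))%C by (rewrite RtoC_minus; ring).
  eapply Rle_trans. apply Cmod_triangle. rewrite !Cmod_mult, !Cmod_R, !Rabs_pos_eq by lra. unfold r. nra. }
assert (LOC : forall z, Cmod (z - q) <= r -> Cmod (K z - K q - l * (z - q)) <= e * r).
{ intros z Hz. eapply Rle_trans. apply Hd'. lra. apply Rmult_le_compat_l; lra. }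
unfold T, triint in HT.
set (a := P x y) in *. set (b := P (x + h) y) in *. set (c := P x (y + h)) in *.
assert (Qa : Cmod (a - q) <= 2 * M * h0) by (apply PQ; rewrite Rminus_diag; auto).
assert (Qb : Cmod (b - q) <= 2 * M * h0) by (apply PQ; [replace (x + h - x) with h by ring; lra|rewrite Rminus_diag; auto]).
assert (Qc : Cmod (c - q) <= 2 * M * h0) by (apply PQ; [rewrite Rminus_diag; auto|replace (y + h - y) with h by ring; lra]).
assert (Da : in_disk a) by (apply simplex_disk; lra).
assert (Db : in_disk b) by (apply simplex_disk; lra).
assert (Dc : in_disk c) by (apply simplex_disk; lra).
assert (Lab : forall a b, Cmod (a - q) <= 2 * M * h0 -> Cmod (b - q) <= 2 * M * h0 -> Cmod (b - a) <= 4 * M * h0).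
{ intros a' b' Ha Hb. replace (b' - a')%C with ((b' - q) + - (a' - q))%C by ring.
  eapply Rle_trans. apply Cmod_triangle. rewrite Cmod_opp. lra. }
assert (Hlast : Cmod (triint K a b c) <= 3 * (e * r * (4 * M * h0))).
{ pose proof (seg_affine_part q l e a b r Da Db (fun t => SEG a b t Qa Qb) LOC) as B1.
  pose proof (seg_affine_part q l e b c r Db Dc (fun t => SEG b c t Qb Qc) LOC) as B2.
  pose proof (seg_affine_part q l e c a r Dc Da (fun t => SEG c a t Qc Qa) LOC) as B3.
  unfold triint.
  set (A1 := ((K q - l * q) * (b - a) + l * / 2 * (b * b - a * a))%C) in *.
  set (A2 := ((K q - l * q) * (c - b) + l * / 2 * (c * c - b * b))%C) in *.
  set (A3 := ((K q - l * q) * (a - c) + l * / 2 * (a * a - c * c))%C) in *.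
  replace (segint K a b + segint K b c + segint K c a)%C with ((segint K a b - A1) + (segint K b c - A2) + (segint K c a - A3))%C
    by (unfold A1, A2, A3; ring).
  assert (e * r >= 0) by nra.
  eapply Rle_trans. apply Cmod_triangle. eapply Rle_trans. apply Rplus_le_compat_r, Cmod_triangle.
  generalize (Lab a b Qa Qb) (Lab b c Qb Qc) (Lab c a Qc Qa). nra. }
assert (F : Cmod (triint K u v w) * h0 ^ 2 <= (36 * e * M * M) * h0 ^ 2).
{ eapply Rle_trans. apply HT. eapply Rle_trans. apply Hlast. unfold r. right. ring. }
apply Rmult_le_reg_r in F; [|nra]. eapply Rle_trans. apply F.
replace eps with (36 * e * (M + 1) * (M + 1)) by (unfold e; field; lra). nra.
Qed.

End Goursat.

(** Used in the contrapositive: if [a] is off the segment from [u] to [v], then the triangle with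
    vertices [a], [u], [v] contains [a] only as that vertex. *)
Lemma segm_of_cone (a u v : C) alpha beta : 0 <= alpha -> 0 <= beta -> 0 < alpha + beta ->
  (RtoC alpha * (u - a) + RtoC beta * (v - a) = 0)%C ->
  exists s, 0 <= s <= 1 /\ a = segm u v s.
Proof.
intros Ha Hb Hab E. exists (beta / (alpha + beta)). split.
- split. apply Rdiv_le_0_compat; lra. apply Rle_div_l; lra.
- assert (N : RtoC (alpha + beta) <> 0) by (intros X; apply RtoC_inj in X; lra).
  unfold segm. rewrite RtoC_div by lra.
  replace a with (a + (RtoC alpha * (u - a) + RtoC beta * (v - a)) / RtoC (alpha + beta))%C at 1 by (rewrite E; field; auto).
  rewrite RtoC_plus in *. field; auto.
Qed.

(** * Primitives of a function with one exceptional point *)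

Section Primitive.
Variables (K : C -> C) (a : C).
Hypothesis Da : in_disk a.
Hypothesis KC : forall z, in_disk z -> continuous K z.
Hypothesis KD : forall z, in_disk z -> z <> a -> exists l, Cd K z l.

Lemma chasles_disk u v s : in_disk u -> in_disk v -> 0 <= s <= 1 ->
  segint K u v = (segint K u (segm u v s) + segint K (segm u v s) v)%C.
Proof. intros. apply segint_chasles; [|lra]. intros. apply KC, in_disk_segm; auto. Qed.

Lemma swap_disk u v : in_disk u -> in_disk v -> segint K v u = (- segint K u v)%C.
Proof. intros. apply segint_swap. intros. apply KC, in_disk_segm; auto. Qed.

(** If [a] lies on the opposite edge, the edges cancel. Otherwise a small corner at [a] is cut off:
    Goursat's theorem applies to the two triangles that make up the rest, and the integral over the
    corner tends to 0 because [K] is bounded near [a]. *)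
Lemma triint_vertex u v : in_disk u -> in_disk v -> triint K a u v = 0.
Proof.
intros Du Dv.
destruct (excluded_middle_informative (exists s, 0 <= s <= 1 /\ a = segm u v s)) as [[s [Hs Es]]|NS].
{ unfold triint. rewrite (chasles_disk u v s), <- Es by auto. rewrite (swap_disk a u), (swap_disk a v) by auto. ring. }
assert (NZ : forall alpha beta, 0 <= alpha -> 0 <= beta -> 0 < alpha + beta ->
  (a + RtoC alpha * (u - a) + RtoC beta * (v - a) <> a)%C).
{ intros al be H1 H2 H3 E. apply NS. apply (segm_of_cone a u v al be); auto.
  replace (RtoC al * (u - a) + RtoC be * (v - a))%C with (a + RtoC al * (u - a) + RtoC be * (v - a) - a)%C by ring. rewrite E. ring. }
assert (Main : forall la, 0 < la < 1 -> triint K a u v = triint K a (segm a u la) (segm a v la)).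
{ intros la Hla.
  set (ul := segm a u la). set (vl := segm a v la).
  assert (Dul : in_disk ul) by (apply in_disk_segm; auto; lra).
  assert (Dvl : in_disk vl) by (apply in_disk_segm; auto; lra).
  assert (T1 : triint K ul u v = 0).
  { apply goursat_triangle; auto. intros x y Hx Hy Hxy.
    apply KD. apply (simplex_disk ul u v Dul Du Dv x y); auto.
    replace (ul + RtoC x * (u - ul) + RtoC y * (v - ul))%C with
      (a + RtoC (la * (1 - x - y) + x) * (u - a) + RtoC y * (v - a))%C.
    apply NZ; nra. unfold ul, segm. rewrite RtoC_plus, RtoC_mult, !RtoC_minus. ring. }
  assert (T2 : triint K ul v vl = 0).
  { apply goursat_triangle; auto. intros x y Hx Hy Hxy.
    apply KD. apply (simplex_disk ul v vl Dul Dv Dvl x y); auto.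
    replace (ul + RtoC x * (v - ul) + RtoC y * (vl - ul))%C with
      (a + RtoC (la * (1 - x - y)) * (u - a) + RtoC (x + la * y) * (v - a))%C.
    apply NZ; nra. unfold vl, ul, segm. rewrite RtoC_plus, !RtoC_mult, !RtoC_minus. ring. }
  transitivity (triint K a ul vl + triint K ul u v + triint K ul v vl)%C.
  2: rewrite T1, T2; ring.
  unfold triint. rewrite (chasles_disk a u la) by (auto; lra). rewrite (swap_disk a v) by auto. rewrite (chasles_disk a v la) by (auto; lra).
  fold ul vl. rewrite (swap_disk ul v), (swap_disk vl v), (swap_disk ul vl), (swap_disk a vl) by auto. ring. }
apply Cmod_eq_0. apply Rle_antisym; [|apply Cmod_ge_0].
apply le_epsilon. intros eps Heps. rewrite Rplus_0_l.
pose proof (KC a Da) as Ca. rewrite continuous_C_iff in Ca. specialize (Ca 1 Rlt_0_1).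
apply locally_C_iff in Ca. destruct Ca as [d [Hd Hd']].
set (M := Cmod (K a) + 1). set (L := Cmod (u - a) + Cmod (v - a)).
assert (HM : 0 < M) by (unfold M; generalize (Cmod_ge_0 (K a)); lra).
assert (HL : 0 <= L) by (unfold L; generalize (Cmod_ge_0 (u - a)) (Cmod_ge_0 (v - a)); lra).
(* The second term keeps the corner where [K] differs from [K a] by less than 1. The third makes [M]
   times the perimeter, which is at most [2 * la * L], no larger than [eps]. *)
set (la := Rmin (1 / 2) (Rmin (d / (2 * (L + 1))) (eps / (2 * M * (L + 1))))).
assert (L1 : la <= 1 / 2) by apply Rmin_l.
assert (L2 : la <= d / (2 * (L + 1))) by (eapply Rle_trans; [apply Rmin_r|apply Rmin_l]).
assert (L3 : la <= eps / (2 * M * (L + 1))) by (eapply Rle_trans; [apply Rmin_r|apply Rmin_r]).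
assert (L0 : 0 < la). { unfold la. apply Rmin_glb_lt. lra. apply Rmin_glb_lt; apply Rdiv_lt_0_compat; try lra; apply Rmult_lt_0_compat; lra. }
rewrite (Main la) by lra.
apply Rle_div_r in L2; [|nra]. apply Rle_div_r in L3; [|nra].
set (ul := segm a u la). set (vl := segm a v la).
assert (Dul : in_disk ul) by (apply in_disk_segm; auto; lra).
assert (Dvl : in_disk vl) by (apply in_disk_segm; auto; lra).
assert (Au : Cmod (ul - a) <= la * Cmod (u - a)).
{ unfold ul, segm. replace (a + RtoC la * (u - a) - a)%C with (RtoC la * (u - a))%C by ring. rewrite Cmod_mult, Cmod_R, Rabs_pos_eq; lra. }
assert (Av : Cmod (vl - a) <= la * Cmod (v - a)).
{ unfold vl, segm. replace (a + RtoC la * (v - a) - a)%C with (RtoC la * (v - a))%C by ring. rewrite Cmod_mult, Cmod_R, Rabs_pos_eq; lra. }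
assert (Aa : Cmod (a - a) <= la * L) by (replace (a - a)%C with (RtoC 0) by ring; rewrite Cmod_0; nra).
assert (B : forall b c, in_disk b -> in_disk c -> Cmod (b - a) <= la * L -> Cmod (c - a) <= la * L -> Cmod (segint K b c) <= M * Cmod (c - b)).
{ intros b c Db Dc Hb Hc. apply segint_bound. intros; apply KC, in_disk_segm; auto.
  intros t Ht. replace (K (segm b c t)) with ((K (segm b c t) - K a) + K a)%C by ring.
  eapply Rle_trans. apply Cmod_triangle. unfold M. assert (Cmod (K (segm b c t) - K a) < 1); [|lra].
  apply Hd'. unfold segm. replace (b + RtoC t * (c - b) - a)%C with (RtoC (1 - t) * (b - a) + RtoC t * (c - a))%C by (rewrite RtoC_minus; ring).
  eapply Rle_lt_trans. apply Cmod_triangle. rewrite !Cmod_mult, !Cmod_R, !Rabs_pos_eq by lra. nra. }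
assert (HCu := Cmod_ge_0 (u - a)). assert (HCv := Cmod_ge_0 (v - a)).
assert (Bu : Cmod (ul - a) <= la * L) by (unfold L; nra).
assert (Bv : Cmod (vl - a) <= la * L) by (unfold L; nra).
assert (Buv : Cmod (vl - ul) <= la * L).
{ replace (vl - ul)%C with ((vl - a) + - (ul - a))%C by ring. eapply Rle_trans. apply Cmod_triangle. rewrite Cmod_opp. unfold L. nra. }
assert (Bva : Cmod (a - vl) <= la * Cmod (v - a)).
{ replace (a - vl)%C with (- (vl - a))%C by ring. now rewrite Cmod_opp. }
unfold triint. eapply Rle_trans. apply Cmod_triangle. eapply Rle_trans. apply Rplus_le_compat_r, Cmod_triangle.
generalize (B a ul Da Dul Aa Bu) (B ul vl Dul Dvl Bu Bv) (B vl a Dvl Da Bv Aa).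
intros B1 B2 B3.
assert (M * Cmod (ul - a) <= M * (la * Cmod (u - a))) by (apply Rmult_le_compat_l; lra).
assert (M * Cmod (vl - ul) <= M * (la * L)) by (apply Rmult_le_compat_l; lra).
assert (M * Cmod (a - vl) <= M * (la * Cmod (v - a))) by (apply Rmult_le_compat_l; lra).
assert (M * (la * Cmod (u - a)) + M * (la * Cmod (v - a)) = M * (la * L)) by (unfold L; ring).
assert (la * (2 * M * (L + 1)) = 2 * (M * (la * L)) + 2 * (M * la)) by ring. assert (0 < M * la) by nra. lra.
Qed.

(** Integrating from the exceptional point itself gives every triangle that occurs a vertex at [a],
    so [triint_vertex] suffices and the increment is the integral from [z] to [y]. *)
Lemma primitive_at z : in_disk z -> Cd (segint K a) z (K z).
Proof.
intros Dz. apply is_derive_C_iff. intros eps Heps.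
pose proof (KC z Dz) as Cz. rewrite continuous_C_iff in Cz. specialize (Cz eps Heps).
apply locally_C_iff in Cz. destruct Cz as [d [Hd Hd']].
exists (Rmin d (1 - Cmod z)). split. apply Rmin_glb_lt; auto. unfold in_disk in Dz; lra.
intros y Hy.
assert (Hyd : Cmod (y - z) < d) by (eapply Rlt_le_trans; [apply Hy|apply Rmin_l]).
assert (Dy : in_disk y).
{ unfold in_disk. replace y with ((y - z) + z)%C by ring. eapply Rle_lt_trans. apply Cmod_triangle.
  assert (Cmod (y - z) < 1 - Cmod z) by (eapply Rlt_le_trans; [apply Hy|apply Rmin_r]). lra. }
pose proof (triint_vertex z y Dz Dy) as E. unfold triint in E. rewrite (swap_disk a y) in E by auto.
replace (segint K a y - segint K a z)%C with (segint K z y).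
2:{ replace (segint K z y) with ((segint K a z + segint K z y + - segint K a y) + segint K a y - segint K a z)%C by ring. rewrite E. ring. }
assert (Dt : forall t, 0 <= t <= 1 -> in_disk (segm z y t)) by (intros; now apply in_disk_segm).
assert (Cm : forall t, 0 <= t <= 1 -> continuous (fun x => K x - K z)%C (segm z y t)).
{ intros t Ht. apply continuous_Cminus. auto. apply continuous_const. }
replace (segint K z y - K z * (y - z))%C with (segint (fun x => K x - K z)%C z y).
- apply segint_bound; auto. intros t Ht. left. apply Hd'. unfold segm.
  replace (z + RtoC t * (y - z) - z)%C with (RtoC t * (y - z))%C by ring. rewrite Cmod_mult, Cmod_R, Rabs_pos_eq by lra.
  generalize (Cmod_ge_0 (y - z)). nra.
- assert (E2 : segint K z y = (segint (fun x => K x - K z)%C z y + segint (fun _ => K z) z y)%C).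
  { rewrite <- segint_plus; auto. unfold segint. apply CInt_ext. lra. intros; f_equal; ring. intros; apply continuous_const. }
  rewrite E2. unfold segint at 3. rewrite CInt_const. replace (1 - 0) with 1 by ring. ring.
Qed.

End Primitive.

(** * Cauchy's formula and Schwarz's lemma *)

(** The derivative is asked for in the open interval because in [radial_const] the equation
    multiplied by z says nothing at the centre. *)
Lemma Rd_zero_const (f : R -> C) a b : a <= b ->
  (forall t, a <= t <= b -> continuous f t) -> (forall t, a < t < b -> Rd f t (RtoC 0)) -> f b = f a.
Proof.
intros Hab HC HD.
assert (Rmin a b = a /\ Rmax a b = b) as [E1 E2] by (split; [now apply Rmin_left|now apply Rmax_right]).
apply injective_projections.
- destruct (MVT_gen (fun t => Re (f t)) a b (fun _ => 0)) as [c [_ E]]; rewrite ?E1, ?E2.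
  + intros t Ht. exact (Rd_Re _ _ _ (HD t Ht)).
  + intros t Ht. apply continuity_pt_filterlim. apply (continuous_Re f t). auto.
  + unfold Re in E. lra.
- destruct (MVT_gen (fun t => Im (f t)) a b (fun _ => 0)) as [c [_ E]]; rewrite ?E1, ?E2.
  + intros t Ht. exact (Rd_Im _ _ _ (HD t Ht)).
  + intros t Ht. apply continuity_pt_filterlim. apply (continuous_Im f t). auto.
  + unfold Im in E. lra.
Qed.

(** Differentiation under the integral sign. For the kernels 1 / (c - b) the remainder is an
    explicit multiple of the square of [b - a], so a quadratic bound uniform in [t] is the
    convenient hypothesis. *)
Lemma Cd_param (k : C -> R -> C) (k' : R -> C) (a : C) (delta C0 T : R) : 0 < delta -> 0 <= T ->
  (forall b t, Cmod (b - a) < delta -> 0 <= t <= T -> continuous (k b) t) ->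
  (forall t, 0 <= t <= T -> continuous k' t) ->
  (forall b t, Cmod (b - a) < delta -> 0 <= t <= T ->
     Cmod (k b t - k a t - (b - a) * k' t) <= C0 * (Cmod (b - a)) ^ 2) ->
  Cd (fun b => CInt (k b) 0 T) a (CInt k' 0 T).
Proof.
intros Hdel HT Ck Ck' HB. apply is_derive_C_iff. intros eps Heps.
assert (N : 0 < Rabs C0 * T + 1) by (generalize (Rabs_pos C0); nra).
exists (Rmin delta (eps / (Rabs C0 * T + 1))). split.
{ apply Rmin_glb_lt; auto. now apply Rdiv_lt_0_compat. }
intros b Hb.
assert (Hb1 : Cmod (b - a) < delta) by (eapply Rlt_le_trans; [apply Hb|apply Rmin_l]).
assert (Hb2 : Cmod (b - a) < eps / (Rabs C0 * T + 1)) by (eapply Rlt_le_trans; [apply Hb|apply Rmin_r]).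
apply Rlt_div_r in Hb2; auto.
assert (Ha : Cmod (a - a) < delta) by (replace (a - a)%C with (RtoC 0) by ring; now rewrite Cmod_0).
assert (X1 : ex_CInt (k b) 0 T) by (apply ex_CInt_cont; auto).
assert (X2 : ex_CInt (k a) 0 T) by (apply ex_CInt_cont; auto).
assert (X3 : ex_CInt k' 0 T) by (apply ex_CInt_cont; auto).
assert (X4 : ex_CInt (fun t => k b t - k a t)%C 0 T) by (apply ex_CInt_cont; auto; intros; apply continuous_Cminus; auto).
assert (X5 : ex_CInt (fun t => (b - a) * k' t)%C 0 T) by (apply ex_CInt_cont; auto; intros; apply continuous_Cmult; auto; apply continuous_const).
replace (CInt (k b) 0 T - CInt (k a) 0 T - CInt k' 0 T * (b - a))%C
  with (CInt (fun t => k b t - k a t - (b - a) * k' t)%C 0 T).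
2:{ rewrite CInt_minus, CInt_minus, CInt_Cscal by assumption. cring. }
assert (X6 : ex_CInt (fun t => k b t - k a t - (b - a) * k' t)%C 0 T).
{ apply ex_CInt_cont; auto. intros. apply continuous_Cminus. apply continuous_Cminus; auto. apply continuous_Cmult; auto; apply continuous_const. }
eapply Rle_trans.
- apply (CInt_bound _ 0 T (C0 * Cmod (b - a) ^ 2)); auto.
- rewrite Rminus_0_r. generalize (Cmod_ge_0 (b - a)) (Rle_abs C0). intros P1 P2.
  assert (C0 * T <= Rabs C0 * T) by (apply Rmult_le_compat_r; auto).
  replace (C0 * Cmod (b - a) ^ 2 * T) with (Cmod (b - a) * (C0 * T) * Cmod (b - a)) by ring.
  apply Rmult_le_compat_r; auto. nra.
Qed.

(** * Cauchy kernels on a circle *)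

Definition circ (r t : R) : C := (RtoC r * (cos t, sin t))%C.

Lemma Cmod_circ r t : 0 <= r -> Cmod (circ r t) = r.
Proof.
intros Hr. unfold circ. rewrite Cmod_mult, Cmod_R, Rabs_pos_eq by auto.
replace (Cmod (cos t, sin t)) with 1. ring.
unfold Cmod; simpl. replace (cos t * (cos t * 1) + sin t * (sin t * 1)) with 1. now rewrite sqrt_1.
generalize (sin2_cos2 t). unfold Rsqr. lra.
Qed.

Lemma Rd_circ r t : Rd (circ r) t (Ci * circ r t)%C.
Proof.
unfold circ. eapply Rd_eq. apply Rd_mult. apply Rd_const. apply Rd_pair. apply is_derive_cos. apply is_derive_sin.
apply injective_projections; simpl; ring.
Qed.

Lemma continuous_circ r t : continuous (circ r) t.
Proof. exact (Rd_continuous _ _ _ (Rd_circ r t)). Qed.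

Lemma circ_2PI r : circ r (2 * PI) = circ r 0.
Proof. unfold circ. now rewrite cos_2PI, sin_2PI, cos_0, sin_0. Qed.

Lemma circ_far r t a : 0 <= r -> r - Cmod a <= Cmod (circ r t - a).
Proof.
intros Hr. rewrite <- (Cmod_circ r t Hr) at 1.
generalize (Cmod_triangle (circ r t - a) a). replace (circ r t - a + a)%C with (circ r t) by ring. lra.
Qed.

Lemma circ_neq r t a : Cmod a < r -> (circ r t - a <> 0)%C.
Proof.
intros H E. assert (0 <= r) by (generalize (Cmod_ge_0 a); lra).
generalize (circ_far r t a H0). rewrite E, Cmod_0. lra.
Qed.

Lemma continuous_kernel r t a : Cmod a < r -> continuous (fun s => / (circ r s - a))%C t.
Proof.
intros H. apply continuous_Cinv. now apply circ_neq. apply continuous_Cminus. apply continuous_circ. apply continuous_const.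
Qed.

Section Kernel.
Variables (g : R -> C) (r G : R) (a : C).
Hypothesis Ha : Cmod a < r.
Hypothesis Cg : forall t, 0 <= t <= 2 * PI -> continuous g t.
Hypothesis HG : forall t, 0 <= t <= 2 * PI -> Cmod (g t) <= G.

Lemma two_PI_ge_0 : 0 <= 2 * PI. Proof. generalize PI_RGT_0; lra. Qed.
Lemma radius_ge_0 : 0 <= r. Proof. generalize (Cmod_ge_0 a); lra. Qed.
(** Half the distance from [a] to the circle: a point [b] within [d] of [a] still has distance at
    least [d] from the circle. *)
Let d := (r - Cmod a) / 2.
Lemma kernel_d_pos : 0 < d. Proof. unfold d; lra. Qed.

Lemma kernel_near b : Cmod (b - a) < d -> Cmod b < r.
Proof.
intros H. replace b with ((b - a) + a)%C by ring. eapply Rle_lt_trans. apply Cmod_triangle. unfold d in H. lra.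
Qed.

Lemma kernel_inv_le b t : Cmod (b - a) < d -> Cmod (/ (circ r t - b)) <= / d.
Proof.
intros Hb. pose proof (kernel_near b Hb) as Hb'. rewrite Cmod_inv by now apply circ_neq.
apply Rinv_le_contravar. apply kernel_d_pos. eapply Rle_trans. 2: apply circ_far, radius_ge_0.
generalize (Cmod_triangle (b - a) a). replace (b - a + a)%C with b by ring. unfold d in *. lra.
Qed.

Lemma kernel_center : Cmod (a - a) < d.
Proof. replace (a - a)%C with (RtoC 0) by ring. rewrite Cmod_0. apply kernel_d_pos. Qed.

Lemma Cd_kernel1 :
  Cd (fun b => CInt (fun t => g t * / (circ r t - b))%C 0 (2 * PI)) a
     (CInt (fun t => g t * (/ (circ r t - a) * / (circ r t - a)))%C 0 (2 * PI)).
Proof.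
apply (Cd_param (fun b t => g t * / (circ r t - b))%C _ a d (G * (/ d * / d * / d))).
- apply kernel_d_pos.
- apply two_PI_ge_0.
- intros b t Hb Ht. apply continuous_Cmult; auto. apply continuous_kernel. now apply kernel_near.
- intros t Ht. apply continuous_Cmult; auto. apply continuous_Cmult; now apply continuous_kernel.
- intros b t Hb Ht. pose proof (circ_neq r t a Ha). pose proof (circ_neq r t b (kernel_near b Hb)).
  replace (g t * / (circ r t - b) - g t * / (circ r t - a) - (b - a) * (g t * (/ (circ r t - a) * / (circ r t - a))))%C
    with (g t * (/ (circ r t - a) * / (circ r t - a) * / (circ r t - b)) * ((b - a) * (b - a)))%C by (field; auto).
  rewrite !Cmod_mult. replace (Cmod (b - a) ^ 2) with (Cmod (b - a) * Cmod (b - a)) by ring.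
  pose proof kernel_d_pos. pose proof (Rinv_0_lt_compat _ H1).
  assert (0 <= Cmod (b - a)) by apply Cmod_ge_0.
  apply Rmult_le_compat_r. nra.
  repeat apply Rmult_le_compat; auto using Cmod_ge_0, kernel_inv_le, kernel_center; repeat apply Rmult_le_pos; apply Cmod_ge_0.
Qed.

Lemma Cd_kernel2 :
  Cd (fun b => CInt (fun t => g t * (/ (circ r t - b) * / (circ r t - b)))%C 0 (2 * PI)) a
     (CInt (fun t => g t * (2 * (/ (circ r t - a) * / (circ r t - a) * / (circ r t - a))))%C 0 (2 * PI)).
Proof.
(* With A and B the kernels at [a] and [b], the remainder is [g t] times A^2 B^2 + 2 A^3 B times the
   square of [b - a]; hence the factor 3 and the fourth power of [/ d]. *)
apply (Cd_param (fun b t => g t * (/ (circ r t - b) * / (circ r t - b)))%C _ a d (G * (3 * (/ d * / d * / d * / d)))).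
- apply kernel_d_pos.
- apply two_PI_ge_0.
- intros b t Hb Ht. apply continuous_Cmult; auto. apply continuous_Cmult; apply continuous_kernel; now apply kernel_near.
- intros t Ht. apply continuous_Cmult; auto. apply continuous_Cmult. apply continuous_const.
  apply continuous_Cmult; [apply continuous_Cmult|]; now apply continuous_kernel.
- intros b t Hb Ht. pose proof (circ_neq r t a Ha). pose proof (circ_neq r t b (kernel_near b Hb)).
  set (A := (/ (circ r t - a))%C). set (B := (/ (circ r t - b))%C).
  replace (g t * (B * B) - g t * (A * A) - (b - a) * (g t * (2 * (A * A * A))))%C
    with (g t * (A * A * B * B + 2 * (A * A * A * B)) * ((b - a) * (b - a)))%C by (unfold A, B; field; auto).
  rewrite (Cmod_mult (g t * _)), (Cmod_mult (b - a)), (Cmod_mult (g t)). replace (Cmod (b - a) ^ 2) with (Cmod (b - a) * Cmod (b - a)) by ring.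
  pose proof kernel_d_pos. pose proof (Rinv_0_lt_compat _ H1).
  assert (0 <= Cmod (b - a)) by apply Cmod_ge_0.
  apply Rmult_le_compat_r. nra. apply Rmult_le_compat; auto using Cmod_ge_0.
  eapply Rle_trans. apply Cmod_triangle. rewrite !Cmod_mult, Cmod_R, (Rabs_pos_eq 2) by lra.
  assert (HA : Cmod A <= / d) by (apply kernel_inv_le, kernel_center).
  assert (HB : Cmod B <= / d) by (now apply kernel_inv_le).
  assert (PA := Cmod_ge_0 A). assert (PB := Cmod_ge_0 B).
  assert (Cmod A * Cmod A * Cmod B * Cmod B <= / d * / d * / d * / d).
  { repeat apply Rmult_le_compat; auto; repeat apply Rmult_le_pos; auto. }
  assert (Cmod A * Cmod A * Cmod A * Cmod B <= / d * / d * / d * / d).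
  { repeat apply Rmult_le_compat; auto; repeat apply Rmult_le_pos; auto. }
  lra.
Qed.

End Kernel.

(** No logarithm is involved: as a function of the pole, the integral has derivative 0, because the
    differentiated integrand is the derivative of [Ci * / (circ r t - b)] along a closed curve. At
    the pole 0 the integrand is 1. *)
Lemma CInt_kernel_one r a : Cmod a < r ->
  CInt (fun t => circ r t * / (circ r t - a))%C 0 (2 * PI) = RtoC (2 * PI).
Proof.
intros Ha.
assert (Hpi := two_PI_ge_0). assert (Hr := radius_ge_0 r a Ha).
set (N := fun b => CInt (fun t => circ r t * / (circ r t - b))%C 0 (2 * PI)).
assert (DN : forall b, Cmod b < r -> Cd N b (RtoC 0)).
{ intros b Hb. eapply Cd_eq.
  apply (Cd_kernel1 (circ r) r r b Hb (fun t _ => continuous_circ r t) (fun t _ => Req_le _ _ (Cmod_circ r t Hr))).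
  rewrite (CInt_FTC (fun t => Ci * / (circ r t - b))%C).
  - rewrite circ_2PI. cring.
  - auto.
  - intros t _. pose proof (circ_neq r t b Hb). eapply Rd_eq.
    apply (Rd_comp (fun z => Ci * / (z - b))%C (circ r)). apply Rd_circ.
    apply Cd_mult. apply Cd_const. apply Cd_inv. apply Cd_minus. apply Cd_id. apply Cd_const. auto.
    assert (E : (Ci * Ci = - (1))%C) by (apply injective_projections; simpl; ring).
    cbv beta. match goal with |- @eq _ ?x ?y => change (@eq C x y) end.
    transitivity (- (Ci * Ci) * circ r t * (/ (circ r t - b) * / (circ r t - b)))%C. field; auto. rewrite E. field; auto.
  - intros t _. apply continuous_Cmult. apply continuous_circ. apply continuous_Cmult; now apply continuous_kernel. }
change (N a = RtoC (2 * PI)).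
assert (HR : forall t, 0 <= t <= 1 -> Cmod (segm 0 a t) < r).
{ intros t Ht. unfold segm. replace (0 + RtoC t * (a - 0))%C with (RtoC t * a)%C by ring.
  rewrite Cmod_mult, Cmod_R, Rabs_pos_eq by lra. generalize (Cmod_ge_0 a). nra. }
assert (RD : forall t, 0 <= t <= 1 -> Rd (fun s => N (segm 0 a s)) t (RtoC 0)).
{ intros t Ht. eapply Rd_eq. apply (Rd_comp N). apply Rd_segm. apply DN. auto. cring. }
pose proof (Rd_zero_const (fun s => N (segm 0 a s)) 0 1 Rle_0_1 (fun t Ht => Rd_continuous _ _ _ (RD t Ht)) (fun t Ht => RD t ltac:(lra))) as E.
cbv beta in E. replace (segm 0 a 1) with a in E by (unfold segm; ring). replace (segm 0 a 0) with (RtoC 0) in E by (unfold segm; ring).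
rewrite E. unfold N. transitivity (CInt (fun _ => RtoC 1) 0 (2 * PI)).
- apply CInt_ext; auto. intros t _. assert (circ r t - 0 <> 0)%C. apply circ_neq. rewrite Cmod_0. specialize (HR 0). generalize (Cmod_ge_0 a); lra.
  field. intros E2. apply H. rewrite E2. ring.
- rewrite CInt_const, Rminus_0_r. cring.
Qed.

Lemma in_disk_circ r t : 0 <= r < 1 -> in_disk (circ r t).
Proof. intros H. unfold in_disk. rewrite Cmod_circ; lra. Qed.

Lemma analytic_continuous f z : analytic f -> in_disk z -> continuous f z.
Proof. intros H Hz. destruct (H z Hz) as [l Hl]. exact (Cd_continuous _ _ _ Hl). Qed.

Lemma continuous_on_circ f r t : analytic f -> 0 <= r < 1 -> continuous (fun s => f (circ r s)) t.
Proof.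
intros Hf Hr. apply (continuous_comp (circ r) f). apply continuous_circ. apply analytic_continuous; auto. now apply in_disk_circ.
Qed.

(** The difference quotient of [f] at [a], extended continuously by the slope function [q],
    satisfies the hypotheses of the section on primitives with exceptional point [a]. Hence its
    integral over the circle is 0, and [CInt_kernel_one] evaluates the rest. *)
Lemma cauchy_formula f r a : analytic f -> Cmod a < r < 1 ->
  CInt (fun t => f (circ r t) * circ r t * / (circ r t - a))%C 0 (2 * PI) = (RtoC (2 * PI) * f a)%C.
Proof.
intros Hf [Ha Hr]. pose proof (radius_ge_0 r a Ha) as Hr0. assert (Hpi := two_PI_ge_0).
assert (Da : in_disk a) by (unfold in_disk; lra).
destruct (Hf a Da) as [l Hl]. destruct (Cd_carath _ _ _ Hl) as [q [Cq [_ Eq]]].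
assert (Hq : forall y, y <> a -> q y = ((f y - f a) / (y - a))%C).
{ intros y Hy. rewrite Eq. field. intros E. apply Hy. replace y with (y - a + a)%C by ring. rewrite E; ring. }
assert (KD : forall z, in_disk z -> z <> a -> exists l, Cd q z l).
{ intros z Dz Hz. destruct (Hf z Dz) as [m Hm]. eexists.
  apply (Cd_ext_loc (fun y => (f y - f a) / (y - a))%C).
  - assert (z - a <> 0)%C by (intros E; apply Hz; replace z with (z - a + a)%C by ring; rewrite E; ring).
    assert (CC : @continuous C_UniformSpace C_UniformSpace (fun y => y - a)%C z) by (apply continuous_Cminus; [apply continuous_id|apply continuous_const]).
    generalize (continuous_nonzero _ z CC H). apply filter_imp. intros y Hy. symmetry. apply Hq. intros ->. apply Hy. ring.
  - apply Cd_div. apply Cd_minus. exact Hm. apply Cd_const. apply Cd_minus. apply Cd_id. apply Cd_const.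
    intros E; apply Hz; replace z with (z - a + a)%C by ring; rewrite E; ring. }
assert (KC : forall z, in_disk z -> continuous q z).
{ intros z Dz. destruct (Ceq_dec z a) as [->|Hz]; auto. destruct (KD z Dz Hz) as [m Hm]. exact (Cd_continuous _ _ _ Hm). }
assert (E : CInt (fun t => q (circ r t) * (Ci * circ r t))%C 0 (2 * PI) = RtoC 0).
{ rewrite (CInt_FTC (fun t => segint q a (circ r t))).
  - rewrite circ_2PI. cring.
  - auto.
  - intros t _. apply (Rd_comp (segint q a)). apply Rd_circ. apply primitive_at; auto. now apply in_disk_circ.
  - intros t _. apply continuous_Cmult. apply (continuous_comp (circ r) q). apply continuous_circ. apply KC. now apply in_disk_circ.
    apply continuous_Cmult. apply continuous_const. apply continuous_circ. }
rewrite <- (CInt_kernel_one r a Ha).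
assert (X1 : ex_CInt (fun t => circ r t * / (circ r t - a))%C 0 (2 * PI)).
{ apply ex_CInt_cont; auto. intros t _. apply continuous_Cmult. apply continuous_circ. now apply continuous_kernel. }
assert (X2 : ex_CInt (fun t => q (circ r t) * (Ci * circ r t))%C 0 (2 * PI)).
{ apply ex_CInt_cont; auto. intros t _. apply continuous_Cmult. apply (continuous_comp (circ r) q). apply continuous_circ. apply KC. now apply in_disk_circ.
    apply continuous_Cmult. apply continuous_const. apply continuous_circ. }
transitivity (CInt (fun t => f a * (circ r t * / (circ r t - a)) + (- Ci) * (q (circ r t) * (Ci * circ r t)))%C 0 (2 * PI)).
- apply CInt_ext; auto. intros t _. pose proof (circ_neq r t a Ha).
  rewrite Hq by (intros EE; apply H; rewrite EE; ring).
  assert (EC : (Ci * Ci = - (1))%C) by (apply injective_projections; simpl; ring).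
  match goal with |- @eq _ ?x ?y => change (@eq C x y) end.
  transitivity (f a * (circ r t * / (circ r t - a)) - (Ci * Ci) * ((f (circ r t) - f a) / (circ r t - a) * circ r t))%C.
  rewrite EC. field; auto. field; auto.
- rewrite CInt_plus, !CInt_Cscal by (auto; eexists; apply is_CInt_Cscal; apply (RInt_correct (V := C_R_CompleteNormedModule)); auto).
  rewrite E. cring.
Qed.

Lemma bounded_on_circ (g : R -> C) : (forall t, 0 <= t <= 2 * PI -> continuous g t) ->
  exists G, forall t, 0 <= t <= 2 * PI -> Cmod (g t) <= G.
Proof.
intros H. destruct (continuity_ab_maj (fun t => Cmod (g t)) 0 (2 * PI) two_PI_ge_0) as [m [Hm _]].
- intros t Ht. apply continuity_pt_filterlim. apply (continuous_Cmod g). auto.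
- now exists (Cmod (g m)).
Qed.

Lemma disk_radius z : in_disk z -> exists r, Cmod z < r < 1.
Proof. unfold in_disk. intros H. exists ((Cmod z + 1) / 2). lra. Qed.

Lemma open_ball_locally r z : Cmod z < r -> @locally C_UniformSpace z (fun y => Cmod y < r).
Proof.
intros H. apply locally_C_iff. exists (r - Cmod z). split. lra. intros y Hy.
replace y with ((y - z) + z)%C by ring. eapply Rle_lt_trans. apply Cmod_triangle. lra.
Qed.

Lemma C_derive_unique f z l : Cd f z l -> C_derive f z = l.
Proof. apply is_C_derive_unique. Qed.

Lemma Cd_C_derive f z : analytic f -> in_disk z -> Cd f z (C_derive f z).
Proof. intros H Hz. apply C_derive_correct; auto. Qed.

Lemma two_PI_neq_0 : RtoC (2 * PI) <> 0.
Proof. intros E. apply RtoC_inj in E. generalize PI_RGT_0. lra. Qed.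

(** Cauchy's formula writes [f] near [z] as a kernel integral with a fixed weight [g].
    Differentiating it once identifies the derivative of [f] nearby, and [Cd_kernel2] differentiates
    that. *)
Lemma analytic_C_derive f : analytic f -> analytic (C_derive f).
Proof.
intros Hf z Hz. destruct (disk_radius z Hz) as [r [Hzr Hr]]. pose proof (radius_ge_0 r z Hzr) as Hr0.
set (g := fun t => (f (circ r t) * circ r t)%C).
assert (Cg : forall t, 0 <= t <= 2 * PI -> continuous g t).
{ intros. apply continuous_Cmult. apply continuous_on_circ; auto. apply continuous_circ. }
destruct (bounded_on_circ g Cg) as [G HG].
eexists. apply (Cd_ext_loc (fun b => / RtoC (2 * PI) * CInt (fun t => g t * (/ (circ r t - b) * / (circ r t - b)))%C 0 (2 * PI))%C).
2:{ apply Cd_mult. apply Cd_const. apply (Cd_kernel2 g r G z Hzr Cg HG). }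
generalize (open_ball_locally r z Hzr). apply filter_imp. intros y Hy. symmetry. apply C_derive_unique.
apply (Cd_ext_loc (fun b => / RtoC (2 * PI) * CInt (fun t => g t * / (circ r t - b))%C 0 (2 * PI))%C).
- generalize (open_ball_locally r y Hy). apply filter_imp. intros b Hb. unfold g. rewrite cauchy_formula by auto. cfield. apply two_PI_neq_0.
- eapply Cd_eq. apply Cd_mult. apply Cd_const. apply (Cd_kernel1 g r G y Hy Cg HG). cring.
Qed.

Definition divz (f : C -> C) (z : C) : C :=
  if Ceq_dec z 0 then C_derive f 0 else ((f z - f 0) / z)%C.

Lemma in_disk_0 : in_disk 0.
Proof. unfold in_disk. rewrite Cmod_0. lra. Qed.

Lemma locally_neq (z a : C) : z <> a -> @locally C_UniformSpace z (fun y => y <> a).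
Proof.
intros H. assert (z - a <> 0)%C by (intros E; apply H; replace z with (z - a + a)%C by ring; rewrite E; ring).
assert (CC : @continuous C_UniformSpace C_UniformSpace (fun y => y - a)%C z) by (apply continuous_Cminus; [apply continuous_id|apply continuous_const]).
generalize (continuous_nonzero _ z CC H0). apply filter_imp. intros y Hy ->. apply Hy. ring.
Qed.

(** At 0 the quotient is again a kernel integral: c / (c - b) - 1 = b / (c - b), so subtracting
    Cauchy's formulas at [b] and 0 yields [b] times the differentiable function [h]. *)
Lemma analytic_divz f : analytic f -> analytic (divz f).
Proof.
intros Hf z Hz. destruct (Ceq_dec z 0) as [->|Hz0].
- set (r := 1 / 2). assert (Hr : 0 <= r < 1) by (unfold r; lra). assert (H0r : Cmod 0 < r) by (rewrite Cmod_0; unfold r; lra).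
  set (g := fun t => f (circ r t)).
  assert (Cg : forall t, 0 <= t <= 2 * PI -> continuous g t) by (intros; apply continuous_on_circ; auto).
  destruct (bounded_on_circ g Cg) as [G HG].
  set (h := fun b => (/ RtoC (2 * PI) * CInt (fun t => g t * / (circ r t - b))%C 0 (2 * PI))%C).
  assert (Dh : exists l, Cd h (RtoC 0) l).
  { eexists. apply Cd_mult. apply Cd_const. apply (Cd_kernel1 g r G 0 H0r Cg HG). }
  assert (Eh : forall b, Cmod b < r -> (f b - f 0 = b * h b)%C).
  { intros b Hb. assert (X : forall b', Cmod b' < r -> ex_CInt (fun t => f (circ r t) * circ r t * / (circ r t - b'))%C 0 (2 * PI)).
    { intros b' Hb'. apply ex_CInt_cont. apply two_PI_ge_0. intros. apply continuous_Cmult. apply continuous_Cmult. now apply Cg. apply continuous_circ. now apply continuous_kernel. }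
    assert (F : (RtoC (2 * PI) * (f b - f 0) = b * (RtoC (2 * PI) * h b))%C).
    { transitivity (RtoC (2 * PI) * f b - RtoC (2 * PI) * f 0)%C. ring.
      rewrite <- (cauchy_formula f r b), <- (cauchy_formula f r 0) by (auto; lra). rewrite <- CInt_minus by auto.
      transitivity (CInt (fun t => b * (g t * / (circ r t - b)))%C 0 (2 * PI)).
      - apply CInt_ext. apply two_PI_ge_0. intros t _. pose proof (circ_neq r t b Hb). pose proof (circ_neq r t 0 H0r).
        unfold g. cfield. split; auto. intros E. apply H0. rewrite E. ring.
      - rewrite CInt_Cscal. unfold h. cfield. apply two_PI_neq_0. apply ex_CInt_cont. apply two_PI_ge_0. intros. apply continuous_Cmult. now apply Cg. now apply continuous_kernel. }
    replace (f b - f 0)%C with (/ RtoC (2 * PI) * (RtoC (2 * PI) * (f b - f 0)))%C by (field; apply two_PI_neq_0).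
    rewrite F. field. apply two_PI_neq_0. }
  destruct Dh as [l Hl]. exists l. apply (Cd_ext_loc h); auto.
  generalize (open_ball_locally r 0 H0r). apply filter_imp. intros y Hy. unfold divz. destruct (Ceq_dec y 0) as [->|Hy0].
  + symmetry. apply C_derive_unique. apply (Cd_ext_loc (fun b => f 0 + b * h b)%C).
    * generalize (open_ball_locally r 0 H0r). apply filter_imp. intros b Hb. rewrite <- Eh by auto. cring.
    * eapply Cd_eq. apply Cd_plus. apply Cd_const. apply Cd_mult. apply Cd_id. exact Hl. cring.
  + rewrite Eh by auto. cfield. auto.
- destruct (Hf z Hz) as [l Hl]. eexists. apply (Cd_ext_loc (fun y => (f y - f 0) / y)%C).
  + generalize (locally_neq z 0 Hz0). apply filter_imp. intros y Hy. unfold divz. now destruct (Ceq_dec y 0).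
  + apply Cd_div. apply Cd_minus. exact Hl. apply Cd_const. apply Cd_id. auto.
Qed.

Lemma divz_spec (f : C -> C) (z : C) : f 0 = 0 -> (f z = z * divz f z)%C.
Proof.
intros H. unfold divz. destruct (Ceq_dec z 0) as [->|Hz]. rewrite H. ring. rewrite H. field. auto.
Qed.

Lemma cauchy_bound (f : C -> C) r a M : analytic f -> Cmod a < r < 1 -> (forall t, Cmod (f (circ r t)) <= M) ->
  Cmod (f a) <= M * r / (r - Cmod a).
Proof.
intros Hf [Ha Hr] HM. pose proof (radius_ge_0 r a Ha) as Hr0.
assert (B : Cmod (RtoC (2 * PI) * f a) <= M * r / (r - Cmod a) * (2 * PI - 0)).
{ rewrite <- (cauchy_formula f r a) by auto. apply CInt_bound. apply two_PI_ge_0.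
  - apply ex_CInt_cont. apply two_PI_ge_0. intros. apply continuous_Cmult. apply continuous_Cmult. apply continuous_on_circ; auto. apply continuous_circ. now apply continuous_kernel.
  - intros t _. rewrite !Cmod_mult, Cmod_circ by auto. rewrite Cmod_inv by now apply circ_neq.
    unfold Rdiv. apply Rmult_le_compat. apply Rmult_le_pos; auto. apply Cmod_ge_0.
    left. apply Rinv_0_lt_compat, Cmod_gt_0. now apply circ_neq.
    apply Rmult_le_compat_r; auto. apply Rinv_le_contravar. lra. now apply circ_far. }
rewrite Cmod_mult, Cmod_R, Rabs_pos_eq, Rminus_0_r in B by (generalize PI_RGT_0; lra).
apply Rmult_le_reg_l with (2 * PI). generalize PI_RGT_0; lra. lra.
Qed.

Lemma analytic_mult f g : analytic f -> analytic g -> analytic (fun z => f z * g z)%C.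
Proof. intros Hf Hg z Hz. destruct (Hf z Hz) as [l Hl]. destruct (Hg z Hz) as [m Hm]. eexists. apply Cd_mult; eauto. Qed.

Lemma analytic_const c : analytic (fun _ => c).
Proof. intros z _. eexists. apply Cd_const. Qed.

(* Applying the Cauchy bound to all powers of [w z / z] removes the factor [r / (r - |z|)]. *)
Lemma schwarz (w : C -> C) : analytic w -> w 0 = 0 -> (forall z, in_disk z -> Cmod (w z) < 1) ->
  forall z, in_disk z -> Cmod (w z) <= Cmod z.
Proof.
intros Hw H0 H1 z Hz.
set (h := divz w). assert (Ah : analytic h) by now apply analytic_divz.
rewrite (divz_spec w z H0). fold h. rewrite Cmod_mult.
cut (Cmod (h z) <= 1). generalize (Cmod_ge_0 z). nra.
cut (forall r, Cmod z < r < 1 -> r * Cmod (h z) <= 1).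
{ intros H. destruct (Rle_dec (Cmod (h z)) 1) as [|N]; auto. exfalso. unfold in_disk in Hz.
  (* Both arguments are midpoints with 1, so [r] exceeds [Cmod z] and [/ Cmod (h z)] and is still
     below 1. *)
  set (r := Rmax ((Cmod z + 1) / 2) ((1 + / Cmod (h z)) / 2)).
  assert (/ Cmod (h z) < 1) by (rewrite <- Rinv_1; apply Rinv_lt_contravar; lra).
  assert (R1 := Rmax_l ((Cmod z + 1) / 2) ((1 + / Cmod (h z)) / 2)). assert (R2 := Rmax_r ((Cmod z + 1) / 2) ((1 + / Cmod (h z)) / 2)). fold r in R1, R2.
  assert (r < 1) by (unfold r; apply Rmax_lub_lt; lra).
  specialize (H r ltac:(lra)).
  assert (1 < r * Cmod (h z)); [|lra].
  apply Rlt_le_trans with ((1 + / Cmod (h z)) / 2 * Cmod (h z)). 2: apply Rmult_le_compat_r; lra.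
  replace ((1 + / Cmod (h z)) / 2 * Cmod (h z)) with ((Cmod (h z) + 1) / 2) by (field; lra). lra. }
intros r Hr. assert (Hr0 := radius_ge_0 r z (proj1 Hr)). assert (Hrp : 0 < r) by (generalize (Cmod_ge_0 z); lra).
destruct (Rle_dec (r * Cmod (h z)) 1) as [|N]; auto. exfalso.
assert (B : forall n, (r * Cmod (h z)) ^ n <= r / (r - Cmod z)).
{ intros n.
  assert (An : analytic (fun y => Cpow (h y) n)) by (induction n; simpl; [apply analytic_const|now apply analytic_mult]).
  assert (HM : forall t, Cmod (Cpow (h (circ r t)) n) <= (/ r) ^ n).
  { intros t. rewrite Cmod_pow. apply pow_incr. split. apply Cmod_ge_0.
    assert (Dc : in_disk (circ r t)) by (apply in_disk_circ; lra).
    specialize (H1 _ Dc). rewrite (divz_spec w _ H0) in H1. fold h in H1. rewrite Cmod_mult, Cmod_circ in H1 by auto.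
    apply Rmult_le_reg_l with r; auto. rewrite Rinv_r; lra. }
  pose proof (cauchy_bound _ r z _ An Hr HM) as E. cbv beta in E. rewrite Cmod_pow in E.
  rewrite Rpow_mult_distr. assert (0 < r ^ n) by now apply pow_lt.
  apply Rmult_le_compat_l with (r := r ^ n) in E; [|lra]. rewrite pow_inv in E.
  eapply Rle_trans. apply E. right. field. split; lra. }
assert (N' : Rabs (r * Cmod (h z)) > 1) by (rewrite Rabs_pos_eq; lra).
destruct (Pow_x_infinity _ N' (r / (r - Cmod z) + 1)) as [n Hn]. specialize (Hn n (le_n _)). specialize (B n).
rewrite Rabs_pos_eq in Hn by (apply pow_le; lra). lra.
Qed.

(** * The real primitive of (phi_RL (x) - 1) / x *)

Definition kappa : R := 2 * (sqrt 2 - 1).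

Lemma sqrt2_sq : sqrt 2 * sqrt 2 = 2.
Proof. apply sqrt_sqrt. lra. Qed.

Lemma sqrt2_bounds : 1.4142 < sqrt 2 < 1.4143.
Proof. split; (apply Rsqr_incrst_0; [unfold Rsqr; rewrite ?sqrt2_sq; lra| |]); try apply sqrt_pos; lra. Qed.

Lemma kappa_bounds : 0.8284 < kappa < 0.8286.
Proof. unfold kappa. generalize sqrt2_bounds. lra. Qed.

Definition phi_RLr (x : R) : R := sqrt 2 - (sqrt 2 - 1) * sqrt ((1 - x) / (1 + kappa * x)).

Definition prim_RL (x : R) : R := kappa * ln ((sqrt (1 - x) + sqrt (kappa * x + 1)) / 2) + g0 x.

(* [(phi_RLr x - 1) / x], rationalised so that [0] is not exceptional. *)
Definition dprim_RL (x : R) : R :=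
  kappa * (kappa + 1) / (2 * sqrt (kappa * x + 1) * (sqrt (1 - x) + sqrt (kappa * x + 1))).

Lemma kappa_x_pos x : -1 <= x <= 1 -> 0 < kappa * x + 1.
Proof. generalize kappa_bounds. nra. Qed.

Lemma x_dprim_RL x : -1 <= x <= 1 -> x * dprim_RL x = phi_RLr x - 1.
Proof.
intros Hx. pose proof (kappa_x_pos x Hx) as H1. unfold dprim_RL, phi_RLr.
rewrite (Rplus_comm 1 (kappa * x)), sqrt_div by lra.
assert (Hb : 0 < sqrt (kappa * x + 1)) by now apply sqrt_lt_R0.
assert (Ha : 0 <= sqrt (1 - x)) by apply sqrt_pos.
assert (Eb : sqrt (kappa * x + 1) * sqrt (kappa * x + 1) = kappa * x + 1) by (apply sqrt_sqrt; lra).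
assert (Ea : sqrt (1 - x) * sqrt (1 - x) = 1 - x) by (apply sqrt_sqrt; lra).
set (a := sqrt (1 - x)) in *. set (b := sqrt (kappa * x + 1)) in *.
replace (sqrt 2) with (kappa / 2 + 1) by (unfold kappa; lra).
replace (kappa / 2 + 1 - (kappa / 2 + 1 - 1) * (a / b) - 1) with (kappa * ((b - a) * (a + b)) / (2 * b * (a + b))) by (field; lra).
replace ((b - a) * (a + b)) with ((kappa + 1) * x) by (replace ((b - a) * (a + b)) with (b * b - a * a) by ring; rewrite Ea, Eb; ring).
field. lra.
Qed.

Lemma prim_RL_args_pos x : -1 <= x <= 1 ->
  0 < sqrt (1 - x) + sqrt (kappa * x + 1) /\ 0 < kappa * sqrt (1 - x) + sqrt (kappa * x + 1).
Proof.
intros Hx. pose proof (kappa_x_pos x Hx) as H1.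
assert (Hb : 0 < sqrt (kappa * x + 1)) by now apply sqrt_lt_R0.
assert (Ha : 0 <= sqrt (1 - x)) by apply sqrt_pos. generalize kappa_bounds. nra.
Qed.

Lemma is_derive_prim_RL x : -1 < x < 1 -> is_derive prim_RL x (dprim_RL x).
Proof.
intros Hx. destruct (prim_RL_args_pos x ltac:(lra)) as [P1 P2]. pose proof (kappa_x_pos x ltac:(lra)) as H1.
assert (Hb : 0 < sqrt (kappa * x + 1)) by now apply sqrt_lt_R0.
assert (Ha : 0 < sqrt (1 - x)) by (apply sqrt_lt_R0; lra).
assert (Hk := kappa_bounds).
unfold prim_RL, g0. fold kappa.
set (s := sqrt kappa). assert (Es : s * s = kappa) by (apply sqrt_sqrt; lra).
auto_derive.
- change (0 < 1 - x /\ 0 < kappa * x + 1 /\ 0 < (sqrt (1 - x) + sqrt (kappa * x + 1)) * / 2 /\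
   (0 < kappa * x + 1 /\ 0 < 1 - x /\ 0 < 1 - x /\ 0 < kappa * x + 1 /\ kappa * sqrt (1 - x) + sqrt (kappa * x + 1) <> 0 /\ True)).
  repeat split; lra.
- unfold dprim_RL. replace (1 + - x) with (1 - x) by ring.
  assert (Eb : sqrt (kappa * x + 1) * sqrt (kappa * x + 1) = kappa * x + 1) by (apply sqrt_sqrt; lra).
  assert (Ea : sqrt (1 - x) * sqrt (1 - x) = 1 - x) by (apply sqrt_sqrt; lra).
  set (a := sqrt (1 - x)) in *. set (b := sqrt (kappa * x + 1)) in *.
  (* This sum of squares is the denominator coming from the derivative of [atan]; it does not depend
     on [x], which is why the derivative simplifies. *)
  assert (Q : (kappa * a + b) * (kappa * a + b) + kappa * ((b - a) * (b - a)) = (1 + kappa) * (1 + kappa)).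
  { transitivity ((1 + kappa) * (kappa * (a * a) + b * b)). ring. rewrite Ea, Eb. ring. }
  assert (Q0 : (kappa * a + b) * (kappa * a + b) + kappa * ((b - a) * (b - a)) <> 0) by (rewrite Q; nra).
  match goal with |- _ + ?B = _ => replace B with
    (kappa * ((kappa * / (2 * b) + / (2 * a)) * (kappa * a + b) - (b - a) * (kappa * / (2 * b) - kappa * / (2 * a))) /
      ((kappa * a + b) * (kappa * a + b) + kappa * ((b - a) * (b - a)))) end.
  + rewrite Q.
    replace ((kappa * / (2 * b) + / (2 * a)) * (kappa * a + b) - (b - a) * (kappa * / (2 * b) - kappa * / (2 * a)))
      with ((1 + kappa) * (kappa * (a * a) + b * b) / (2 * a * b)) by (field; lra).
    rewrite Ea, Eb. field. lra.
  (* Once [kappa] is replaced by [s * s], the identity is rational in [s], [a] and [b]. *)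
  + clear - Es Q0 Ha Hb P2. clearbody s a b. revert Es Q0 P2. generalize kappa. intros k Es Q0 P2. subst k.
    field. repeat split; lra.
Qed.

Lemma dprim_RL_pos x : -1 <= x <= 1 -> 0 < dprim_RL x.
Proof.
intros Hx. destruct (prim_RL_args_pos x Hx) as [P1 P2]. pose proof (kappa_x_pos x Hx) as H1.
assert (Hb : 0 < sqrt (kappa * x + 1)) by now apply sqrt_lt_R0. assert (Hk := kappa_bounds).
unfold dprim_RL. apply Rdiv_lt_0_compat. nra. apply Rmult_lt_0_compat; lra.
Qed.

(** At 1 the function [sqrt (1 - x)] has no derivative, so continuity up to the end points needs its
    own proof. It is two-sided there because [sqrt] is 0 on negative numbers. *)
Lemma continuous_prim_RL x : -1 <= x <= 1 -> continuity_pt prim_RL x.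
Proof.
intros Hx. destruct (prim_RL_args_pos x Hx) as [P1 P2]. pose proof (kappa_x_pos x Hx) as H1.
assert (C1 : continuity_pt (fun x => sqrt (1 - x)) x).
{ apply (continuity_pt_comp (fun x => 1 - x) sqrt). { apply continuity_pt_filterlim, (ex_derive_continuous (V := R_NormedModule)). now auto_derive. } apply continuity_pt_sqrt. lra. }
assert (C2 : continuity_pt (fun x => sqrt (kappa * x + 1)) x).
{ apply (continuity_pt_comp (fun x => kappa * x + 1) sqrt). { apply continuity_pt_filterlim. apply (ex_derive_continuous (V := R_NormedModule) (fun x => kappa * x + 1) x). now auto_derive. } apply continuity_pt_sqrt. lra. }
unfold prim_RL. apply continuity_pt_plus.
- apply continuity_pt_scal. apply (continuity_pt_comp (fun x => (sqrt (1 - x) + sqrt (kappa * x + 1)) / 2) ln).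
  + apply (continuity_pt_mult (fun x => sqrt (1 - x) + sqrt (kappa * x + 1)) (fun _ => / 2)).
    apply (continuity_pt_plus _ _ _ C1 C2). apply continuity_pt_const. intros ? ?; reflexivity.
  + apply derivable_continuous_pt. exists (/ ((sqrt (1 - x) + sqrt (kappa * x + 1)) / 2)). apply derivable_pt_lim_ln. lra.
- unfold g0. fold kappa. apply continuity_pt_scal.
  apply (continuity_pt_comp (fun x => sqrt kappa * (sqrt (kappa * x + 1) - sqrt (1 - x)) / (kappa * sqrt (1 - x) + sqrt (kappa * x + 1))) atan).
  + apply (continuity_pt_div (fun x => sqrt kappa * (sqrt (kappa * x + 1) - sqrt (1 - x))) (fun x => kappa * sqrt (1 - x) + sqrt (kappa * x + 1))).
    * apply (continuity_pt_scal (fun x => sqrt (kappa * x + 1) - sqrt (1 - x))). apply (continuity_pt_minus _ _ _ C2 C1).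
    * apply (continuity_pt_plus (fun x => kappa * sqrt (1 - x))); auto. now apply continuity_pt_scal.
    * lra.
  + apply derivable_continuous_pt. apply derivable_pt_atan.
Qed.

Lemma prim_RL_0 : prim_RL 0 = 0.
Proof.
unfold prim_RL, g0. fold kappa. rewrite Rmult_0_r, Rplus_0_l, Rminus_0_r, sqrt_1.
replace ((1 + 1) / 2) with 1 by field. rewrite ln_1.
replace (sqrt kappa * (1 - 1) / (kappa * 1 + 1)) with 0. rewrite atan_0. ring.
unfold Rdiv. ring.
Qed.

Lemma prim_RL_incr x y : -1 <= x -> x < y -> y <= 1 -> prim_RL x < prim_RL y.
Proof.
intros Hx Hxy Hy.
destruct (MVT_gen prim_RL x y dprim_RL) as [c [Hc E]].
- intros t. rewrite Rmin_left, Rmax_right by lra. intros. apply is_derive_prim_RL; lra.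
- intros t. rewrite Rmin_left, Rmax_right by lra. intros. apply continuous_prim_RL; lra.
- rewrite Rmin_left, Rmax_right in Hc by lra. pose proof (dprim_RL_pos c ltac:(lra)). nra.
Qed.

Lemma bound_a_prim : bound_a = 3 / 2 * - prim_RL (-1).
Proof.
unfold bound_a, prim_RL. fold kappa. replace (1 - -1) with 2 by ring. replace (kappa * -1 + 1) with (1 - kappa) by ring.
replace (1 / 2 * (sqrt (1 - kappa) + sqrt 2)) with ((sqrt 2 + sqrt (1 - kappa)) / 2) by field. ring.
Qed.

Lemma bound_b_prim : bound_b = prim_RL 1 / ln (5 / 3).
Proof.
unfold bound_b, prim_RL. fold kappa. rewrite Rminus_diag, sqrt_0, Rmult_1_r, Rplus_0_l.
replace (1 / 2 * sqrt (kappa + 1)) with (sqrt (kappa + 1) / 2) by field. reflexivity.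
Qed.

Lemma bound_c_prim : bound_c = 5 / 2 * prim_RL 1.
Proof.
unfold bound_c, prim_RL. fold kappa. rewrite Rminus_diag, sqrt_0, Rmult_1_r, Rplus_0_l.
replace (1 / 2 * sqrt (kappa + 1)) with (sqrt (kappa + 1) / 2) by field. reflexivity.
Qed.

(** * The disks containing phi_RL *)

Lemma Cmod_sq z : Cmod z * Cmod z = Re z * Re z + Im z * Im z.
Proof. generalize (Cmod2_alt z). simpl. lra. Qed.

Lemma Csqrt_sq z : (Csqrt z * Csqrt z = z)%C.
Proof.
pose proof (Rle_trans _ _ _ (Rle_abs _) (re_le_Cmod z)) as H1.
pose proof (Rle_trans _ _ _ (Rle_abs (- Re z)) ltac:(rewrite Rabs_Ropp; apply re_le_Cmod)) as H2.
assert (A : 0 <= (Cmod z + Re z) / 2) by lra. assert (B : 0 <= (Cmod z - Re z) / 2) by lra.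
pose proof (sqrt_sqrt _ A) as SA. pose proof (sqrt_sqrt _ B) as SB.
(* The product of the two parts gives the imaginary part up to sign; the sign in [Csqrt] restores
   it. *)
assert (P : sqrt ((Cmod z + Re z) / 2) * sqrt ((Cmod z - Re z) / 2) = Rabs (Im z) / 2).
{ rewrite <- sqrt_mult by assumption.
  replace ((Cmod z + Re z) / 2 * ((Cmod z - Re z) / 2)) with (Rsqr (Im z / 2)).
  rewrite sqrt_Rsqr_abs. unfold Rdiv. rewrite Rabs_mult, (Rabs_pos_eq (/ 2)) by lra. reflexivity.
  unfold Rsqr. replace ((Cmod z + Re z) / 2 * ((Cmod z - Re z) / 2)) with ((Cmod z * Cmod z - Re z * Re z) / 4) by field.
  rewrite Cmod_sq. field. }
unfold Csqrt. apply injective_projections; simpl; set (a := sqrt _) in *; set (b := sqrt _) in *.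
- fold (Re z). destruct Rle_dec; nra.
- fold (Im z). destruct (Rle_dec 0 (Im z)) as [Hi|Hi].
  + rewrite Rabs_pos_eq in P by auto. lra.
  + rewrite Rabs_left in P by lra. lra.
Qed.

Lemma Csqrt_Re_ge0 z : 0 <= Re (Csqrt z).
Proof. apply sqrt_pos. Qed.

Lemma Csqrt_Re_gt0 z : 0 < Re z -> 0 < Re (Csqrt z).
Proof. intros H. apply sqrt_lt_R0. generalize (Cmod_ge_0 z). lra. Qed.

Lemma Csqrt_real x : 0 <= x -> Csqrt (RtoC x) = RtoC (sqrt x).
Proof.
intros Hx. unfold Csqrt. rewrite Cmod_R, Rabs_pos_eq by auto. simpl.
replace ((x + x) / 2) with x by field. replace ((x - x) / 2) with 0 by field. rewrite sqrt_0, Rmult_0_r. reflexivity.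
Qed.

(** The slope of the square root is exactly the inverse of a sum of two roots, and nonnegative real
    parts keep that sum away from 0. Continuity and the derivative both follow. *)
Lemma Csqrt_diff y z : 0 < Re z -> (Csqrt y - Csqrt z = / (Csqrt y + Csqrt z) * (y - z))%C /\
  Re (Csqrt z) <= Cmod (Csqrt y + Csqrt z).
Proof.
intros Hz.
assert (H : Re (Csqrt z) <= Cmod (Csqrt y + Csqrt z)).
{ eapply Rle_trans. 2: apply re_le_Cmod. eapply Rle_trans. 2: apply Rle_abs.
  change (Re (Csqrt y + Csqrt z)) with (Re (Csqrt y) + Re (Csqrt z)). generalize (Csqrt_Re_ge0 y). lra. }
split; auto.
rewrite <- (Csqrt_sq y) at 3. rewrite <- (Csqrt_sq z) at 3. field.
apply Cmod_gt_0. generalize (Csqrt_Re_gt0 z Hz). lra.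
Qed.

Lemma continuous_Csqrt z : 0 < Re z -> @continuous C_UniformSpace C_UniformSpace Csqrt z.
Proof.
intros Hz. pose proof (Csqrt_Re_gt0 z Hz) as P. apply continuous_C_iff. intros eps Heps. apply locally_C_iff.
exists (eps * Re (Csqrt z)). split. nra. intros y Hy.
destruct (Csqrt_diff y z Hz) as [E B]. rewrite E, Cmod_mult, Cmod_inv by (apply Cmod_gt_0; lra).
apply Rmult_lt_reg_l with (Cmod (Csqrt y + Csqrt z)). lra.
rewrite <- Rmult_assoc, Rinv_r, Rmult_1_l by lra. nra.
Qed.

Lemma Cd_Csqrt z : 0 < Re z -> Cd Csqrt z (/ (Csqrt z + Csqrt z))%C.
Proof.
intros Hz. pose proof (continuous_Csqrt z Hz) as CS.
apply (carath_Cd _ (fun y => / (Csqrt y + Csqrt z))%C).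
- apply continuous_Cinv. intros E. destruct (Csqrt_diff z z Hz) as [_ B]. rewrite E, Cmod_0 in B. generalize (Csqrt_Re_gt0 z Hz); lra.
  apply continuous_Cplus; auto. apply continuous_const.
- apply filter_forall. intros y. apply Csqrt_diff. auto.
Qed.

Definition moebius (z : C) : C := ((1 - z) / (1 + RtoC kappa * z))%C.

Lemma moebius_den z : in_disk z -> 0 < Re (1 + RtoC kappa * z).
Proof.
intros Hz. replace (Re (1 + RtoC kappa * z)) with (1 + kappa * Re z) by (unfold Re; simpl; ring).
pose proof (re_le_Cmod z). unfold in_disk in Hz. generalize kappa_bounds. apply Rabs_le_between in H. nra.
Qed.

Lemma moebius_den_neq z : in_disk z -> (1 + RtoC kappa * z <> 0)%C.
Proof. intros Hz E. generalize (moebius_den z Hz). rewrite E. simpl. lra. Qed.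

(** A Moebius map with real coefficients preserves symmetry about the real line, so the images of
    [t] and [- t] are the ends of a diameter of the image disk. *)
Lemma moebius_disc (z : C) (t : R) : Cmod z <= t < 1 ->
  0 < (1 - t) / (1 + kappa * t) <= (1 + t) / (1 - kappa * t) /\
  0 <= (Re (moebius z) - (1 - t) / (1 + kappa * t)) * ((1 + t) / (1 - kappa * t) - Re (moebius z)) - Im (moebius z) * Im (moebius z).
Proof.
intros [Hz Ht]. assert (Dz : in_disk z) by (unfold in_disk; lra). assert (H0 := Cmod_ge_0 z). assert (Hk := kappa_bounds).
assert (P1 : 0 < 1 + kappa * t) by nra. assert (P2 : 0 < 1 - kappa * t) by nra.
split.
{ split. apply Rdiv_lt_0_compat; lra. apply Rle_div_l; auto.
  replace ((1 + t) / (1 - kappa * t) * (1 + kappa * t)) with ((1 + t) * (1 + kappa * t) / (1 - kappa * t)) by (field; lra).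
  apply Rle_div_r; auto. nra. }
pose proof (moebius_den z Dz) as D. assert (Sq := Cmod_sq z).
assert (Sq2 : Cmod z * Cmod z <= t * t) by nra.
destruct z as [p q]. unfold moebius. simpl in *. unfold Re, Im in *. simpl in *.
set (N := (1 + kappa * p) * (1 + kappa * p) + kappa * q * (kappa * q)).
assert (HN : 0 < N) by (unfold N; nra).
(* [N] is the squared modulus of the denominator of [moebius]; the sign is decided by t^2 -
   |z|^2. *)
match goal with |- 0 <= ?x => replace x with ((1 + kappa) * (1 + kappa) * (t * t - (p * p + q * q)) / (N * ((1 + kappa * t) * (1 - kappa * t)))) end.
- apply Rdiv_le_0_compat. apply Rmult_le_pos. nra. lra. apply Rmult_lt_0_compat; auto. apply Rmult_lt_0_compat; lra.
- unfold N. field. repeat split; try lra; unfold N in HN; intros E; nra.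
Qed.

(** With P the expression in the conclusion, the expression for S^2 in the hypothesis equals [P * N]
    minus a square, where [N] is positive; so P is nonnegative. *)
Lemma sqrt_disc (S : C) (s2 t2 : R) : 0 < Re S -> 0 < s2 <= t2 ->
  0 <= (Re (S * S) - s2) * (t2 - Re (S * S)) - Im (S * S) * Im (S * S) ->
  0 <= (Re S - sqrt s2) * (sqrt t2 - Re S) - Im S * Im S.
Proof.
intros HS [H1 H2]. assert (E1 := sqrt_sqrt s2 ltac:(lra)). assert (E2 := sqrt_sqrt t2 ltac:(lra)).
assert (P1 : 0 < sqrt s2) by (apply sqrt_lt_R0; lra). assert (P2 : sqrt s2 <= sqrt t2) by (apply sqrt_le_1; lra).
set (a := sqrt s2) in *. set (b := sqrt t2) in *. rewrite <- E1, <- E2.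
destruct S as [x y]. unfold Re, Im in *. simpl in *. intros H.
set (P := (x - a) * (b - x) - y * y). set (N := (x + a) * (b + x) + y * y).
replace ((x * x - y * y - a * a) * (b * b - (x * x - y * y)) - (x * y + y * x) * (x * y + y * x)) with
  (P * N - (y * (b - a)) * (y * (b - a))) in H by (unfold P, N; ring).
assert (HN : 0 < N).
{ assert (0 < (x + a) * (b + x)) by (apply Rmult_lt_0_compat; lra). generalize (Rle_0_sqr y). unfold N, Rsqr. lra. }
apply Rmult_le_reg_r with N; auto. generalize (Rle_0_sqr (y * (b - a))). unfold Rsqr. lra.
Qed.

Lemma moebius_Re_pos z : in_disk z -> 0 < Re (moebius z).
Proof.
intros Hz. destruct (moebius_disc z (Cmod z)) as [[A B] D]. unfold in_disk in Hz; lra.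
set (s := (1 - Cmod z) / _) in *. set (u := (1 + Cmod z) / _) in *.
assert (0 <= (Re (moebius z) - s) * (u - Re (moebius z))) by nra. nra.
Qed.

Lemma phi_RL_moebius z : phi_RL z = (RtoC (sqrt 2) - RtoC (sqrt 2 - 1) * Csqrt (moebius z))%C.
Proof. reflexivity. Qed.

(* Here and below a closed disk with real diameter [[a, b]] is encoded as
   [0 <= (x - a) * (b - x) - y^2]. *)
Lemma phi_RL_disc z t : Cmod z <= t < 1 ->
  0 <= (Re (phi_RL z) - phi_RLr (- t)) * (phi_RLr t - Re (phi_RL z)) - Im (phi_RL z) * Im (phi_RL z).
Proof.
intros H. destruct (moebius_disc z t H) as [A B].
assert (Dz : in_disk z) by (unfold in_disk; lra).
pose proof (sqrt_disc (Csqrt (moebius z)) _ _ (Csqrt_Re_gt0 _ (moebius_Re_pos z Dz)) A) as D.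
rewrite Csqrt_sq in D. specialize (D B).
rewrite phi_RL_moebius. unfold phi_RLr.
replace (1 - - t) with (1 + t) by ring. replace (1 + kappa * - t) with (1 - kappa * t) by ring.
set (c := sqrt 2 - 1). assert (0 < c) by (unfold c; generalize sqrt2_bounds; lra).
set (s := sqrt ((1 - t) / (1 + kappa * t))) in *. set (u := sqrt ((1 + t) / (1 - kappa * t))) in *.
destruct (Csqrt (moebius z)) as [x y]. unfold Re, Im in *. simpl in *.
match goal with |- 0 <= ?e => replace e with ((c * c) * ((x - s) * (u - x) - y * y)) by ring end.
apply Rmult_le_pos; nra.
Qed.

Lemma phi_RL_real x : -1 < x < 1 -> phi_RL (RtoC x) = RtoC (phi_RLr x).
Proof.
intros Hx. unfold phi_RLr. rewrite phi_RL_moebius. unfold moebius.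
assert (P := kappa_x_pos x ltac:(lra)).
replace ((1 - RtoC x) / (1 + RtoC kappa * RtoC x))%C with (RtoC ((1 - x) / (1 + kappa * x))).
- rewrite Csqrt_real by (apply Rdiv_le_0_compat; lra). now rewrite <- RtoC_mult, <- RtoC_minus.
- rewrite RtoC_div, RtoC_minus, RtoC_plus, RtoC_mult by lra. reflexivity.
Qed.

Lemma phi_RL_0 : phi_RL 0 = 1.
Proof.
rewrite phi_RL_real by lra. unfold phi_RLr. replace ((1 - 0) / (1 + kappa * 0)) with 1 by (field; rewrite Rmult_0_r; lra). rewrite sqrt_1. f_equal. ring.
Qed.

Lemma analytic_phi_RL : analytic phi_RL.
Proof.
intros z Hz. eexists. apply (Cd_minus (fun _ => RtoC (sqrt 2)) (fun z => RtoC (sqrt 2 - 1) * Csqrt (moebius z))%C). apply Cd_const.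
apply Cd_mult. apply Cd_const. apply (Cd_comp Csqrt moebius). 2: apply Cd_Csqrt, moebius_Re_pos; auto.
apply Cd_div. apply Cd_minus. apply Cd_const. apply Cd_id. apply Cd_plus. apply Cd_const. apply Cd_mult. apply Cd_const. apply Cd_id.
now apply moebius_den_neq.
Qed.

Lemma dot_le dx dy p q rho : dx * dx + dy * dy = 1 -> p * p + q * q <= rho * rho -> 0 <= rho ->
  dx * p + dy * q <= rho.
Proof.
intros H1 H2 H3. apply Rsqr_incr_0_var; auto. unfold Rsqr.
assert (0 <= (dx * q - dy * p) * (dx * q - dy * p)) by apply Rle_0_sqr. nra.
Qed.

(** Testing in every direction reduces a planar estimate to scalar ones, to which the mean value
    theorem applies. *)
Lemma norm_le_of_dot P Q rho : (forall dx dy, dx * dx + dy * dy = 1 -> dx * P + dy * Q <= rho) ->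
  P * P + Q * Q <= rho * rho.
Proof.
intros H. set (n := sqrt (P * P + Q * Q)).
assert (Hn : n * n = P * P + Q * Q) by (apply sqrt_sqrt; nra).
assert (n0 : 0 <= n) by apply sqrt_pos.
destruct (Req_dec n 0) as [E|E]. { rewrite E in Hn. nra. }
specialize (H (P / n) (Q / n)).
replace (P / n * (P / n) + Q / n * (Q / n)) with ((P * P + Q * Q) / (n * n)) in H by (field; auto).
replace (P / n * P + Q / n * Q) with ((P * P + Q * Q) / n) in H by (field; auto).
rewrite <- Hn in H. replace (n * n / n) with n in H by (field; auto).
specialize (H ltac:(field; auto)). nra.
Qed.

Lemma is_derive_prim_RL_lin s t : -1 < s * t < 1 -> is_derive (fun x => prim_RL (s * x)) t (s * dprim_RL (s * t)).
Proof.
intros H. apply (is_derive_comp prim_RL (fun x => s * x)). now apply is_derive_prim_RL.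
auto_derive; auto. ring.
Qed.

(* The derivative of [prim_RL (s t) - prim_RL (- s t)] and of [prim_RL (s t) + prim_RL (- s t)] in [t] are
   the diameter and twice the centre of the disk of [phi_RL_disc] up to the factor [1 / t], so the
   disks integrate along the ray through [z]; the comparison is made in each direction [(dx, dy)]. *)
Lemma growth_disc (L l F : C -> C) (w : C -> C) (beta : R) :
  L 0 = 0 ->
  (forall z, in_disk z -> Cd L z (l z)) ->
  (forall z, in_disk z -> (RtoC beta * (z * l z) = F z - 1)%C) ->
  (forall z, in_disk z -> F z = phi_RL (w z)) ->
  (forall z, in_disk z -> Cmod (w z) <= Cmod z) ->
  forall z, in_disk z ->
  0 <= (beta * Re (L z) - prim_RL (- Cmod z)) * (prim_RL (Cmod z) - beta * Re (L z)) - (beta * Im (L z)) * (beta * Im (L z)).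
Proof.
intros L0 HL HF Fw Hw z Dz. set (s := Cmod z). assert (Hs : 0 <= s < 1) by (split; [apply Cmod_ge_0|exact Dz]).
set (c := (prim_RL s + prim_RL (- s)) / 2). set (rho := (prim_RL s - prim_RL (- s)) / 2).
cut ((beta * Re (L z) - c) * (beta * Re (L z) - c) + (beta * Im (L z)) * (beta * Im (L z)) <= rho * rho).
{ unfold c, rho. intros. nra. }
apply norm_le_of_dot. intros dx dy Hd.
(* The first two terms are the support function, in the direction [(dx, dy)], of the disk reached at
   [segm 0 z t]; the component of [beta * L] in that direction is subtracted. *)
set (psi := fun t => (1 + dx) / 2 * prim_RL (s * t) + (dx - 1) / 2 * prim_RL ((- s) * t) -
   (beta * dx * Re (L (segm 0 z t)) + beta * dy * Im (L (segm 0 z t)))).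
set (dpsi := fun t => (1 + dx) / 2 * (s * dprim_RL (s * t)) + (dx - 1) / 2 * ((- s) * dprim_RL ((- s) * t)) -
   (beta * dx * Re (l (segm 0 z t) * (z - 0)) + beta * dy * Im (l (segm 0 z t) * (z - 0)))).
assert (Dt : forall t, 0 <= t <= 1 -> in_disk (segm 0 z t)) by (intros; apply in_disk_segm; auto; apply in_disk_0).
assert (D : forall t, 0 <= t <= 1 -> is_derive psi t (dpsi t)).
{ intros t Ht. unfold psi, dpsi. pose proof (Rd_comp _ _ _ _ _ (Rd_segm 0 z t) (HL _ (Dt t Ht))) as HR.
  apply (is_derive_minus (V := R_NormedModule)).
  - apply (is_derive_plus (V := R_NormedModule)); apply is_derive_scal, is_derive_prim_RL_lin; nra.
  - apply (is_derive_plus (V := R_NormedModule)); apply is_derive_scal. now apply Rd_Re. now apply Rd_Im. }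
destruct (MVT_cor2 psi dpsi 0 1 Rlt_0_1) as [t [E Ht]].
{ intros t Ht. apply is_derive_Reals. auto. }
assert (P0 : psi 0 = 0).
{ unfold psi. rewrite !Rmult_0_r, prim_RL_0. replace (segm 0 z 0) with (RtoC 0) by (unfold segm; ring). rewrite L0. simpl. ring. }
assert (P1 : psi 1 = rho - (dx * (beta * Re (L z) - c) + dy * (beta * Im (L z)))).
{ unfold psi, rho, c. replace (segm 0 z 1) with z by (unfold segm; ring). rewrite !Rmult_1_r. field. }
cut (0 <= dpsi t). intros; rewrite P0, P1 in E; lra.
(* The factor [t] turns [l y * z] into [y * l y], which the differential equation expresses through
   [F]. *)
cut (0 <= t * dpsi t). { intros. apply Rmult_le_reg_l with t; lra. }
set (y := segm 0 z t) in *. assert (Dy : in_disk y) by (apply Dt; lra).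
assert (Ey : (y = RtoC t * z)%C) by (unfold y, segm; ring).
set (x := s * t). assert (Hx : 0 <= x < 1) by (unfold x; nra).
assert (Cy : Cmod y = x) by (rewrite Ey, Cmod_mult, Cmod_R, Rabs_pos_eq by lra; unfold x, s; ring).
pose proof (phi_RL_disc (w y) x ltac:(split; [rewrite <- Cy; apply Hw; auto|lra])) as PD.
rewrite <- Fw in PD by auto.
assert (E1 := x_dprim_RL x ltac:(lra)). assert (E2 := x_dprim_RL (- x) ltac:(lra)).
assert (Q1 := dprim_RL_pos x ltac:(lra)). assert (Q2 := dprim_RL_pos (- x) ltac:(lra)).
assert (EX : (RtoC beta * (RtoC t * (l y * (z - 0))) = F y - 1)%C) by (rewrite <- HF by auto; rewrite Ey at 2; ring).
assert (EXr : beta * (t * Re (l y * (z - 0))) = Re (F y) - 1).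
{ apply (f_equal Re) in EX. unfold Re in *. simpl in *. lra. }
assert (EXi : beta * (t * Im (l y * (z - 0))) = Im (F y)).
{ apply (f_equal Im) in EX. unfold Im in *. simpl in *. lra. }
unfold dpsi. fold y. replace (- s * t) with (- x) by (unfold x; ring). fold x.
match goal with |- 0 <= ?e => replace e with ((1 + dx) / 2 * (x * dprim_RL x) + (dx - 1) / 2 * (- x * dprim_RL (- x)) -
  (dx * (beta * (t * Re (l y * (z - 0)))) + dy * (beta * (t * Im (l y * (z - 0)))))) by (unfold x; field) end.
rewrite EXr, EXi, E1, E2.
assert (R1 : 0 <= phi_RLr x - 1) by (rewrite <- E1; nra). assert (R2 : phi_RLr (- x) - 1 <= 0) by (rewrite <- E2; nra).
pose proof (dot_le dx dy (Re (F y) - (phi_RLr x + phi_RLr (- x)) / 2) (Im (F y)) ((phi_RLr x - phi_RLr (- x)) / 2) Hd) as DL.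
assert (X1 : (Re (F y) - (phi_RLr x + phi_RLr (- x)) / 2) * (Re (F y) - (phi_RLr x + phi_RLr (- x)) / 2) + Im (F y) * Im (F y) <=
  (phi_RLr x - phi_RLr (- x)) / 2 * ((phi_RLr x - phi_RLr (- x)) / 2)) by nra.
specialize (DL X1 ltac:(lra)). lra.
Qed.

(** * Numerical bounds *)

Lemma derive_ge0_le (f df : R -> R) a b : a <= b -> (forall x, a <= x <= b -> is_derive f x (df x)) ->
  (forall x, a <= x <= b -> 0 <= df x) -> f a <= f b.
Proof.
intros [Hab| ->] Hd Hp; [|lra].
destruct (MVT_cor2 f df a b Hab) as [c [E Hc]].
{ intros. apply is_derive_Reals. auto. }
specialize (Hp c ltac:(lra)). nra.
Qed.

(* Pade approximants of [ln] and [atan], for which the derivative of the error is a monomial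
   over a positive denominator. *)
Lemma ln_le_pade x : 1 <= x -> ln x <= (x - 1) * (x + 5) / (4 * x + 2).
Proof.
intros Hx.
pose proof (derive_ge0_le (fun x => (x - 1) * (x + 5) / (4 * x + 2) - ln x)
  (fun x => 4 * (x - 1) ^ 3 / (x * (4 * x + 2) ^ 2)) 1 x Hx) as H.
cbv beta in H. rewrite ln_1 in H.
cut ((1 - 1) * (1 + 5) / (4 * 1 + 2) - 0 <= (x - 1) * (x + 5) / (4 * x + 2) - ln x). lra.
apply H.
- intros y Hy. auto_derive. repeat split; lra. field. repeat split; lra.
- intros y Hy. apply Rdiv_le_0_compat. apply Rmult_le_pos. lra. apply pow_le; lra.
  apply Rmult_lt_0_compat. lra. apply pow_lt; lra.
Qed.

Lemma atan_le_pade x : 0 <= x -> atan x <= x * (15 + 4 * x ^ 2) / (15 + 9 * x ^ 2).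
Proof.
intros Hx.
pose proof (derive_ge0_le (fun x => x * (15 + 4 * x ^ 2) / (15 + 9 * x ^ 2) - atan x)
  (fun x => 36 * x ^ 6 / ((1 + x ^ 2) * (15 + 9 * x ^ 2) ^ 2)) 0 x Hx) as H.
cbv beta in H. rewrite atan_0 in H.
cut (0 * (15 + 4 * 0 ^ 2) / (15 + 9 * 0 ^ 2) - 0 <= x * (15 + 4 * x ^ 2) / (15 + 9 * x ^ 2) - atan x). unfold Rdiv; lra.
apply H.
- intros y Hy. assert (0 <= y * y) by nra. auto_derive. simpl; lra. simpl. field. repeat split; unfold Rsqr; lra.
- intros y Hy. assert (0 <= y * y) by nra. apply Rdiv_le_0_compat. apply Rmult_le_pos. lra. apply pow_le; lra.
  apply Rmult_lt_0_compat. simpl; lra. apply pow_lt; simpl; lra.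
Qed.

Lemma atan_ge_pade x : 0 <= x -> x * (105 + 55 * x ^ 2) / (105 + 90 * x ^ 2 + 9 * x ^ 4) <= atan x.
Proof.
intros Hx.
pose proof (derive_ge0_le (fun x => atan x - x * (105 + 55 * x ^ 2) / (105 + 90 * x ^ 2 + 9 * x ^ 4))
  (fun x => 576 * x ^ 8 / ((1 + x ^ 2) * (105 + 90 * x ^ 2 + 9 * x ^ 4) ^ 2)) 0 x Hx) as H.
cbv beta in H. rewrite atan_0 in H.
cut (0 - 0 * (105 + 55 * 0 ^ 2) / (105 + 90 * 0 ^ 2 + 9 * 0 ^ 4) <= atan x - x * (105 + 55 * x ^ 2) / (105 + 90 * x ^ 2 + 9 * x ^ 4)). unfold Rdiv; lra.
apply H.
- intros y Hy. assert (0 <= y * y) by nra. assert (0 <= (y * y) * (y * y)) by nra. auto_derive. simpl; lra. simpl. field. repeat split; unfold Rsqr; lra.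
- intros y Hy. assert (0 <= y * y) by nra. assert (0 <= (y * y) * (y * y)) by nra. apply Rdiv_le_0_compat. apply Rmult_le_pos. lra. apply pow_le; lra.
  apply Rmult_lt_0_compat. simpl; lra. apply pow_lt; simpl; lra.
Qed.

(** The approximant is accurate only near 1, hence the splitting into factors, here and in
    [ln_53_le]. *)
Lemma ln_2_le : ln 2 <= 0.6942.
Proof.
replace 2 with (4 / 3 * (3 / 2)) by field. rewrite ln_mult by lra.
pose proof (ln_le_pade (4 / 3) ltac:(lra)). pose proof (ln_le_pade (3 / 2) ltac:(lra)). lra.
Qed.

Lemma ln_53_le : ln (5 / 3) <= 0.5112.
Proof.
replace (5 / 3) with (5 / 4 * (4 / 3)) by field. rewrite ln_mult by lra.
pose proof (ln_le_pade (5 / 4) ltac:(lra)). pose proof (ln_le_pade (4 / 3) ltac:(lra)). lra.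
Qed.

Lemma ln_53_pos : 0 < ln (5 / 3).
Proof. rewrite <- ln_1. apply ln_increasing; lra. Qed.

(** Since [kappa + 1] is [2 * sqrt 2 - 1], the logarithm can be rewritten so that both end values
    share the logarithm of [2 / (2 * sqrt 2 - 1)], a number close to 1. *)
Lemma prim_RL_1 : prim_RL 1 = - (kappa / 2) * (ln (2 / (2 * sqrt 2 - 1)) + ln 2) + sqrt kappa * atan (sqrt kappa).
Proof.
assert (Hk := kappa_bounds). assert (H2 := sqrt2_bounds).
unfold prim_RL, g0. fold kappa. rewrite Rminus_diag, sqrt_0, Rmult_1_r, !Rplus_0_l, Rmult_0_r, Rplus_0_l, Rminus_0_r.
assert (Hs : 0 < sqrt (kappa + 1)) by (apply sqrt_lt_R0; lra).
replace (sqrt kappa * sqrt (kappa + 1) / sqrt (kappa + 1)) with (sqrt kappa) by (field; lra). f_equal.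
assert (E : ln (2 / (2 * sqrt 2 - 1)) + ln 2 = - (2 * ln (sqrt (kappa + 1) / 2))).
{ replace (2 * ln (sqrt (kappa + 1) / 2)) with (ln (sqrt (kappa + 1) / 2) + ln (sqrt (kappa + 1) / 2)) by ring.
  rewrite <- !ln_mult, <- ln_Rinv by (try apply Rdiv_lt_0_compat; try apply Rmult_lt_0_compat; try apply Rdiv_lt_0_compat; lra).
  f_equal. replace (sqrt (kappa + 1) / 2 * (sqrt (kappa + 1) / 2)) with ((sqrt (kappa + 1) * sqrt (kappa + 1)) / 4) by field.
  rewrite sqrt_sqrt by lra. unfold kappa. field. lra. }
rewrite E. field.
Qed.

Lemma prim_RL_m1 : - prim_RL (-1) = kappa * ln (2 / (2 * sqrt 2 - 1)) + sqrt kappa * atan (sqrt kappa / (3 - sqrt 2)).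
Proof.
assert (Hk := kappa_bounds). assert (H2 := sqrt2_bounds). assert (S2 := sqrt2_sq).
unfold prim_RL, g0. fold kappa. replace (1 - -1) with 2 by ring.
(* [1 - kappa] is [3 - 2 * sqrt 2], the square of [sqrt 2 - 1]. *)
replace (sqrt (kappa * -1 + 1)) with (sqrt 2 - 1).
2:{ symmetry. apply sqrt_lem_1; unfold kappa; nra. }
replace (sqrt kappa * (sqrt 2 - 1 - sqrt 2) / (kappa * sqrt 2 + (sqrt 2 - 1))) with (- (sqrt kappa / (3 - sqrt 2))).
2:{ replace (kappa * sqrt 2 + (sqrt 2 - 1)) with (3 - sqrt 2) by (unfold kappa; nra). field. lra. }
rewrite atan_opp. replace (2 / (2 * sqrt 2 - 1)) with (/ ((sqrt 2 + (sqrt 2 - 1)) / 2)) by (field; lra).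
rewrite ln_Rinv by lra. ring.
Qed.

Lemma le_div a b c : 0 < c -> a * c <= b -> a <= b / c.
Proof. intros. now apply Rle_div_r. Qed.

Lemma div_le a b c : 0 < c -> b <= a * c -> b / c <= a.
Proof. intros. now apply Rle_div_l. Qed.

(** The extra factor [s] leaves even powers only, so for [s = sqrt kappa] the bound becomes rational
    in [kappa]. *)
Lemma mult_pade_lower s d : 0 < d ->
  s * (s / d * (105 + 55 * (s / d) ^ 2) / (105 + 90 * (s / d) ^ 2 + 9 * (s / d) ^ 4)) =
  (s * s) * d * (105 * (d * d) + 55 * (s * s)) / (105 * (d * d) * (d * d) + 90 * (s * s) * (d * d) + 9 * (s * s) * (s * s)).
Proof.
intros Hd. field. assert (0 < d ^ 2) by (apply pow_lt; auto). assert (0 < d ^ 4) by (apply pow_lt; auto).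
assert (0 <= s ^ 2) by (apply pow2_ge_0). assert (0 <= s ^ 4) by (replace (s ^ 4) with ((s ^ 2) ^ 2) by ring; apply pow2_ge_0).
assert (0 <= s ^ 2 * d ^ 2) by (apply Rmult_le_pos; lra). repeat split; lra.
Qed.

Lemma mult_pade_upper s d : 0 < d ->
  s * (s / d * (15 + 4 * (s / d) ^ 2) / (15 + 9 * (s / d) ^ 2)) =
  (s * s) * (15 * (d * d) + 4 * (s * s)) / (d * (15 * (d * d) + 9 * (s * s))).
Proof.
intros Hd. field. assert (0 < d ^ 2) by (apply pow_lt; auto).
assert (0 <= s ^ 2) by (apply pow2_ge_0). repeat split; lra.
Qed.

(** The values are about 0.348 and 0.549. The lower bound on the first and the upper bound on the
    second must be tight, because [prim_RL_ratio] holds with a margin of about one percent; the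
    other two bounds serve only to order the values. *)
Lemma prim_RL_numeric : 0.3459 <= prim_RL 1 <= 0.4700 /\ 0.4730 <= - prim_RL (-1) <= 0.5510.
Proof.
rewrite prim_RL_m1, prim_RL_1.
assert (Hk := kappa_bounds). assert (H2 := sqrt2_bounds). assert (S2 := sqrt2_sq).
assert (K2 : sqrt kappa * sqrt kappa = kappa) by (apply sqrt_sqrt; lra).
assert (Kp : 0 < sqrt kappa) by (apply sqrt_lt_R0; lra).
assert (L2 := ln_2_le). assert (L2' := ln_lt_2).
assert (M0 : 0 <= ln (2 / (2 * sqrt 2 - 1))).
{ rewrite <- ln_1. apply ln_le. lra. apply le_div; lra. }
assert (M1 : ln (2 / (2 * sqrt 2 - 1)) <= 0.09).
{ eapply Rle_trans. apply ln_le_pade. apply le_div; lra.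
  replace ((2 / (2 * sqrt 2 - 1) - 1) * (2 / (2 * sqrt 2 - 1) + 5) / (4 * (2 / (2 * sqrt 2 - 1)) + 2))
    with ((3 - 2 * sqrt 2) * (10 * sqrt 2 - 3) / ((2 * sqrt 2 - 1) * (4 * sqrt 2 + 6))) by (field; lra).
  apply div_le. apply Rmult_lt_0_compat; lra. nra. }
assert (Yp : 0 <= sqrt kappa / (3 - sqrt 2)) by (apply Rdiv_le_0_compat; lra).
assert (T1l := Rmult_le_compat_l _ _ _ (Rlt_le _ _ Kp) (atan_ge_pade (sqrt kappa) ltac:(lra))).
assert (T1u := Rmult_le_compat_l _ _ _ (Rlt_le _ _ Kp) (atan_le_pade (sqrt kappa) ltac:(lra))).
assert (T2l := Rmult_le_compat_l _ _ _ (Rlt_le _ _ Kp) (atan_ge_pade _ Yp)).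
assert (T2u := Rmult_le_compat_l _ _ _ (Rlt_le _ _ Kp) (atan_le_pade _ Yp)).
set (d := 3 - sqrt 2) in *. assert (Hd : 1.5857 < d < 1.5858) by (unfold d; lra).
assert (Ed : d * d = 11 - 6 * sqrt 2) by (unfold d; nra).
replace (sqrt kappa) with (sqrt kappa / 1) in T1l at 2 3 4 5 by field. rewrite mult_pade_lower, K2 in T1l by lra.
replace (sqrt kappa) with (sqrt kappa / 1) in T1u at 4 5 6 by field. rewrite mult_pade_upper, K2 in T1u by lra.
rewrite mult_pade_lower, K2, Ed in T2l by lra. rewrite mult_pade_upper, K2, Ed in T2u by lra.
assert (Kq : 0.68624 < kappa * kappa < 0.68658) by (clear - Hk; nra).
assert (T1l' : 0.671 <= sqrt kappa * atan (sqrt kappa)).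
{ eapply Rle_trans. 2: apply T1l. apply le_div; lra. }
assert (T1u' : sqrt kappa * atan (sqrt kappa) <= 0.676).
{ eapply Rle_trans. apply T1u. apply div_le; lra. }
assert (T2l' : 0.473 <= sqrt kappa * atan (sqrt kappa / d)).
{ eapply Rle_trans. 2: apply T2l. clear - S2 H2. unfold d, kappa. apply le_div; nra. }
assert (T2u' : sqrt kappa * atan (sqrt kappa / d) <= 0.476).
{ eapply Rle_trans. apply T2u. clear - S2 H2. unfold d, kappa. apply div_le; nra. }
clear T1l T1u T2l T2u.
assert (U : 0 <= kappa * ln (2 / (2 * sqrt 2 - 1)) <= 0.0746) by (clear - Hk M0 M1; nra).
assert (U' : 0 <= kappa * ln 2 <= 0.5753) by (clear - Hk L2 L2'; nra).
assert (U'' : 0.414 <= kappa * ln 2) by (clear - Hk L2'; nra).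
lra.
Qed.

Lemma prim_RL_ratio : (prim_RL 1 - prim_RL (-1)) * ln (5 / 3) <= 4 / 3 * prim_RL 1.
Proof. destruct prim_RL_numeric as [A B]. assert (P := ln_53_pos). assert (Q := ln_53_le). nra. Qed.

(** This decides which end of the diameter binds. In (a) both ends may reach 2/3, so the longer left
    side binds; in (c) the left end may reach 2 and the right one 2/5, so the right side binds as
    long as the ratio is at most 5. *)
Lemma prim_RL_compare : 0 < prim_RL 1 <= - prim_RL (-1) /\ - prim_RL (-1) <= 5 * prim_RL 1.
Proof. destruct prim_RL_numeric as [A B]. lra. Qed.

(** * The images of the disk in the three cases *)

Definition Cexp (z : C) : C := (exp (Re z) * cos (Im z), exp (Re z) * sin (Im z)).

Lemma exp_monotone x y : x <= y -> exp x <= exp y.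
Proof. intros [H| ->]; [left; now apply exp_increasing|lra]. Qed.

Lemma Cexp_0 : Cexp 0 = 1.
Proof. unfold Cexp. simpl. rewrite exp_0, cos_0, sin_0. apply injective_projections; simpl; ring. Qed.

Lemma Cexp_RtoC x : Cexp (RtoC x) = RtoC (exp x).
Proof. unfold Cexp. simpl. rewrite cos_0, sin_0. apply injective_projections; simpl; ring. Qed.

Lemma Cexp_plus y z : Cexp (y + z) = (Cexp y * Cexp z)%C.
Proof.
unfold Cexp. destruct y as [a b], z as [c d]. simpl. unfold Re, Im. simpl. rewrite exp_plus, cos_plus, sin_plus.
apply injective_projections; simpl; ring.
Qed.

Lemma Cexp_neq_0 z : Cexp z <> 0.
Proof.
intros E. assert (H : (Cexp z * Cexp (- z) = 1)%C) by (rewrite <- Cexp_plus, Cplus_opp_r; apply Cexp_0).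
rewrite E, Cmult_0_l in H. apply RtoC_inj in H. lra.
Qed.

Lemma is_derive_0_bound (f : R -> R) l eps : is_derive f 0 l -> 0 < eps ->
  exists d, 0 < d /\ forall x, Rabs x < d -> Rabs (f x - f 0 - x * l) <= eps * Rabs x.
Proof.
intros [_ H] He. destruct (H 0 (fun P HP => HP) (mkposreal _ He)) as [d Hd]. exists d. split. apply cond_pos.
intros x Hx. specialize (Hd x).
assert (B : @ball (AbsRing_UniformSpace R_AbsRing) 0 d x) by (change (Rabs (x - 0) < d); now rewrite Rminus_0_r).
specialize (Hd B). change (Rabs (f x - f 0 - (x - 0) * l) <= eps * Rabs (x - 0)) in Hd. now rewrite Rminus_0_r in Hd.
Qed.

Lemma Cmod_le_ReIm z : Cmod z <= Rabs (Re z) + Rabs (Im z).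
Proof.
replace z with (RtoC (Re z) + Ci * RtoC (Im z))%C at 1 by (destruct z; apply injective_projections; simpl; ring).
eapply Rle_trans. apply Cmod_triangle. rewrite Cmod_mult, Cmod_Ci, !Cmod_R. lra.
Qed.

Lemma Im_le_Cmod z : Rabs (Im z) <= Cmod z.
Proof. eapply Rle_trans. apply Rmax_r. apply (Rmax_Cmod z). Qed.

Lemma Cd_Cexp_0 : Cd Cexp (RtoC 0) (RtoC 1).
Proof.
(* The real and imaginary parts of the remainder are at most [4 * e] and [5 * e] times [Cmod z],
   hence the 9. *)
apply is_derive_C_iff. intros eps Heps. set (e := Rmin 1 (eps / 9)).
assert (He : 0 < e) by (apply Rmin_glb_lt; lra). assert (He1 : e <= 1) by apply Rmin_l. assert (He2 : e <= eps / 9) by apply Rmin_r.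
destruct (is_derive_0_bound exp 1 e) as [d1 [Hd1 H1]]; auto. { generalize (is_derive_exp 0). now rewrite exp_0. }
destruct (is_derive_0_bound cos 0 e) as [d2 [Hd2 H2]]; auto. { generalize (is_derive_cos 0). now rewrite sin_0, Ropp_0. }
destruct (is_derive_0_bound sin 1 e) as [d3 [Hd3 H3]]; auto. { generalize (is_derive_sin 0). now rewrite cos_0. }
exists (Rmin (Rmin d1 d2) (Rmin d3 e)). split. { apply Rmin_glb_lt; apply Rmin_glb_lt; auto. }
intros z Hz. replace (z - 0)%C with z in * by ring. rewrite Cexp_0.
assert (B1 : Cmod z < d1) by (eapply Rlt_le_trans; [apply Hz|eapply Rle_trans; [apply Rmin_l|apply Rmin_l]]).
assert (B2 : Cmod z < d2) by (eapply Rlt_le_trans; [apply Hz|eapply Rle_trans; [apply Rmin_l|apply Rmin_r]]).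
assert (B3 : Cmod z < d3) by (eapply Rlt_le_trans; [apply Hz|eapply Rle_trans; [apply Rmin_r|apply Rmin_l]]).
assert (B4 : Cmod z < e) by (eapply Rlt_le_trans; [apply Hz|eapply Rle_trans; [apply Rmin_r|apply Rmin_r]]).
assert (X := re_le_Cmod z). assert (Y := Im_le_Cmod z). assert (Z := Cmod_ge_0 z).
set (x := Re z) in *. set (y := Im z) in *.
specialize (H1 x ltac:(lra)). specialize (H2 y ltac:(lra)). specialize (H3 y ltac:(lra)).
rewrite exp_0, Rmult_1_r in H1. rewrite cos_0, Rmult_0_r, Rminus_0_r in H2. rewrite sin_0, Rminus_0_r, Rmult_1_r in H3.
assert (Ex : 0 < exp x <= 3).
{ split. apply exp_pos. eapply Rle_trans. 2: apply exp_le_3. apply exp_monotone. generalize (Rle_abs x). lra. }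
assert (Ex1 : Rabs (exp x - 1) <= 2 * e).
{ replace (exp x - 1) with ((exp x - 1 - x) + x) by ring. eapply Rle_trans. apply Rabs_triang. nra. }
eapply Rle_trans. apply Cmod_le_ReIm.
assert (R1 : Rabs (Re (Cexp z - 1 - 1 * z)) <= 4 * e * Cmod z).
{ replace (Re (Cexp z - 1 - 1 * z)) with (exp x * (cos y - 1) + (exp x - 1 - x)) by (unfold x, y, Cexp; simpl; unfold Re, Im; simpl; ring).
  eapply Rle_trans. apply Rabs_triang. rewrite Rabs_mult, (Rabs_pos_eq (exp x)) by lra.
  assert (exp x * Rabs (cos y - 1) <= 3 * (e * Cmod z)). { apply Rmult_le_compat; try lra. apply Rabs_pos. nra. } nra. }
assert (R2 : Rabs (Im (Cexp z - 1 - 1 * z)) <= 5 * e * Cmod z).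
{ replace (Im (Cexp z - 1 - 1 * z)) with (exp x * (sin y - y) + (exp x - 1) * y) by (unfold x, y, Cexp; simpl; unfold Re, Im; simpl; ring).
  eapply Rle_trans. apply Rabs_triang. rewrite !Rabs_mult, (Rabs_pos_eq (exp x)) by lra.
  assert (exp x * Rabs (sin y - y) <= 3 * (e * Cmod z)). { apply Rmult_le_compat; try lra. apply Rabs_pos. nra. }
  assert (Rabs (exp x - 1) * Rabs y <= (2 * e) * Cmod z). { apply Rmult_le_compat; try lra; apply Rabs_pos. } lra. }
nra.
Qed.

Lemma Cd_Cexp z : Cd Cexp z (Cexp z).
Proof.
apply (Cd_ext_loc (fun y => Cexp z * Cexp (y - z))%C).
- apply filter_forall. intros y. rewrite <- Cexp_plus. f_equal. cring.
- eapply Cd_eq. apply Cd_mult. apply Cd_const. apply (Cd_comp Cexp (fun y => y - z)%C). apply Cd_minus. apply Cd_id. apply Cd_const.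
  cbv beta. replace (z - z)%C with (RtoC 0) by ring. apply Cd_Cexp_0. cring.
Qed.

Lemma disc_enlarge a b a' b' x y : 0 <= a -> 0 <= b -> a <= a' -> b <= b' ->
  0 <= (x + a) * (b - x) - y * y -> - a <= x <= b /\ (x + a) * (b - x) <= (x + a') * (b' - x).
Proof.
intros Ha Hb Haa Hbb H.
assert (- a <= x <= b). { split; apply Rnot_lt_le; intros N; nra. }
split; auto. apply Rmult_le_compat; lra.
Qed.

Lemma disc_enlarge_strict a b a' b' x y : 0 <= a < a' -> 0 <= b < b' ->
  0 <= (x + a) * (b - x) - y * y -> 0 < (x + a') * (b' - x) - y * y.
Proof.
intros Ha Hb H.
destruct (disc_enlarge a b a b x y) as [Hx _]; try lra.
assert ((x + a) * (b - x) < (x + a') * (b' - x)); [|lra].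
apply Rle_lt_trans with ((x + a) * (b' - x)). apply Rmult_le_compat_l; lra. apply Rmult_lt_compat_r; lra.
Qed.

(** [V] stands for a value [L z] and [s] for [Cmod z]. As [s < 1], monotonicity of [prim_RL] makes
    the inclusion strict. Each of the three cases chooses its own [A'] and [B']. *)
Lemma region_disc V s beta A' B' : 0 <= s < 1 -> 0 < beta ->
  - prim_RL (-1) <= beta * A' -> prim_RL 1 <= beta * B' ->
  0 <= (beta * Re V - prim_RL (- s)) * (prim_RL s - beta * Re V) - (beta * Im V) * (beta * Im V) ->
  0 < (Re V + A') * (B' - Re V) - Im V * Im V.
Proof.
intros Hs Hb HA HB H.
assert (E1 : prim_RL (-1) < prim_RL (- s)) by (apply prim_RL_incr; lra).
assert (E2 : prim_RL s < prim_RL 1) by (apply prim_RL_incr; lra).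
assert (E3 : 0 <= prim_RL s). { rewrite <- prim_RL_0. destruct (Req_dec s 0) as [->|]. lra. left; apply prim_RL_incr; lra. }
assert (E4 : prim_RL (- s) <= 0). { rewrite <- prim_RL_0. destruct (Req_dec s 0) as [->|]. rewrite Ropp_0; lra. left; apply prim_RL_incr; lra. }
pose proof (disc_enlarge_strict (- prim_RL (- s)) (prim_RL s) (beta * A') (beta * B') (beta * Re V) (beta * Im V)) as D.
specialize (D ltac:(lra) ltac:(lra) ltac:(lra)).
apply Rmult_lt_reg_l with (beta * beta). nra. rewrite Rmult_0_r.
eapply Rlt_le_trans. apply D. right. ring.
Qed.

Lemma Cmod_lt_sq z r : 0 < r -> Re z * Re z + Im z * Im z < r * r -> Cmod z < r.
Proof. intros Hr H. rewrite <- Cmod_sq in H. generalize (Cmod_ge_0 z). nra. Qed.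

Lemma region_a V s beta : 0 <= s < 1 -> bound_a <= beta ->
  0 <= (beta * Re V - prim_RL (- s)) * (prim_RL s - beta * Re V) - (beta * Im V) * (beta * Im V) ->
  Cmod (1 + V - 1) < 2 / 3.
Proof.
rewrite bound_a_prim. destruct prim_RL_compare as [[E0 E1] E2]. intros Hs Hb H.
apply (region_disc V s beta (2 / 3) (2 / 3)) in H; auto; try lra.
replace (1 + V - 1)%C with V by ring. apply Cmod_lt_sq; nra.
Qed.

Lemma region_c V s beta : 0 <= s < 1 -> bound_c <= beta ->
  0 <= (beta * Re V - prim_RL (- s)) * (prim_RL s - beta * Re V) - (beta * Im V) * (beta * Im V) ->
  (1 - V <> 0)%C /\ Cmod (/ (1 - V) - 1) < 2 / 3.
Proof.
rewrite bound_c_prim. destruct prim_RL_compare as [[E0 E1] E2]. intros Hs Hb H.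
(* 1 / (1 - V) takes the values 1/3 and 5/3 at -2 and 2/5, so it maps the disk with this diameter
   onto |p - 1| < 2/3. *)
apply (region_disc V s beta 2 (2 / 5)) in H; auto; try lra.
assert (N : (1 - V <> 0)%C).
{ intros N. replace V with (RtoC 1) in H. simpl in H. lra. replace V with (1 - (1 - V))%C by ring. rewrite N. ring. }
split; auto. replace (/ (1 - V) - 1)%C with (V / (1 - V))%C by (field; auto).
rewrite Cmod_div by auto. apply Rlt_div_l. now apply Cmod_gt_0.
assert (S1 := Cmod_sq V). assert (S2 := Cmod_sq (1 - V)).
replace (Re (1 - V)) with (1 - Re V) in S2 by (unfold Re; simpl; ring).
replace (Im (1 - V)) with (- Im V) in S2 by (unfold Im; simpl; ring).
assert (P1 := Cmod_ge_0 V). assert (P2 := Cmod_ge_0 (1 - V)).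
assert (Cmod V * Cmod V < (2 / 3 * Cmod (1 - V)) * (2 / 3 * Cmod (1 - V))) by nra. nra.
Qed.

Lemma cos_ge y : 1 - y * y / 2 <= cos y.
Proof.
assert (H : forall y, 0 <= y -> 1 - y * y / 2 <= cos y).
{ intros x Hx. pose proof (derive_ge0_le (fun x => cos x - (1 - x * x / 2)) (fun x => x - sin x) 0 x Hx) as D.
  cbv beta in D. rewrite cos_0 in D. cut (1 - (1 - 0 * 0 / 2) <= cos x - (1 - x * x / 2)). lra. apply D.
  - intros t Ht. auto_derive; auto. field.
  - intros t Ht. destruct (Req_dec t 0) as [->|]. rewrite sin_0; lra. generalize (sin_lt_x t ltac:(lra)). lra. }
destruct (Rle_dec 0 y). auto. rewrite <- cos_neg. replace (y * y) with (- y * - y) by ring. apply H. lra.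
Qed.

(* [g] below is convex on the interval and vanishes with nonpositive slope at its right end point. *)
Lemma exp_disc_aux m x l : x = ln (5 / 3) -> 0 <= m -> (1 + m) * x <= 4 / 3 -> - (m * x) <= l <= x ->
  (exp l + 5 / 9 * exp (- l)) / 2 <= 1 - (l + m * x) * (x - l) / 2.
Proof.
intros Hx Hm Hmx Hl.
assert (Ex : exp x = 5 / 3) by (rewrite Hx; apply exp_ln; lra).
assert (Ex' : exp (- x) = 3 / 5) by (rewrite exp_Ropp, Ex; field).
assert (X0 : 0 < x) by (rewrite Hx; apply ln_53_pos).
(* With [(1 + m) * x <= 4 / 3] this gives [m * x <= 1], so on the interval [exp] stays above
   exp(-1), hence above 1/3. *)
assert (X1 : 1 / 3 <= x).
{ assert (T := exp_ineq1_le (- x)). rewrite Ex' in T. lra. }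
assert (W : forall t, - (m * x) <= t <= x -> 0 <= 1 - (exp t + 5 / 9 * exp (- t)) / 2).
{ intros t Ht. assert (P := exp_pos t). rewrite exp_Ropp.
  assert (exp t <= 5 / 3) by (rewrite <- Ex; apply exp_monotone; lra).
  assert (1 / 3 <= exp t).
  { apply Rle_trans with (exp (- (1))). rewrite exp_Ropp. replace (1 / 3) with (/ 3) by field. apply Rinv_le_contravar. apply exp_pos. apply exp_le_3. apply exp_monotone. nra. }
  replace (1 - (exp t + 5 / 9 * / exp t) / 2) with ((3 * exp t - 1) * (5 - 3 * exp t) / (18 * exp t)) by (field; lra).
  apply Rdiv_le_0_compat. apply Rmult_le_pos; lra. lra. }
set (dg := fun t => (2 * t + (m - 1) * x) / 2 - (exp t - 5 / 9 * exp (- t)) / 2).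
assert (Dg : forall t, - (m * x) <= t <= x -> dg t <= 0).
{ intros t Ht. apply Rle_trans with (dg x).
  - apply (derive_ge0_le dg (fun t => 1 - (exp t + 5 / 9 * exp (- t)) / 2)). lra.
    intros; unfold dg; auto_derive; auto; field. intros; apply W; lra.
  - unfold dg. rewrite Ex, Ex'. lra. }
pose proof (derive_ge0_le (fun t => - (1 - (t + m * x) * (x - t) / 2 - (exp t + 5 / 9 * exp (- t)) / 2)) (fun t => - dg t) l x ltac:(lra)) as D.
cbv beta in D. rewrite Ex, Ex' in D.
assert (D' : - (1 - (l + m * x) * (x - l) / 2 - (exp l + 5 / 9 * exp (- l)) / 2) <= - (1 - (x + m * x) * (x - x) / 2 - (5 / 3 + 5 / 9 * (3 / 5)) / 2)).
{ apply D. intros; unfold dg; auto_derive; auto; field. intros t Ht. generalize (Dg t ltac:(lra)). lra. }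
lra.
Qed.

(** For V = l + i y the claim is exp(2 l) - 2 exp(l) cos y + 1 < 4/9, that is (exp l + 5/9 exp(-l))
    / 2 < cos y. Here cos y >= 1 - y^2 / 2, and y^2 is bounded through the disk with diameter from
    [- (m * x)] to [x], so [exp_disc_aux] concludes. *)
Lemma region_b V s beta : 0 <= s < 1 -> bound_b <= beta ->
  0 <= (beta * Re V - prim_RL (- s)) * (prim_RL s - beta * Re V) - (beta * Im V) * (beta * Im V) ->
  Cmod (Cexp V - 1) < 2 / 3.
Proof.
rewrite bound_b_prim. destruct prim_RL_compare as [[E0 E1] E2]. assert (E3 := prim_RL_ratio). intros Hs Hb H.
assert (X0 := ln_53_pos). set (x := ln (5 / 3)) in *. set (m := - prim_RL (-1) / prim_RL 1).
assert (Hm : 0 <= m) by (apply Rdiv_le_0_compat; lra).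
assert (Em : prim_RL 1 * m = - prim_RL (-1)) by (unfold m; field; lra).
assert (Hb0 : 0 < beta) by (eapply Rlt_le_trans; [|apply Hb]; now apply Rdiv_lt_0_compat).
assert (Hbx : prim_RL 1 <= beta * x) by (apply Rle_div_l; auto).
assert (Hmx : (1 + m) * x <= 4 / 3).
{ apply Rmult_le_reg_l with (prim_RL 1); auto. replace (prim_RL 1 * ((1 + m) * x)) with ((prim_RL 1 + prim_RL 1 * m) * x) by ring. rewrite Em. lra. }
apply (region_disc V s beta (m * x) x) in H; auto.
2:{ rewrite <- Em. replace (beta * (m * x)) with (beta * x * m) by ring. apply Rmult_le_compat_r; lra. }
assert (Hl : - (m * x) <= Re V <= x).
{ assert (0 <= m * x) by nra. destruct (disc_enlarge (m * x) x (m * x) x (Re V) (Im V)); lra. }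
pose proof (exp_disc_aux m x (Re V) eq_refl Hm Hmx Hl) as G. pose proof (cos_ge (Im V)) as K.
apply Cmod_lt_sq. lra.
set (l := Re V) in *. set (y := Im V) in *.
replace (Re (Cexp V - 1)) with (exp l * cos y - 1) by (unfold l, y, Cexp, Re, Im; simpl; ring).
replace (Im (Cexp V - 1)) with (exp l * sin y) by (unfold l, y, Cexp, Re, Im; simpl; ring).
assert (P := exp_pos l). assert (SC := sin2_cos2 y). unfold Rsqr in SC.
assert (Q : (exp l + 5 / 9 * exp (- l)) / 2 < cos y) by lra.
apply Rmult_lt_compat_l with (r := 2 * exp l) in Q; [|lra].
replace (2 * exp l * ((exp l + 5 / 9 * exp (- l)) / 2)) with (exp l * exp l + 5 / 9) in Q.
2:{ rewrite exp_Ropp. field. lra. }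
replace ((exp l * cos y - 1) * (exp l * cos y - 1) + exp l * sin y * (exp l * sin y)) with
  (exp l * exp l * (sin y * sin y + cos y * cos y) - 2 * exp l * cos y + 1) by ring.
rewrite SC. lra.
Qed.

(** * The nephroid domain *)

Lemma cube_diff_bound (x y : C) rho : Cmod x <= rho -> Cmod y <= rho ->
  Cmod ((x * x * x - y * y * y) / 3) <= rho * rho * Cmod (x - y).
Proof.
intros Hx Hy. assert (T3 : RtoC 3 <> 0) by (intros E; apply RtoC_inj in E; lra).
replace ((x * x * x - y * y * y) / 3)%C with ((x * x + x * y + y * y) / 3 * (x - y))%C by (field; auto).
rewrite Cmod_mult. apply Rmult_le_compat_r. apply Cmod_ge_0.
rewrite Cmod_div, Cmod_R, Rabs_pos_eq by (auto; lra). apply div_le. lra.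
eapply Rle_trans. apply Cmod_triangle. eapply Rle_trans. apply Rplus_le_compat_r, Cmod_triangle. rewrite !Cmod_mult.
assert (X := Cmod_ge_0 x). assert (Y := Cmod_ge_0 y).
assert (Cmod x * Cmod x <= rho * rho) by (apply Rmult_le_compat; auto).
assert (Cmod x * Cmod y <= rho * rho) by (apply Rmult_le_compat; auto).
assert (Cmod y * Cmod y <= rho * rho) by (apply Rmult_le_compat; auto). lra.
Qed.

(* Fixed point of the contraction [w |-> u + w^3 / 3] of a disk of radius [rho < 1]. *)
Lemma nephroid_preimage (u : C) : Cmod u < 2 / 3 -> exists w : C, Cmod w < 1 /\ (w - w * w * w / 3 = u)%C.
Proof.
intros Hu.
assert (T3 : RtoC 3 <> 0) by (intros E; apply RtoC_inj in E; lra).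
(* The function rho - rho^3 / 3 has the value 2/3 and slope 0 at 1, so moving to [1 - d / 2] loses
   only the second order in [d], less than the available [d]. *)
assert (Hrho : exists rho, 0 < rho < 1 /\ Cmod u + rho * rho * rho / 3 <= rho).
{ set (d := 2 / 3 - Cmod u). assert (0 < d <= 2 / 3) by (unfold d; generalize (Cmod_ge_0 u); lra).
  exists (1 - d / 2). split. lra. replace (Cmod u) with (2 / 3 - d) by (unfold d; ring).
  assert (0 <= d * d * d) by (apply Rmult_le_pos; nra). assert (d * d <= d) by nra. lra. }
destruct Hrho as [rho [Hr HR]].
set (T := fun w : C => (u + w * w * w / 3)%C).
set (x := fun n => Nat.iter n T (RtoC 0)).
assert (Bx : forall n, Cmod (x n) <= rho).
{ induction n. change (x 0%nat) with (RtoC 0). rewrite Cmod_0; lra. change (x (S n)) with (T (x n)). unfold T.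
  eapply Rle_trans. apply Cmod_triangle. rewrite Cmod_div, !Cmod_mult, Cmod_R, Rabs_pos_eq by (auto; lra).
  eapply Rle_trans. 2: apply HR. apply Rplus_le_compat_l, Rmult_le_compat_r. lra.
  pose proof (Cmod_ge_0 (x n)). assert (Cmod (x n) * Cmod (x n) <= rho * rho) by (apply Rmult_le_compat; auto).
  apply Rmult_le_compat; auto. apply Rmult_le_pos; auto. }
assert (CT : forall n k, Cmod (x (n + k)%nat - x n) <= (rho * rho) ^ n).
{ induction n; intros k.
  - simpl. change (x 0%nat) with (RtoC 0). replace (x k - 0)%C with (x k) by ring. specialize (Bx k); lra.
  - change (x (S n + k)%nat) with (T (x (n + k)%nat)). change (x (S n)) with (T (x n)). unfold T.
    replace (u + x (n + k)%nat * x (n + k)%nat * x (n + k)%nat / 3 - (u + x n * x n * x n / 3))%C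
      with ((x (n + k)%nat * x (n + k)%nat * x (n + k)%nat - x n * x n * x n) / 3)%C by (field; auto).
    eapply Rle_trans. apply (cube_diff_bound _ _ rho); auto. simpl. apply Rmult_le_compat_l. nra. apply IHn. }
destruct (proj1 (filterlim_locally_cauchy (U := C_R_CompleteNormedModule) (F := eventually) x)) as [w Hw].
{ intros eps. destruct (pow_lt_1_zero (rho * rho) ltac:(rewrite Rabs_pos_eq; nra) (eps / 2) ltac:(generalize (cond_pos eps); lra)) as [N HN].
  specialize (HN N (le_n _)). rewrite Rabs_pos_eq in HN by (apply pow_le; nra).
  exists (fun n => (N <= n)%nat). split. now exists N.
  intros n m Hn Hm. apply C_NormedModule_mixin_compat1.
  change (Cmod (x m - x n) < eps).
  replace (x m - x n)%C with ((x m - x N) + - (x n - x N))%C by ring.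
  eapply Rle_lt_trans. apply Cmod_triangle. rewrite Cmod_opp.
  replace m with (N + (m - N))%nat by (now rewrite Nat.add_comm, Nat.sub_add).
  replace n with (N + (n - N))%nat by (now rewrite Nat.add_comm, Nat.sub_add).
  generalize (CT N (m - N)%nat) (CT N (n - N)%nat). lra. }
exists w.
assert (Ew : w = T w).
{ apply (filterlim_locally_unique (V := C_R_NormedModule) (F := eventually) (fun n => x (S n))).
  - apply (filterlim_comp _ _ _ S x eventually eventually). apply eventually_subseq. intros; apply Nat.lt_succ_diag_r. exact Hw.
  - apply (filterlim_comp _ _ _ x T eventually (locally w)). exact Hw.
    apply (continuous_Cplus (U := C_UniformSpace) (fun _ => u) (fun w => w * w * w / 3)%C). apply continuous_const.
    unfold Cdiv. apply continuous_Cmult; [|apply continuous_const].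
    apply continuous_Cmult; [apply continuous_Cmult|]; apply continuous_id. }
split.
- apply Rle_lt_trans with rho; [|lra].
  apply (filterlim_le (F := eventually) (fun n => Cmod (x n)) (fun _ => rho) (Finite (Cmod w)) (Finite rho)).
  + now exists 0%nat.
  + apply (filterlim_comp _ _ _ x Cmod eventually (locally w)). exact Hw. apply (continuous_Cmod (fun y : C => y) w). apply continuous_id.
  + apply filterlim_const.
- rewrite Ew at 1. unfold T. ring.
Qed.

Lemma analytic_phi_Ne : analytic phi_Ne.
Proof.
intros z _. eexists. unfold phi_Ne. apply Cd_minus. apply Cd_plus. apply Cd_const. apply Cd_id.
unfold Cdiv. apply Cd_mult. apply Cd_mult. apply Cd_mult; apply Cd_id. apply Cd_id. apply Cd_const.
Qed.

(** The preimages are chosen point by point. Their dependence on [z] is analytic because the divided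
    difference of w - w^3 / 3 is bounded away from 0 on the unit disk when one argument is fixed, so
    the slope of [W] is the slope of [p] divided by it. *)
Lemma subordinate_Ne p : analytic p -> p 0 = 1 -> (forall z, in_disk z -> Cmod (p z - 1) < 2 / 3) ->
  subordinate p phi_Ne.
Proof.
intros Ap P0 HP. split; [|split]; auto using analytic_phi_Ne.
assert (T3 : RtoC 3 <> 0) by (intros E; apply RtoC_inj in E; lra).
set (W := fun z => match excluded_middle_informative (in_disk z) with
  | left H => proj1_sig (constructive_indefinite_description _ (nephroid_preimage (p z - 1) (HP z H)))
  | right _ => RtoC 0 end).
assert (HW : forall z, in_disk z -> Cmod (W z) < 1 /\ (W z - W z * W z * W z / 3 = p z - 1)%C).
{ intros z Hz. unfold W. destruct (excluded_middle_informative (in_disk z)) as [H|]; [|easy].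
  exact (proj2_sig (constructive_indefinite_description _ (nephroid_preimage (p z - 1) (HP z H)))). }
(* The divided difference of w - w^3 / 3 at [W y] and [W z]. *)
set (D := fun z y => (1 - (W y * W y + W y * W z + W z * W z) / 3)%C).
assert (HD : forall z y, in_disk z -> in_disk y -> ((W y - W z) * D z y = p y - p z)%C).
{ intros z y Hz Hy. destruct (HW z Hz) as [_ E1]. destruct (HW y Hy) as [_ E2].
  replace (p y - p z)%C with ((p y - 1) - (p z - 1))%C by ring. rewrite <- E1, <- E2. unfold D. field; auto. }
assert (HB : forall z y, in_disk z -> in_disk y -> 1 - (1 + 2 * Cmod (W z)) / 3 <= Cmod (D z y)).
{ intros z y Hz Hy. destruct (HW z Hz) as [B1 _]. destruct (HW y Hy) as [B2 _]. unfold D.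
  set (q := ((W y * W y + W y * W z + W z * W z) / 3)%C).
  assert (Cmod q <= (1 + 2 * Cmod (W z)) / 3).
  { unfold q. rewrite Cmod_div, Cmod_R, Rabs_pos_eq by (auto; lra). apply Rmult_le_compat_r. lra.
    eapply Rle_trans. apply Cmod_triangle. eapply Rle_trans. apply Rplus_le_compat_r, Cmod_triangle. rewrite !Cmod_mult.
    pose proof (Cmod_ge_0 (W z)) as Z0. pose proof (Cmod_ge_0 (W y)) as Y0.
    assert (Cmod (W y) * Cmod (W y) <= 1 * 1) by (apply Rmult_le_compat; lra).
    assert (Cmod (W y) * Cmod (W z) <= 1 * Cmod (W z)) by (apply Rmult_le_compat; lra).
    assert (Cmod (W z) * Cmod (W z) <= 1 * Cmod (W z)) by (apply Rmult_le_compat; lra). lra. }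
  generalize (Cmod_triangle (1 - q) q). replace (1 - q + q)%C with (RtoC 1) by ring. rewrite Cmod_1. lra. }
assert (HN : forall z y, in_disk z -> in_disk y -> D z y <> 0).
{ intros z y Hz Hy E. pose proof (HB z y Hz Hy) as B. rewrite E, Cmod_0 in B. destruct (HW z Hz). lra. }
assert (CW : forall z, in_disk z -> continuous W z).
{ intros z Hz. apply continuous_C_iff. intros eps Heps.
  destruct (HW z Hz) as [B1 _]. set (m := 1 - (1 + 2 * Cmod (W z)) / 3). assert (Hm : 0 < m) by (unfold m; lra).
  pose proof (analytic_continuous p z Ap Hz) as Cp. rewrite continuous_C_iff in Cp.
  generalize (filter_and _ _ (Cp (eps * m) (Rmult_lt_0_compat _ _ Heps Hm)) (open_ball_locally 1 z Hz)).
  apply filter_imp. intros y [Hy Dy]. rewrite <- (HD z y Hz Dy), Cmod_mult in Hy.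
  pose proof (HB z y Hz Dy) as B. fold m in B. pose proof (Cmod_ge_0 (W y - W z)).
  apply Rmult_lt_reg_r with m; auto. eapply Rle_lt_trans. 2: apply Hy. apply Rmult_le_compat_l; auto. }
exists W. split; [|split; [|split]].
- intros z Hz. destruct (Ap z Hz) as [l Hl]. destruct (Cd_carath _ _ _ Hl) as [q [Cq [_ Eq]]].
  eexists. apply (carath_Cd W (fun y => q y / D z y)%C).
  + apply continuous_Cmult; auto. apply continuous_Cinv. apply HN; auto.
    apply continuous_Cminus. apply continuous_const. apply continuous_Cmult. 2: apply continuous_const.
    apply continuous_Cplus; [apply continuous_Cplus|]; apply continuous_Cmult; auto; apply continuous_const.
  + generalize (open_ball_locally 1 z Hz). apply filter_imp. intros y Hy.
    pose proof (HN z y Hz Hy). match goal with |- @eq _ ?a ?b => change (@eq C a b) end.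
    transitivity ((W y - W z) * D z y / D z y)%C. field; auto. rewrite (HD z y Hz Hy), Eq. field; auto.
- destruct (HW 0 in_disk_0) as [B1 E]. rewrite P0 in E. set (x := W 0) in *.
  (* The other roots of x - x^3 / 3 satisfy x^2 = 3 and lie outside the unit disk, so the chosen
     preimage of 0 is 0. *)
  assert (X : (x * (1 - x * x / 3) = 0)%C) by (transitivity (x - x * x * x / 3)%C; [field; auto|rewrite E; ring]).
  destruct (Ceq_dec x 0) as [|Hx]; auto. exfalso.
  assert (Y : (1 - x * x / 3 <> 0)%C).
  { intros Y. assert (Y2 : (x * x = 3)%C). { replace (x * x)%C with (3 * (1 - (1 - x * x / 3)))%C by (field; auto). rewrite Y. ring. }
    assert (Y3 : Cmod x * Cmod x = 3) by (rewrite <- Cmod_mult, Y2, Cmod_R; apply Rabs_pos_eq; lra). generalize (Cmod_ge_0 x). nra. }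
  apply (Cmult_neq_0 _ _ Hx Y X).
- intros z Hz. apply HW; auto.
- intros z Hz. destruct (HW z Hz) as [_ E]. unfold phi_Ne. replace (p z) with (1 + (p z - 1))%C by ring. rewrite <- E. ring.
Qed.

(** * Continuation along rays *)

Section ClassA.
Variable f : C -> C.
Hypothesis Hf : class_A f.

Lemma class_A_divz z : (f z = z * divz f z)%C.
Proof. apply divz_spec. apply Hf. Qed.

Lemma class_A_divz_0 : divz f 0 = 1.
Proof. unfold divz. destruct (Ceq_dec 0 0); [apply Hf|easy]. Qed.

Lemma regular_point_iff z : regular_point f z <-> divz f z <> 0 /\ C_derive f z <> 0.
Proof.
unfold regular_point. split; intros [H1 H2]; split; auto.
- destruct (Ceq_dec z 0) as [->|Hz]. rewrite class_A_divz_0. intros E. apply RtoC_inj in E. lra.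
  intros E. apply (H1 Hz). rewrite class_A_divz, E. ring.
- intros Hz. rewrite class_A_divz. now apply Cmult_neq_0.
Qed.

(** In this form 0 is no longer exceptional: both numerator and denominator are analytic on the
    whole disk. *)
Lemma log_quot_divz z : divz f z <> 0 -> log_quot f z = (C_derive f z / divz f z)%C.
Proof.
intros H. unfold log_quot. destruct (Ceq_dec z 0) as [->|Hz].
- rewrite class_A_divz_0. destruct Hf as [_ [_ ->]]. field.
- rewrite class_A_divz. field. auto.
Qed.

Lemma class_A_analytic : analytic f. Proof. apply Hf. Qed.

Lemma continuous_divz z : in_disk z -> continuous (divz f) z.
Proof. intros Hz. apply analytic_continuous; auto. apply analytic_divz, Hf. Qed.

Lemma ex_Cd_log_quot z : in_disk z -> divz f z <> 0 -> exists l, Cd (log_quot f) z l.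
Proof.
intros Hz H. destruct (analytic_C_derive f class_A_analytic z Hz) as [l Hl]. destruct (analytic_divz f class_A_analytic z Hz) as [m Hm].
eexists. apply (Cd_ext_loc (fun y => C_derive f y / divz f y)%C). 2: apply Cd_div; eauto.
generalize (continuous_nonzero _ z (continuous_divz z Hz) H). apply filter_imp. intros y Hy. symmetry. now apply log_quot_divz.
Qed.

(** Logarithmic differentiation of p = z f' / f gives z p' / p = 1 - p + z f'' / f', which is
    [calG f]. This equation turns the three conditions into differential equations for p alone. *)
Lemma calG_log_quot z l : in_disk z -> regular_point f z -> Cd (log_quot f) z l ->
  (z * l = calG f z * log_quot f z)%C.
Proof.
intros Hz HR Hl. pose proof HR as [HR1 HR2]. apply regular_point_iff in HR. destruct HR as [HR _].
destruct (Ceq_dec z 0) as [->|Hz0].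
- unfold calG. rewrite log_quot_divz by auto. rewrite class_A_divz_0. destruct Hf as [_ [_ ->]]. field.
- specialize (HR1 Hz0). pose proof (Cd_C_derive f z class_A_analytic Hz) as D1.
  pose proof (Cd_C_derive (C_derive f) z (analytic_C_derive f class_A_analytic) Hz) as D2.
  assert (D : Cd (log_quot f) z (((1 * C_derive f z + z * C_derive (C_derive f) z) * f z - (z * C_derive f z) * C_derive f z) / (f z * f z))%C).
  { apply (Cd_ext_loc (fun y => (y * C_derive f y) / f y)%C).
    - generalize (locally_neq z 0 Hz0). apply filter_imp. intros y Hy. unfold log_quot. now destruct (Ceq_dec y 0).
    - apply (Cd_div (fun y => y * C_derive f y)%C f); auto. apply (Cd_mult (fun y => y) (C_derive f)); auto. apply Cd_id. }
  rewrite <- (C_derive_unique _ _ _ Hl), (C_derive_unique _ _ _ D).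
  unfold calG, log_quot. destruct (Ceq_dec z 0); [easy|]. field. split; auto.
Qed.

End ClassA.

Lemma eq_at_left_end (g1 g2 : R -> C) a b : a < b -> continuous g1 b -> continuous g2 b ->
  (forall t, a <= t < b -> g1 t = g2 t) -> g1 b = g2 b.
Proof.
intros Hab C1 C2 H. destruct (Ceq_dec (g1 b - g2 b) 0) as [E|E].
{ replace (g1 b) with (g1 b - g2 b + g2 b)%C by ring. rewrite E. ring. }
exfalso. destruct (continuous_nonzero (fun t => g1 t - g2 t)%C b (continuous_Cminus _ _ _ C1 C2) E) as [d Hd].
assert (Pd := cond_pos d).
set (t := Rmax a (b - d / 2)). assert (a <= t) by apply Rmax_l. assert (b - d / 2 <= t) by apply Rmax_r.
assert (t < b) by (apply Rmax_lub_lt; lra).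
apply (Hd t). change (Rabs (t - b) < d). rewrite Rabs_left; lra. rewrite H by lra. cring.
Qed.

(** The conclusion is half the derivative of |g|^2 along a path with velocity [d]; [continuation]
    takes [q] to be z f' / f. *)
Lemma inner_pos (c : R) (g d q : C) : 0 < c -> (RtoC c * d = q * g)%C -> 0 < Re q -> g <> 0 ->
  0 < Re g * Re d + Im g * Im d.
Proof.
intros Hc E Hq Hg. pose proof (Cnorm2_gt_0 g Hg) as N.
destruct g as [a b], d as [x y], q as [u v]. unfold Re, Im in *. simpl in *.
injection E as E1 E2.
apply Rmult_lt_reg_l with c; auto. rewrite Rmult_0_r.
replace (c * (a * x + b * y)) with (a * (c * x - 0 * y) + b * (c * y + 0 * x)) by ring. rewrite E1, E2.
replace (a * (u * a - v * b) + b * (u * b + v * a)) with (u * (a * (a * 1) + b * (b * 1))) by ring. now apply Rmult_lt_0_compat.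
Qed.

Lemma segm_0 z t : segm 0 z t = (RtoC t * z)%C.
Proof. unfold segm. ring. Qed.

(* Along a ray, as long as [log_quot f] has positive real part, [|f|] increases; hence the first
   singular point of [log_quot f] is not a zero of [f], and it is not a zero of [f'] by continuity. *)
Lemma continuation (f ps : C -> C) : class_A f ->
  (forall z, in_disk z -> 0 < Re (ps z)) -> (forall z, in_disk z -> continuous ps z) ->
  (forall z, in_disk z -> (forall t, 0 <= t <= 1 -> regular_point f (segm 0 z t)) -> log_quot f z = ps z) ->
  forall z, in_disk z -> regular_point f z /\ log_quot f z = ps z.
Proof.
intros Hf HRe Hps HE z Hz.
assert (Dt : forall t, 0 <= t <= 1 -> in_disk (segm 0 z t)) by (intros; apply in_disk_segm; auto; apply in_disk_0).
assert (R0 : regular_point f 0).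
{ apply regular_point_iff; auto. rewrite class_A_divz_0 by auto. destruct Hf as [_ [_ ->]]. split; intros E; apply RtoC_inj in E; lra. }
assert (S0 : segm 0 z 0 = 0) by (rewrite segm_0; ring).
(* The supremum [T] of this set is shown to be regular itself and then, regularity being an open
   condition, to equal 1. *)
set (S := fun T => 0 <= T <= 1 /\ forall t, 0 <= t <= T -> regular_point f (segm 0 z t)).
assert (ES : forall T, S T -> log_quot f (segm 0 z T) = ps (segm 0 z T)).
{ intros T [HT1 HT]. apply HE. apply Dt; lra. intros t Ht.
  replace (segm 0 (segm 0 z T) t) with (segm 0 z (t * T)). apply HT; nra. rewrite !segm_0, RtoC_mult. ring. }
assert (S00 : S 0). { split. lra. intros t Ht. replace t with 0 by lra. now rewrite S0. }
destruct (completeness S) as [T [UB LUB]].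
{ exists 1. intros x [Hx _]. lra. } { now exists 0. }
assert (HT0 : 0 <= T) by (apply UB; auto). assert (HT1 : T <= 1) by (apply LUB; intros x [Hx _]; lra).
assert (Below : forall t, 0 <= t < T -> S t).
{ intros t Ht. apply NNPP. intros N. assert (T <= t); [|lra]. apply LUB. intros x [Hx1 Hx2].
  apply Rnot_lt_le. intros Hlt. apply N. split. lra. intros s Hs. apply Hx2. lra. }
assert (RT : regular_point f (segm 0 z T)).
{ destruct HT0 as [HT0| <-]. 2: now rewrite S0.
  destruct (Ceq_dec z 0) as [->|Hz0]. { replace (segm 0 0 T) with (RtoC 0) by (rewrite segm_0; ring). auto. }
  assert (NZ : forall t, 0 < t -> (segm 0 z t <> 0)%C).
  { intros t Ht. rewrite segm_0. apply Cmult_neq_0; auto. intros E. apply RtoC_inj in E. lra. }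
  assert (DT : in_disk (segm 0 z T)) by (apply Dt; lra).
  assert (fT : f (segm 0 z T) <> 0).
  { set (g := fun t => f (segm 0 z t)). set (dg := fun t => (C_derive f (segm 0 z t) * (z - 0))%C).
    assert (Dg : forall t, 0 <= t <= T -> Rd g t (dg t)).
    { intros t Ht. apply (Rd_comp f (segm 0 z)). apply Rd_segm. apply Cd_C_derive. apply Hf. apply Dt. lra. }
    destruct (MVT_cor2 (fun t => Re (g t) * Re (g t) + Im (g t) * Im (g t)) (fun t => 2 * (Re (g t) * Re (dg t) + Im (g t) * Im (dg t))) (T / 2) T) as [c [E Hc]].
    - lra.
    - intros t Ht. apply is_derive_Reals.
      replace (2 * (Re (g t) * Re (dg t) + Im (g t) * Im (dg t))) with
       (plus (plus (mult (Re (dg t)) (Re (g t))) (mult (Re (g t)) (Re (dg t)))) (plus (mult (Im (dg t)) (Im (g t))) (mult (Im (g t)) (Im (dg t)))))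
       by (unfold plus, mult; simpl; unfold mult; simpl; ring).
      apply (is_derive_plus (V := R_NormedModule)).
      + apply (is_derive_mult (K := R_AbsRing) (fun t => Re (g t)) (fun t => Re (g t))). apply Rd_Re, Dg; lra. apply Rd_Re, Dg; lra. exact Rmult_comm.
      + apply (is_derive_mult (K := R_AbsRing) (fun t => Im (g t)) (fun t => Im (g t))). apply Rd_Im, Dg; lra. apply Rd_Im, Dg; lra. exact Rmult_comm.
    - assert (Sc : S c) by (apply Below; lra). pose proof (ES c Sc) as Ec. destruct Sc as [_ Rc]. specialize (Rc c ltac:(lra)).
      assert (fc : f (segm 0 z c) <> 0) by (apply Rc, NZ; lra).
      assert (f2 : f (segm 0 z (T / 2)) <> 0). { destruct (Below (T / 2)) as [_ R2]. lra. apply (R2 (T / 2)). lra. apply NZ; lra. }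
      assert (Pc := HRe _ (Dt c ltac:(lra))). rewrite <- Ec in Pc.
      unfold log_quot in Pc. destruct (Ceq_dec (segm 0 z c) 0) as [E0|_]; [now apply (NZ c ltac:(lra)) in E0|].
      assert (Q : (RtoC c * dg c = (segm 0 z c * C_derive f (segm 0 z c) / f (segm 0 z c)) * g c)%C).
      { unfold dg, g. rewrite segm_0. rewrite segm_0 in fc. field. auto. }
      set (q := (segm 0 z c * C_derive f (segm 0 z c) / f (segm 0 z c))%C) in *.
      pose proof (inner_pos c (g c) (dg c) q ltac:(lra) Q Pc fc) as Pos.
      assert (Pos2 : 0 < Re (g (T / 2)) * Re (g (T / 2)) + Im (g (T / 2)) * Im (g (T / 2))).
      { generalize (Cnorm2_gt_0 _ f2). unfold g. simpl. lra. }
      intros ET. change (g T = 0) in ET. rewrite ET in E. change (Re 0) with 0 in E. change (Im 0) with 0 in E.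
      nra. }
  assert (dT : divz f (segm 0 z T) <> 0).
  { intros E. apply fT. rewrite (class_A_divz f Hf), E. ring. }
  destruct (ex_Cd_log_quot f Hf _ DT dT) as [l Hl].
  assert (EqT : log_quot f (segm 0 z T) = ps (segm 0 z T)).
  { apply (eq_at_left_end (fun t => log_quot f (segm 0 z t)) (fun t => ps (segm 0 z t)) 0 T HT0).
    - apply (continuous_comp (segm 0 z) (log_quot f)). apply continuous_segm. exact (Cd_continuous _ _ _ Hl).
    - apply (continuous_comp (segm 0 z) ps). apply continuous_segm. auto.
    - intros t Ht. apply ES, Below. auto. }
  apply regular_point_iff; auto. split; auto. intros E.
  rewrite log_quot_divz in EqT by auto. rewrite E in EqT. assert (Pc := HRe _ DT). rewrite <- EqT in Pc.
  replace (0 / divz f (segm 0 z T))%C with (RtoC 0) in Pc by (field; auto). simpl in Pc. lra. }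
assert (ST : S T).
{ split. lra. intros t Ht. destruct (Req_dec t T) as [->|]; auto. destruct (Below t) as [_ Rt]. lra. apply Rt; lra. }
assert (T = 1).
{ apply NNPP. intros N. pose proof (proj1 (regular_point_iff f Hf _) RT) as [dT cT].
  assert (DT : in_disk (segm 0 z T)) by (apply Dt; lra).
  assert (L1 : locally T (fun t => divz f (segm 0 z t) <> 0)).
  { apply (continuous_nonzero (fun t => divz f (segm 0 z t))); auto. apply (continuous_comp (segm 0 z) (divz f)). apply continuous_segm. now apply continuous_divz. }
  assert (L2 : locally T (fun t => C_derive f (segm 0 z t) <> 0)).
  { apply (continuous_nonzero (fun t => C_derive f (segm 0 z t))); auto. apply (continuous_comp (segm 0 z) (C_derive f)). apply continuous_segm.
    apply analytic_continuous; auto. apply analytic_C_derive, Hf. }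
  destruct (filter_and _ _ L1 L2) as [d Hd]. assert (Pd := cond_pos d).
  set (T' := Rmin 1 (T + d / 2)). assert (T' <= 1) by apply Rmin_l. assert (T' <= T + d / 2) by apply Rmin_r.
  assert (T < T') by (apply Rmin_glb_lt; lra).
  assert (S T'); [|specialize (UB T' H2); lra].
  split. lra. intros t Ht. destruct (Rle_dec t T). apply ST; lra.
  apply regular_point_iff; auto. apply Hd. change (Rabs (t - T) < d). rewrite Rabs_pos_eq; lra. }
subst T. replace z with (segm 0 z 1) by (rewrite segm_0; ring). split; auto.
Qed.

(** * The three implications *)

Lemma segint_self K a : segint K a a = 0.
Proof.
unfold segint. transitivity (CInt (fun _ => RtoC 0) 0 1).
- apply CInt_ext. lra. intros. cring.
- rewrite CInt_const. ring.
Qed.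

Lemma analytic_minus f g : analytic f -> analytic g -> analytic (fun z => f z - g z)%C.
Proof. intros Hf Hg z Hz. destruct (Hf z Hz) as [l Hl]. destruct (Hg z Hz) as [m Hm]. eexists. apply Cd_minus; eauto. Qed.

Lemma radial_primitive (X : C -> C) (beta : R) : analytic X -> X 0 = 0 -> beta <> 0 ->
  exists L l : C -> C, L 0 = 0 /\ (forall z, in_disk z -> Cd L z (l z)) /\
    (forall z, in_disk z -> (RtoC beta * (z * l z) = X z)%C).
Proof.
intros AX X0 Hb. assert (Nb : RtoC beta <> 0) by (intros E; apply RtoC_inj in E; auto).
pose proof (analytic_divz X AX) as AD.
exists (fun z => / RtoC beta * segint (divz X) 0 z)%C, (fun z => / RtoC beta * divz X z)%C. split; [|split].
- rewrite segint_self. ring.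
- intros z Hz. eapply Cd_eq. apply Cd_mult. apply Cd_const.
  apply (primitive_at (divz X) 0 in_disk_0 (fun y H => analytic_continuous _ y AD H) (fun y H _ => AD y H) z Hz). cring.
- intros z Hz. rewrite (divz_spec X z X0). field. auto.
Qed.

(** Constancy is wanted along a single ray, because before [continuation] regularity is known
    nowhere else. *)
Lemma radial_const (Q dQ : C -> C) z :
  (forall t, 0 <= t <= 1 -> Cd Q (segm 0 z t) (dQ (segm 0 z t))) ->
  (forall t, 0 < t < 1 -> (segm 0 z t * dQ (segm 0 z t) = 0)%C) -> Q z = Q 0.
Proof.
intros HQ HZ.
assert (RD : forall t, 0 <= t <= 1 -> Rd (fun s => Q (segm 0 z s)) t (dQ (segm 0 z t) * (z - 0))%C).
{ intros t Ht. apply (Rd_comp Q (segm 0 z)). apply Rd_segm. auto. }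
pose proof (Rd_zero_const (fun s => Q (segm 0 z s)) 0 1 Rle_0_1 (fun t Ht => Rd_continuous _ _ _ (RD t Ht))) as E.
cbv beta in E. replace (segm 0 z 1) with z in E by (rewrite segm_0; ring). replace (segm 0 z 0) with (RtoC 0) in E by (rewrite segm_0; ring).
apply E. intros t Ht. eapply Rd_eq. apply RD; lra.
assert (Nt : RtoC t <> 0) by (intros X; apply RtoC_inj in X; lra). specialize (HZ t Ht).
match goal with |- @eq _ ?a ?b => change (@eq C a b) end.
replace (dQ (segm 0 z t) * (z - 0))%C with (/ RtoC t * (segm 0 z t * dQ (segm 0 z t)))%C.
rewrite HZ. ring. rewrite segm_0. field. auto.
Qed.

Lemma Re_pos_of_near_1 z : Cmod (z - 1) < 2 / 3 -> 0 < Re z.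
Proof.
intros H. pose proof (re_le_Cmod (z - 1)) as R. replace (Re (z - 1)) with (Re z - 1) in R by (unfold Re; simpl; ring).
apply Rabs_le_between in R. lra.
Qed.

(** The differential equation identifies [log_quot f] with [ps] only at the ends of regular rays;
    the bound on [ps] gives the positive real part with which [continuation] makes every ray
    regular. *)
Lemma S_Ne_of_solution (f ps : C -> C) : class_A f ->
  (forall z, in_disk z -> Cmod (ps z - 1) < 2 / 3) -> (forall z, in_disk z -> continuous ps z) ->
  (forall z, in_disk z -> (forall t, 0 <= t <= 1 -> regular_point f (segm 0 z t)) -> log_quot f z = ps z) ->
  S_Ne f.
Proof.
intros Hf Hps Cps HE.
pose proof (continuation f ps Hf (fun z Hz => Re_pos_of_near_1 _ (Hps z Hz)) Cps HE) as H.
split; auto. apply subordinate_Ne.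
- intros z Hz. destruct (H z Hz) as [R _]. apply ex_Cd_log_quot; auto. apply (proj1 (regular_point_iff f Hf z) R).
- unfold log_quot. destruct (Ceq_dec 0 0); easy.
- intros z Hz. destruct (H z Hz) as [_ ->]. auto.
Qed.

Lemma log_quot_neq_0 f z : class_A f -> regular_point f z -> log_quot f z <> 0.
Proof.
intros Hf HR. apply regular_point_iff in HR; auto. destruct HR as [H1 H2].
rewrite log_quot_divz by auto. intros E. apply H2.
replace (C_derive f z) with (C_derive f z / divz f z * divz f z)%C by (field; auto). rewrite E. ring.
Qed.

Section Solution.
Variables (f : C -> C) (beta : R) (F : C -> C).
Hypothesis Hf : class_A f.
Hypothesis Hbeta : 0 < beta.
Hypothesis HF : subordinate F phi_RL.

Lemma solution_exists : exists L l : C -> C, L 0 = 0 /\ (forall z, in_disk z -> Cd L z (l z)) /\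
  (forall z, in_disk z -> (RtoC beta * (z * l z) = F z - 1)%C) /\
  (forall z, in_disk z ->
    0 <= (beta * Re (L z) - prim_RL (- Cmod z)) * (prim_RL (Cmod z) - beta * Re (L z)) - (beta * Im (L z)) * (beta * Im (L z))).
Proof.
destruct HF as (AF & _ & w & Aw & w0 & w1 & Fw).
assert (F0 : (F 0 - 1 = 0)%C). { rewrite Fw, w0, phi_RL_0 by apply in_disk_0. ring. }
destruct (radial_primitive (fun z => F z - 1)%C beta) as (L & l & L0 & HL & Hl); auto.
{ apply analytic_minus; auto. apply analytic_const. } { lra. }
exists L, l. split; [|split; [|split]]; auto.
apply (growth_disc L l F w beta); auto. now apply schwarz.
Qed.

Lemma log_quot_ode z : in_disk z -> (forall t, 0 <= t <= 1 -> regular_point f (segm 0 z t)) ->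
  forall t, 0 <= t <= 1 -> let y := segm 0 z t in
    in_disk y /\ regular_point f y /\ log_quot f y <> 0 /\ Cd (log_quot f) y (C_derive (log_quot f) y) /\
    (y * C_derive (log_quot f) y = calG f y * log_quot f y)%C.
Proof.
intros Hz HR t Ht y. assert (Dy : in_disk y) by (apply in_disk_segm; auto; apply in_disk_0).
specialize (HR t Ht). destruct (ex_Cd_log_quot f Hf y Dy (proj1 (proj1 (regular_point_iff f Hf y) HR))) as [l Hl].
rewrite (C_derive_unique _ _ _ Hl). split; [|split; [|split; [|split]]]; auto. now apply log_quot_neq_0. now apply calG_log_quot.
Qed.

End Solution.

Lemma log_quot_0 f : log_quot f 0 = 1.
Proof. unfold log_quot. destruct (Ceq_dec 0 0); easy. Qed.

Lemma RtoC_cancel (b : R) (x y : C) : b <> 0 -> (RtoC b * x = RtoC b * y)%C -> x = y.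
Proof.
intros Hb E. assert (Nb : RtoC b <> 0) by (intros X; apply RtoC_inj in X; auto).
replace x with (/ RtoC b * (RtoC b * x))%C by (field; auto). rewrite E. field; auto.
Qed.

Lemma valid_a (f : C -> C) (beta : R) : class_A f -> bound_a <= beta -> cond_a beta f -> S_Ne f.
Proof.
intros Hf Hb [F [HFE HF]].
assert (Hbeta : 0 < beta). { eapply Rlt_le_trans. 2: apply Hb. rewrite bound_a_prim. destruct prim_RL_compare. lra. }
destruct (solution_exists beta F Hbeta HF) as (L & l & L0 & HL & Hl & HD).
apply (S_Ne_of_solution f (fun z => 1 + L z)%C Hf).
- intros z Hz. apply (region_a (L z) (Cmod z) beta); auto. split; [apply Cmod_ge_0|exact Hz].
- intros z Hz. apply continuous_Cplus. apply continuous_const. exact (Cd_continuous _ _ _ (HL z Hz)).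
- intros z Hz HR. pose proof (log_quot_ode f Hf z Hz HR) as O.
  assert (E : (log_quot f z - L z = log_quot f 0 - L 0)%C).
  { apply (radial_const (fun z => log_quot f z - L z)%C (fun y => C_derive (log_quot f) y - l y)%C).
    - intros t Ht. destruct (O t Ht) as (Dy & _ & _ & HP & _). apply Cd_minus; auto.
    - intros t Ht. destruct (O t ltac:(lra)) as (Dy & Ry & Py & HP & EP). set (y := segm 0 z t) in *.
      replace (y * (C_derive (log_quot f) y - l y))%C with (y * C_derive (log_quot f) y - y * l y)%C by ring.
      rewrite EP. replace (y * l y)%C with (calG f y * log_quot f y)%C. ring.
      apply (RtoC_cancel beta). lra. rewrite Hl by auto. rewrite HFE by auto. ring. }
  rewrite log_quot_0, L0 in E. replace (log_quot f z) with (log_quot f z - L z + L z)%C by ring. rewrite E. ring.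
Qed.

Lemma valid_b (f : C -> C) (beta : R) : class_A f -> bound_b <= beta -> cond_b beta f -> S_Ne f.
Proof.
intros Hf Hb [F [HFE HF]].
assert (Hbeta : 0 < beta). { eapply Rlt_le_trans. 2: apply Hb. rewrite bound_b_prim. destruct prim_RL_compare. apply Rdiv_lt_0_compat. lra. apply ln_53_pos. }
destruct (solution_exists beta F Hbeta HF) as (L & l & L0 & HL & Hl & HD).
apply (S_Ne_of_solution f (fun z => Cexp (L z)) Hf).
- intros z Hz. apply (region_b (L z) (Cmod z) beta); auto. split; [apply Cmod_ge_0|exact Hz].
- intros z Hz. exact (Cd_continuous _ _ _ (Cd_comp _ _ _ _ _ (HL z Hz) (Cd_Cexp (L z)))).
- intros z Hz HR. pose proof (log_quot_ode f Hf z Hz HR) as O.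
  (* Differentiating p exp(-L) avoids a branch of log p. *)
  assert (E : (log_quot f z * Cexp (- L z) = log_quot f 0 * Cexp (- L 0))%C).
  { apply (radial_const (fun z => log_quot f z * Cexp (- L z))%C
      (fun y => C_derive (log_quot f) y * Cexp (- L y) + log_quot f y * (Cexp (- L y) * - l y))%C).
    - intros t Ht. destruct (O t Ht) as (Dy & _ & _ & HP & _).
      apply (Cd_mult _ _ _ _ _ HP (Cd_comp Cexp (fun y => - L y)%C _ _ _ (Cd_opp _ _ _ (HL _ Dy)) (Cd_Cexp _))).
    - intros t Ht. destruct (O t ltac:(lra)) as (Dy & Ry & Py & HP & EP). set (y := segm 0 z t) in *.
      replace (y * (C_derive (log_quot f) y * Cexp (- L y) + log_quot f y * (Cexp (- L y) * - l y)))%C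
        with (Cexp (- L y) * (y * C_derive (log_quot f) y - log_quot f y * (y * l y)))%C by ring.
      rewrite EP. replace (y * l y)%C with (calG f y)%C. ring.
      apply (RtoC_cancel beta). lra. rewrite Hl by auto. rewrite HFE by auto. ring. }
  rewrite log_quot_0, L0 in E. replace (- 0)%C with (RtoC 0) in E by ring. rewrite Cexp_0 in E.
  replace (log_quot f z) with (log_quot f z * (Cexp (- L z) * Cexp (L z)))%C.
  + rewrite Cmult_assoc, E. ring.
  + rewrite <- Cexp_plus. replace (- L z + L z)%C with (RtoC 0) by ring. rewrite Cexp_0. ring.
Qed.

Lemma valid_c (f : C -> C) (beta : R) : class_A f -> bound_c <= beta -> cond_c beta f -> S_Ne f.
Proof.
intros Hf Hb [F [HFE HF]].
assert (Hbeta : 0 < beta). { eapply Rlt_le_trans. 2: apply Hb. rewrite bound_c_prim. destruct prim_RL_compare. lra. }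
destruct (solution_exists beta F Hbeta HF) as (L & l & L0 & HL & Hl & HD).
assert (Reg : forall z, in_disk z -> (1 - L z <> 0)%C /\ Cmod (/ (1 - L z) - 1) < 2 / 3).
{ intros z Hz. apply (region_c (L z) (Cmod z) beta); auto. split; [apply Cmod_ge_0|exact Hz]. }
apply (S_Ne_of_solution f (fun z => / (1 - L z))%C Hf).
- intros z Hz. now apply Reg.
- intros z Hz. apply continuous_Cinv. now apply Reg. apply continuous_Cminus. apply continuous_const. exact (Cd_continuous _ _ _ (HL z Hz)).
- intros z Hz HR. pose proof (log_quot_ode f Hf z Hz HR) as O.
  (* Condition (c) prescribes z p' / p^2, so it is 1 / p that is compared with [L]. *)
  assert (E : (/ log_quot f z + L z = / log_quot f 0 + L 0)%C).
  { apply (radial_const (fun z => / log_quot f z + L z)%C (fun y => - C_derive (log_quot f) y / (log_quot f y * log_quot f y) + l y)%C).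
    - intros t Ht. destruct (O t Ht) as (Dy & _ & Py & HP & _). apply Cd_plus; auto. now apply Cd_inv.
    - intros t Ht. destruct (O t ltac:(lra)) as (Dy & Ry & Py & HP & EP). set (y := segm 0 z t) in *.
      replace (y * (- C_derive (log_quot f) y / (log_quot f y * log_quot f y) + l y))%C
        with (- (y * C_derive (log_quot f) y) / (log_quot f y * log_quot f y) + y * l y)%C by (field; auto).
      rewrite EP. replace (y * l y)%C with (calG f y * / log_quot f y)%C. field; auto.
      apply (RtoC_cancel beta). lra. rewrite Hl by auto. rewrite HFE by auto. ring. }
  assert (Pz : log_quot f z <> 0). { destruct (O 1 ltac:(lra)) as (_ & _ & P1 & _). now replace (segm 0 z 1) with z in P1 by (rewrite segm_0; ring). }
  rewrite log_quot_0, L0 in E.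
  replace (1 - L z)%C with (/ log_quot f z)%C. field; auto.
  transitivity (/ log_quot f z + L z - L z)%C. ring. rewrite E. field.
Qed.

(** * Sharpness *)

(** For w = a + i b the imaginary part of 3 phi_Ne(w) is b (3 - 3 a^2 + b^2), whose second factor is
    positive on the disk. So real values come from real [w]. *)
Lemma phi_Ne_real w x : Cmod w < 1 -> phi_Ne w = RtoC x -> 1 / 3 < x < 5 / 3.
Proof.
intros Hw E. assert (T3 : RtoC 3 <> 0) by (intros X; apply RtoC_inj in X; lra).
assert (S := Cmod_sq w). assert (P := Cmod_ge_0 w).
assert (E3 : (3 * phi_Ne w = 3 + 3 * w - w * w * w)%C) by (unfold phi_Ne; field; auto).
rewrite E in E3. destruct w as [a b]. unfold Re, Im in S. simpl in S.
assert (N : a * a + b * b < 1) by nra.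
assert (Er := f_equal Re E3). assert (Ei := f_equal Im E3). unfold Re, Im in Er, Ei. simpl in Er, Ei.
assert (Eb : b * (3 - 3 * (a * a) + b * b) = 0) by lra.
apply Rmult_integral in Eb. destruct Eb as [-> |Eb]; [|nra].
assert (Ha : -1 < a < 1) by nra.
assert (X : 3 * x = 3 + 3 * a - a * a * a) by lra.
(* These products are 2 - 3 a + a^3 and 2 + 3 a - a^3, that is 5 - 3 x and 3 x - 1. *)
assert (0 < (1 - a) * (1 - a) * (a + 2)) by (apply Rmult_lt_0_compat; nra).
assert (0 < (1 + a) * (1 + a) * (2 - a)) by (apply Rmult_lt_0_compat; nra). lra.
Qed.

Lemma S_Ne_real f x y : S_Ne f -> in_disk (RtoC x) -> log_quot f (RtoC x) = RtoC y -> 1 / 3 < y < 5 / 3.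
Proof.
intros [_ (_ & _ & w & _ & _ & w1 & Hw)] Hx E. apply (phi_Ne_real (w (RtoC x))). auto. now rewrite <- Hw.
Qed.

(** Logarithmic integration: f = z exp(L) with z L' = ps - 1. *)
Lemma class_A_of_log_quot (ps : C -> C) : analytic ps -> ps 0 = 1 ->
  exists f, class_A f /\ forall z, in_disk z -> log_quot f z = ps z.
Proof.
intros Aps P0.
destruct (radial_primitive (fun z => ps z - 1)%C 1) as (L & l & L0 & HL & Hl).
{ apply analytic_minus; auto. apply analytic_const. } { rewrite P0. ring. } { lra. }
set (f := fun z => (z * Cexp (L z))%C).
assert (Df : forall z, in_disk z -> Cd f z (Cexp (L z) * ps z)%C).
{ intros z Hz. eapply Cd_eq. apply (Cd_mult (fun z => z) (fun z => Cexp (L z))). apply Cd_id. apply (Cd_comp Cexp L). apply HL, Hz. apply Cd_Cexp.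
  replace (ps z) with (1 + (ps z - 1))%C by ring. rewrite <- (Hl z Hz). cring. }
exists f. split; [split; [|split]|].
- intros z Hz. eexists. apply Df, Hz.
- unfold f. ring.
- rewrite (C_derive_unique _ _ _ (Df 0 in_disk_0)), L0, Cexp_0, P0. ring.
- intros z Hz. unfold log_quot. destruct (Ceq_dec z 0) as [->|Hz0]; auto.
  rewrite (C_derive_unique _ _ _ (Df z Hz)). unfold f. field. split; auto. apply Cexp_neq_0.
Qed.

Lemma subordinate_refl g : analytic g -> subordinate g g.
Proof.
intros Ag. split; [|split]; auto. exists (fun z => z). split; [|split; [|split]]; auto.
intros z _. eexists. apply Cd_id.
Qed.

Lemma calG_of_log_quot f ps z d : class_A f -> (forall z, in_disk z -> log_quot f z = ps z) ->
  in_disk z -> regular_point f z -> Cd ps z d -> (calG f z * ps z = z * d)%C /\ ps z <> 0.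
Proof.
intros Hf HP Hz HR Hd. rewrite <- HP by auto. split.
- symmetry. apply (calG_log_quot f Hf z d Hz HR). apply (Cd_ext_loc ps); auto.
  generalize (open_ball_locally 1 z Hz). apply filter_imp. intros y Hy. symmetry. now apply HP.
- now apply log_quot_neq_0.
Qed.

Lemma extremal_solution beta : 0 < beta -> exists L l : C -> C, L 0 = 0 /\ (forall z, in_disk z -> Cd L z (l z)) /\
  (forall z, in_disk z -> (RtoC beta * (z * l z) = phi_RL z - 1)%C) /\
  (forall z, in_disk z ->
    0 <= (beta * Re (L z) - prim_RL (- Cmod z)) * (prim_RL (Cmod z) - beta * Re (L z)) - (beta * Im (L z)) * (beta * Im (L z))) /\
  (forall x, -1 < x < 1 -> L (RtoC x) = RtoC (prim_RL x / beta)).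
Proof.
intros Hb. destruct (solution_exists beta phi_RL Hb (subordinate_refl _ analytic_phi_RL)) as (L & l & L0 & HL & Hl & HD).
exists L, l. split; [|split; [|split; [|split]]]; auto.
intros x Hx. assert (Nb : RtoC beta <> 0) by (intros X; apply RtoC_inj in X; lra).
assert (Dx : forall t, 0 <= t <= 1 -> in_disk (segm 0 (RtoC x) t)).
{ intros t Ht. rewrite segm_0, <- RtoC_mult. unfold in_disk. rewrite Cmod_R. apply Rabs_def1; nra. }
(* On the real diameter [beta * L] and [prim_RL] obey the same equation and both vanish at 0, so
   their difference is constant. *)
assert (RD : forall t, 0 <= t <= 1 -> Rd (fun t => RtoC beta * L (segm 0 (RtoC x) t) + - RtoC (prim_RL (x * t)))%C t
   (RtoC beta * (l (segm 0 (RtoC x) t) * (RtoC x - 0)) + - RtoC (x * dprim_RL (x * t)))%C).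
{ intros t Ht. apply Rd_plus.
  - eapply Rd_eq. apply Rd_mult. apply Rd_const. apply (Rd_comp L (segm 0 (RtoC x))). apply Rd_segm. apply HL, Dx, Ht. cring.
  - rewrite <- RtoC_opp. apply (is_derive_ext (V := C_R_NormedModule) (fun t => (- prim_RL (x * t), 0))).
    { intros s. rewrite <- RtoC_opp. reflexivity. }
    apply (Rd_pair (fun t => - prim_RL (x * t)) (fun _ => 0)). 2: apply (is_derive_const (V := R_NormedModule)).
    apply (is_derive_opp (V := R_NormedModule) (fun t => prim_RL (x * t))). apply is_derive_prim_RL_lin. nra. }
pose proof (Rd_zero_const _ 0 1 Rle_0_1 (fun t Ht => Rd_continuous _ _ _ (RD t Ht))) as E. cbv beta in E.
replace (segm 0 (RtoC x) 1) with (RtoC x) in E by (rewrite segm_0; ring). replace (segm 0 (RtoC x) 0) with (RtoC 0) in E by (rewrite segm_0; ring).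
rewrite Rmult_0_r, Rmult_1_r, prim_RL_0, L0 in E.
rewrite RtoC_div by lra. transitivity ((RtoC beta * L (RtoC x) + - RtoC (prim_RL x) + RtoC (prim_RL x)) / RtoC beta)%C. field; auto.
rewrite E. field; auto.
intros t Ht. eapply Rd_eq. apply RD; lra.
match goal with |- @eq _ ?a ?b => change (@eq C a b) end.
assert (Nt : t <> 0) by lra. apply (RtoC_cancel t); auto.
assert (Ds := Dx t ltac:(lra)). specialize (Hl _ Ds). set (y := segm 0 (RtoC x) t) in *.
assert (Ey : y = RtoC (x * t)) by (unfold y; rewrite segm_0, RtoC_mult; ring).
transitivity (RtoC beta * (y * l y) - RtoC (x * t * dprim_RL (x * t)))%C.
- rewrite Ey at 2. rewrite !RtoC_mult. ring.
- rewrite Hl, Ey, phi_RL_real, x_dprim_RL by nra. rewrite RtoC_minus. ring.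
Qed.

(** [x0] acts both as the end point and as a sign, so one statement covers large values near 1 and
    very negative ones near -1. *)
Lemma prim_RL_near_endpoint (x0 y : R) : (x0 = 1 \/ x0 = -1) -> y < x0 * prim_RL x0 -> exists x, -1 < x < 1 /\ 0 < x0 * x /\ y <= x0 * prim_RL x.
Proof.
intros Hx0 Hy.
assert (Cx : continuity_pt prim_RL x0) by (apply continuous_prim_RL; lra).
destruct (Cx (x0 * prim_RL x0 - y)) as [d [Hd H]]. lra.
set (x := x0 * (1 - Rmin (d / 2) (1 / 2))).
assert (M1 := Rmin_l (d / 2) (1 / 2)). assert (M2 := Rmin_r (d / 2) (1 / 2)).
assert (M3 : 0 < Rmin (d / 2) (1 / 2)) by (apply Rmin_glb_lt; lra).
set (m := Rmin (d / 2) (1 / 2)) in *.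
exists x. split. { unfold x; destruct Hx0 as [-> | ->]; lra. }
split. { unfold x; destruct Hx0 as [-> | ->]; lra. }
specialize (H x). simpl in H. unfold R_dist in H.
assert (X : Rabs (prim_RL x - prim_RL x0) < x0 * prim_RL x0 - y).
{ apply H. split. split. exact I. unfold x; destruct Hx0 as [-> | ->]; lra.
  unfold x. destruct Hx0 as [-> | ->]. rewrite Rabs_left; lra. rewrite Rabs_right; lra. }
apply Rabs_def2 in X. destruct Hx0 as [-> | ->]; lra.
Qed.

Lemma in_disk_real x : -1 < x < 1 -> in_disk (RtoC x).
Proof. intros H. unfold in_disk. rewrite Cmod_R. apply Rabs_def1; lra. Qed.

Lemma sharp_a : sharp_bound cond_a bound_a.
Proof.
intros b Hb V. assert (Eb := bound_a_prim). destruct prim_RL_compare as [[E0 E1] E2].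
(* The maximum makes [beta] positive even for negative [b], while keeping it at least [b] and below
   the bound. *)
set (beta := Rmax b (bound_a / 2)). assert (B1 : b <= beta) by apply Rmax_l. assert (B2 : bound_a / 2 <= beta) by apply Rmax_r.
assert (B3 : beta < bound_a) by (apply Rmax_lub_lt; lra). assert (B0 : 0 < beta) by lra.
destruct (extremal_solution beta B0) as (L & l & L0 & HL & Hl & _ & HR).
destruct (class_A_of_log_quot (fun z => 1 + L z)%C) as (f & Hf & HP).
{ intros z Hz. eexists. apply Cd_plus. apply Cd_const. now apply HL. } { rewrite L0. ring. }
assert (SN : S_Ne f).
{ apply (V f beta); auto. exists phi_RL. split. 2: apply subordinate_refl, analytic_phi_RL.
  intros z Hz HRg.
  destruct (calG_of_log_quot f _ z (0 + l z)%C Hf HP Hz HRg) as [G _].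
  { apply Cd_plus. apply Cd_const. now apply HL. }
  rewrite HP by auto.
  replace (1 + RtoC beta * calG f z * (1 + L z))%C with (1 + RtoC beta * (calG f z * (1 + L z)))%C by ring.
  rewrite G. replace (phi_RL z) with (1 + (phi_RL z - 1))%C by ring. rewrite <- Hl by auto. ring. }
(* Below the bound the left end exceeds [2 / 3 * beta] in absolute value, so p reaches 1 - 2/3 = 1/3
   or less on the real line. *)
destruct (prim_RL_near_endpoint (-1) (2 / 3 * beta)) as [x [Hx [_ Hy]]]. auto. lra.
destruct (S_Ne_real f x (1 + prim_RL x / beta) SN (in_disk_real x Hx)) as [H _].
{ rewrite HP by now apply in_disk_real. rewrite HR by auto. now rewrite <- RtoC_plus. }
assert (prim_RL x / beta <= - (2 / 3)) by (apply div_le; lra). lra.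
Qed.

Lemma sharp_b : sharp_bound cond_b bound_b.
Proof.
intros b Hb V. assert (Eb := bound_b_prim). destruct prim_RL_compare as [[E0 E1] E2]. assert (X0 := ln_53_pos).
assert (P : 0 < bound_b) by (rewrite Eb; apply Rdiv_lt_0_compat; lra).
set (beta := Rmax b (bound_b / 2)). assert (B1 : b <= beta) by apply Rmax_l. assert (B2 : bound_b / 2 <= beta) by apply Rmax_r.
assert (B3 : beta < bound_b) by (apply Rmax_lub_lt; lra). assert (B0 : 0 < beta) by lra.
destruct (extremal_solution beta B0) as (L & l & L0 & HL & Hl & _ & HR).
assert (DP : forall z, in_disk z -> Cd (fun z => Cexp (L z)) z (Cexp (L z) * l z)%C).
{ intros z Hz. apply (Cd_comp Cexp L). now apply HL. apply Cd_Cexp. }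
destruct (class_A_of_log_quot (fun z => Cexp (L z))) as (f & Hf & HP).
{ intros z Hz. eexists. now apply DP. } { now rewrite L0, Cexp_0. }
assert (SN : S_Ne f).
{ apply (V f beta); auto. exists phi_RL. split. 2: apply subordinate_refl, analytic_phi_RL.
  intros z Hz HRg.
  destruct (calG_of_log_quot f _ z _ Hf HP Hz HRg (DP z Hz)) as [G N].
  replace (calG f z) with (z * l z)%C.
  - rewrite Hl by auto. ring.
  - transitivity (z * (Cexp (L z) * l z) / Cexp (L z))%C. field; auto. rewrite <- G. field; auto. }
destruct (prim_RL_near_endpoint 1 (beta * ln (5 / 3))) as [x [Hx [_ Hy]]]. auto.
{ rewrite Rmult_1_l. rewrite Eb in B3. now apply Rlt_div_r in B3. }
destruct (S_Ne_real f x (exp (prim_RL x / beta)) SN (in_disk_real x Hx)) as [_ H].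
{ rewrite HP by now apply in_disk_real. rewrite HR by auto. now rewrite Cexp_RtoC. }
assert (ln (5 / 3) <= prim_RL x / beta) by (apply le_div; lra).
apply exp_monotone in H0. rewrite exp_ln in H0; lra.
Qed.

Lemma sharp_c : sharp_bound cond_c bound_c.
Proof.
intros b Hb V. assert (Eb := bound_c_prim). destruct prim_RL_compare as [[E0 E1] E2].
(* [bound_c] is [5 / 2 * prim_RL 1]. A [beta] of at least [2 * prim_RL 1] keeps the right end of the
   disk for [L] below 1, so that 1 / (1 - L) is analytic. *)
set (beta := Rmax b (2 * prim_RL 1)). assert (B1 : b <= beta) by apply Rmax_l. assert (B2 : 2 * prim_RL 1 <= beta) by apply Rmax_r.
assert (B3 : beta < bound_c) by (apply Rmax_lub_lt; lra). assert (B0 : 0 < beta) by lra.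
destruct (extremal_solution beta B0) as (L & l & L0 & HL & Hl & HD & HR).
assert (N : forall z, in_disk z -> (1 - L z <> 0)%C).
{ intros z Hz E. pose proof (region_disc (L z) (Cmod z) beta (- prim_RL (-1) / beta) 1) as RD.
  assert (EL : L z = 1) by (replace (L z) with (1 - (1 - L z))%C by ring; rewrite E; ring).
  specialize (RD ltac:(split; [apply Cmod_ge_0|exact Hz]) B0 ltac:(right; field; lra) ltac:(lra) (HD z Hz)).
  rewrite EL in RD. simpl in RD. lra. }
assert (DP : forall z, in_disk z -> Cd (fun z => / (1 - L z))%C z (- (0 - l z) / ((1 - L z) * (1 - L z)))%C).
{ intros z Hz. apply (Cd_inv (fun z => 1 - L z)%C); auto. apply Cd_minus. apply Cd_const. now apply HL. }
destruct (class_A_of_log_quot (fun z => / (1 - L z))%C) as (f & Hf & HP).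
{ intros z Hz. eexists. now apply DP. } { rewrite L0. field. }
assert (SN : S_Ne f).
{ apply (V f beta); auto. exists phi_RL. split. 2: apply subordinate_refl, analytic_phi_RL.
  intros z Hz HRg.
  destruct (calG_of_log_quot f _ z _ Hf HP Hz HRg (DP z Hz)) as [G _]. specialize (N z Hz).
  rewrite HP by auto.
  replace (RtoC beta * calG f z * / / (1 - L z))%C with (RtoC beta * (calG f z * / (1 - L z)) * ((1 - L z) * (1 - L z)))%C by (field; auto).
  rewrite G. replace (phi_RL z) with (1 + (phi_RL z - 1))%C by ring. rewrite <- Hl by auto. field; auto. }
(* 1 / (1 - 2/5) = 5/3 is the right end of the real section of the nephroid domain. *)
destruct (prim_RL_near_endpoint 1 (2 / 5 * beta)) as [x [Hx [Hx0 Hy]]]. auto. lra.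
assert (E3 : prim_RL x < prim_RL 1) by (apply prim_RL_incr; lra).
assert (D1 : prim_RL x / beta < 1) by (apply Rlt_div_l; lra).
assert (D2 : 2 / 5 <= prim_RL x / beta) by (apply le_div; lra).
destruct (S_Ne_real f x (/ (1 - prim_RL x / beta)) SN (in_disk_real x Hx)) as [_ H].
{ rewrite HP by now apply in_disk_real. rewrite HR by auto. now rewrite <- RtoC_minus, RtoC_inv by lra. }
assert (5 / 3 <= / (1 - prim_RL x / beta)); [|lra].
replace (5 / 3) with (/ (3 / 5)) by field. apply Rinv_le_contravar; lra.
Qed.

Theorem corollary2p2 :
  (forall (f : C -> C) (beta : R), class_A f ->
     (bound_a <= beta -> cond_a beta f -> S_Ne f) /\
     (bound_b <= beta -> cond_b beta f -> S_Ne f) /\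
     (bound_c <= beta -> cond_c beta f -> S_Ne f)) /\
  sharp_bound cond_a bound_a /\
  sharp_bound cond_b bound_b /\
  sharp_bound cond_c bound_c.
Proof.
split; [|split; [exact sharp_a|split; [exact sharp_b|exact sharp_c]]].
intros f beta Hf. split; [|split]; intros.
- now apply (valid_a f beta).
- now apply (valid_b f beta).
- now apply (valid_c f beta).
Qed.
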